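(* Let $d\ge2$ be an integer, $S\subset C(\mathbf{k})$ a finite set, and $F\in K[x_1,\dots,x_n]$. Assume that $F$ cannot be written as $a\,\mathbf{x}^{\mathbf{i}}G^d$ for any $a\in K^*$, any monomial $\mathbf{x}^{\mathbf{i}}$ and any $G\in K[x_1,\dots,x_n]$. Then for any $u_1,\dots,u_n\in\mathcal{O}_S^*$ there exist a positive integer $m$ and rationals $c_1,c_2$, all depending only on $\bigl(d,n,\deg F,\max_{1\le j\le n}h(u_j)\bigr)$, such that: if $F(u_1^\ell,\dots,u_n^\ell)$ is a $d$-th power in $K$ for some integer $\ell\ge c_1\tilde h(F)+c_2\max\{1,2\mathfrak g-2+|S|\}$, then $u_1^{m_1}\cdots u_n^{m_n}\in\mathbf{k}$ for some $(m_1,\dots,m_n)\in\mathbb{Z}^n\setminus\{(0,\dots,0)\}$ with $\sum_i|m_i|\le 2m$.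
   Context: $\mathbf{k}$ is an algebraically closed field of characteristic zero, $C$ a smooth projective curve over $\mathbf{k}$ of genus $\mathfrak g$, $K=\mathbf{k}(C)$. For $\mathfrak p\in C(\mathbf{k})$, $v_{\mathfrak p}$ is the normalized order-of-vanishing valuation at $\mathfrak p$. For finite $S\subset C(\mathbf{k})$, $\mathcal{O}_S^*=\{f\in K^*: v_{\mathfrak p}(f)=0 \text{ for all } \mathfrak p\notin S\}$. For $f\in K^*$, $h(f)=\sum_{\mathfrak p}\max\{0,-v_{\mathfrak p}(f)\}$ (number of poles with multiplicity). For a nonzero $F=\sum a_{\mathbf i}\mathbf{x}^{\mathbf i}\in K[x_1,\dots,x_n]$, $v_{\mathfrak p}(F)=\min_{a_{\mathbf i}\ne0}v_{\mathfrak p}(a_{\mathbf i})$ and $\tilde h(F)=-\sum_{\mathfrak p}\min\{0,v_{\mathfrak p}(F)\}$. Notation $\mathbf{x}^{\mathbf i}=x_1^{i_1}\cdots x_n^{i_n}$. *)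

(* Defs.v *)
From HB Require Import structures.
From mathcomp Require Import all_boot all_order all_algebra.
From mathcomp.multinomials Require Import mpoly.
From Stdlib Require List.
From Stdlib Require Import ClassicalEpsilon.
Set Implicit Arguments. Unset Strict Implicit. Unset Printing Implicit Defensive.
Import Order.TTheory GRing.Theory Num.Theory.
Local Open Scope ring_scope.

Section FunctionField.
Variables (k : closedFieldType) (K : fieldType) (iota : {rmorphism k -> K}).

Definition ev2 (P : {poly {poly k}}) (x y : K) : K :=
  (map_poly (fun q : {poly k} => (map_poly iota q).[x]) P).[y].

(* K is a function field of one variable over k, i.e. K = k(C) for a smooth
   projective curve C: K = k(x,y), x transcendental over k, y algebraic over k(x). *)
Definition is_function_field : Prop :=
  exists x y : K,
    (forall p : {poly k}, p != 0 -> (map_poly iota p).[x] != 0) /\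
    (exists P : {poly {poly k}}, P != 0 /\ ev2 P x y = 0) /\
    (forall z : K, exists P Q : {poly {poly k}},
        ev2 Q x y != 0 /\ z = ev2 P x y / ev2 Q x y).

(* normalized discrete valuations of K trivial on k (= points of C(k));
   the value at 0 is fixed to 0 by convention (it is never used). *)
Definition is_place (v : K -> int) : Prop :=
  [/\ v 0 = 0,
      (forall a b, a != 0 -> b != 0 -> v (a * b) = v a + v b),
      (forall a b, a != 0 -> b != 0 -> a + b != 0 -> Num.min (v a) (v b) <= v (a + b)),
      (forall c, c != 0 -> v (iota c) = 0) &
      (exists t, v t = 1)].

Record place := Place { pval :> K -> int; pvalP : is_place pval }.

Definition fin_supp (f : place -> int) (s : seq place) : Prop :=
  List.NoDup s /\ forall P, f P != 0 -> List.In P s.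

Definition fsum (f : place -> int) : int :=
  match excluded_middle_informative (exists s, fin_supp f s) with
  | left H => \sum_(P <- proj1_sig (constructive_indefinite_description _ H)) f P
  | right _ => 0
  end.

Definition height (f : K) : int := fsum (fun P => Num.max 0 (- P f)).

(* divisors, Riemann-Roch spaces and the genus (Riemann's definition:
   g = max_D (deg D - l(D) + 1)) *)
Definition is_divisor (D : place -> int) : Prop := exists s, fin_supp D s.
Definition ddeg (D : place -> int) : int := fsum D.
Definition inL (D : place -> int) (f : K) : Prop := f = 0 \/ forall P, - D P <= P f.
Definition k_lin_indep (s : seq K) : Prop :=
  forall c : 'I_(size s) -> k,
    \sum_(i < size s) iota (c i) * s`_i = 0 -> forall i, c i = 0.
Definition ldim_ge (D : place -> int) (z : int) : Prop :=
  exists s : seq K, z <= (size s)%:Z /\ (forall f, f \in s -> inL D f) /\ k_lin_indep s.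
Definition is_genus (g : nat) : Prop :=
  (forall D, is_divisor D -> ldim_ge D (ddeg D + 1 - g%:Z)) /\
  (exists D, is_divisor D /\ ~ ldim_ge D (ddeg D + 2 - g%:Z)).

Definition S_unit (S : list place) (f : K) : Prop :=
  f != 0 /\ forall P, ~ List.In P S -> P f = 0.

Definition vpoly (n : nat) (P : place) (F : {mpoly K[n]}) : int :=
  match msupp F with
  | [::] => 0
  | m :: s => foldr (fun m' acc => Num.min (P (F@_m')) acc) (P (F@_m)) s
  end.

Definition htilde (n : nat) (F : {mpoly K[n]}) : int :=
  - fsum (fun P => Num.min 0 (vpoly P F)).
End FunctionField.

Definition mtdeg (n : nat) (R : ringType) (F : {mpoly R[n]}) : nat := (msize F).-1.

(* Main.v *)
Require Import Defs.
From HB Require Import structures.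
From mathcomp Require Import all_boot all_order all_algebra.
From mathcomp.multinomials Require Import mpoly.
From mathcomp Require Import zify ring.
From Stdlib Require List.
From Stdlib Require Import ClassicalEpsilon.
Set Implicit Arguments. Unset Strict Implicit. Unset Printing Implicit Defensive.
Import Order.TTheory GRing.Theory Num.Theory.
Local Open Scope ring_scope.

(* Write F = f^e h with f irreducible, not a monomial, prime to h, and d not dividing e.  Choose a
   derivation D of K with few poles (bounded by the genus and the height of some u_j) and extend it
   to K[x] compatibly with the evaluation x_j = u_j^l, the resulting operator being Dm.  If
   F(u^l) is a d-th power, then outside few places every zero of f(u^l) is also a zero of g(u^l),
   where g = h * Dm f is prime to f.

   Assume that the u_j satisfy no short multiplicative relation.  For large l, a polynomial with
   coefficients of small height cannot vanish at u^l, because its terms can be removed one by one by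
   dividing and differentiating.  This yields at least c l common zeros of f(u^l) and g(u^l).  In
   the other direction, the polynomials of degree at most N in the ideal (f, g) nearly fill the
   space of all polynomials of degree at most N.  Multiply a basis of them, evaluated at u^l, by a
   basis of the k-span of the monomials of degree at most q in the coefficients of f and g, where q
   is such that this span grows little from q to q + 1.  The Wronskian of the products vanishes at
   each common zero to order at least their number, while its poles at S almost cancel by the
   product formula.  So there are at most c' l common zeros, with c' < c. *)

(** The coefficients of f and g are functions, not constants, so multiplying a product by one of
    them leaves any fixed finite span of coefficient monomials; a span that grows by a factor close
    to 1 takes its place. A slot is a product of a basis element of that span with a monomial of
    degree at most N. The multiples of f alone would leave a fraction of order 1/N; the coprime pair
    (f, g) leaves one of order 1/N^2, which is why common zeros are counted. All constants must be
    fixed before the curve and F are known. The genus enters only through Riemann's inequality and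
    its sharpness for one divisor; the product formula, the finiteness of zeros and a derivation
    with controlled poles are derived from these. The poles of the derivation must be linear in the
    genus once the heights are bounded, so that max(1, 2g - 2 + |S|) absorbs them. *)

Lemma sum_pair (V : nmodType) (I J : finType) (F : I * J -> V) :
  \sum_ij F ij = \sum_i \sum_j F (i, j).
Proof. by rewrite pair_bigA; apply: eq_bigr => -[]. Qed.

(** * Linear dependence over the constant field *)

Section LinearAlgebra.
Variables (k K : fieldType) (iota : {rmorphism k -> K}).

Definition kfree (I : finType) (f : I -> K) :=
  forall c : I -> k, \sum_i iota (c i) * f i = 0 -> forall i, c i = 0.

Definition kspan (I : finType) (g : I -> K) (z : K) :=
  exists c : I -> k, z = \sum_i iota (c i) * g i.

Lemma span_dep (I J : finType) (f : I -> K) (g : J -> K) :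
  (forall i, kspan g (f i)) -> (#|J| < #|I|)%N ->
  exists c : I -> k, (exists i, c i != 0) /\ \sum_i iota (c i) * f i = 0.
Proof.
move=> fg ltJI.
pose h i := proj1_sig (constructive_indefinite_description _ (fg i)).
have hE i : f i = \sum_j iota (h i j) * g j.
  by rewrite /h; case: constructive_indefinite_description.
pose A := \matrix_(i < #|I|, j < #|J|) h (enum_val i) (enum_val j).
have kerN0 : kermx A != 0.
  rewrite kermx_eq0 /row_free neq_ltn; apply/orP; left.
  exact: leq_ltn_trans (rank_leq_col A) ltJI.
have [i0 [j0 ker_ij]] := matrix0Pn _ kerN0.
exists (fun i => kermx A i0 (enum_rank i)); split.
  by exists (enum_val j0); rewrite enum_valK.
have kA0 : row i0 (kermx A) *m A = 0 by rewrite -row_mul mulmx_ker row0.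
under eq_bigr => i _ do rewrite hE mulr_sumr.
rewrite exchange_big /= big1 // => j _.
under eq_bigr => i _ do rewrite mulrA -rmorphM.
rewrite -mulr_suml -rmorph_sum.
move/matrixP/(_ 0 (enum_rank j)): kA0; rewrite !mxE => kA0.
suff -> : \sum_i kermx A i0 (enum_rank i) * h i j = 0 by rewrite rmorph0 mul0r.
rewrite -[RHS]kA0 [RHS](reindex enum_rank) /=; last by apply: onW_bij; exact: enum_rank_bij.
by apply: eq_bigr => i _; rewrite !mxE !enum_rankK.
Qed.

Lemma kspan_sum (I J : finType) (g : I -> K) (c : J -> K) :
  (forall j, kspan g (c j)) -> kspan g (\sum_j c j).
Proof.
move=> H; pose h i := proj1_sig (constructive_indefinite_description _ (H i)).
have hE i : c i = \sum_j iota (h i j) * g j.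
  by rewrite /h; case: constructive_indefinite_description.
exists (fun i => \sum_j h j i); under eq_bigr => j _ do rewrite hE.
rewrite exchange_big; apply: eq_bigr => i _.
by rewrite rmorph_sum mulr_suml.
Qed.

Lemma kspanZ (I : finType) (g : I -> K) (a : k) z :
  kspan g z -> kspan g (iota a * z).
Proof.
case=> c ->; exists (fun i => a * c i); rewrite mulr_sumr.
by apply: eq_bigr => i _; rewrite rmorphM mulrA.
Qed.

Lemma kspan_id (I : finType) (g : I -> K) i : kspan g (g i).
Proof.
exists (fun j => (j == i)%:R); rewrite (bigD1 i) //= eqxx rmorph1 mul1r big1 ?addr0 //.
by move=> j /negPf ->; rewrite rmorph0 mul0r.
Qed.

End LinearAlgebra.

(** * Evaluation of bivariate polynomials and their bidegrees *)

Section BivariateEvaluation.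
Variables (k : closedFieldType) (K : fieldType) (iota : {rmorphism k -> K}).
Implicit Types (P Q : {poly {poly k}}) (x y : K).

Definition ev1 x (q : {poly k}) : K := (map_poly iota q).[x].

Lemma ev1_is_add x : additive (ev1 x).
Proof. by move=> p q; rewrite /ev1 rmorphB /= hornerD hornerN. Qed.
Lemma ev1_is_mul x : multiplicative (ev1 x).
Proof. by split=> [p q|]; rewrite /ev1 ?rmorphM ?rmorph1 /= ?hornerM ?hornerC. Qed.
HB.instance Definition _ x := GRing.isAdditive.Build _ _ (ev1 x) (ev1_is_add x).
HB.instance Definition _ x := GRing.isMultiplicative.Build _ _ (ev1 x) (ev1_is_mul x).

Lemma ev1C x c : ev1 x c%:P = iota c.
Proof. by rewrite /ev1 map_polyC hornerC. Qed.
Lemma ev1X x : ev1 x 'X = x.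
Proof. by rewrite /ev1 map_polyX hornerX. Qed.
Lemma ev1E x q : ev1 x q = \sum_(i < size q) iota q`_i * x ^+ i.
Proof.
rewrite /ev1 horner_coef size_map_poly.
by apply: eq_bigr => i _; rewrite coef_map.
Qed.

Lemma ev1E_wide x (q : {poly k}) m : (size q <= m)%N -> ev1 x q = \sum_(i < m) iota q`_i * x ^+ i.
Proof.
move=> le; rewrite /ev1 (@horner_coef_wide _ m) ?size_map_poly //.
by apply: eq_bigr => i _; rewrite coef_map.
Qed.

Definition ev x y P : K := ev2 iota P x y.
Lemma evE' x y P : ev x y P = (map_poly (ev1 x) P).[y].
Proof. by []. Qed.
Lemma ev_is_add x y : additive (ev x y).
Proof. by move=> p q; rewrite !evE' rmorphB /= hornerD hornerN. Qed.
Lemma ev_is_mul x y : multiplicative (ev x y).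
Proof. by split=> [p q|]; rewrite !evE' ?rmorphM ?rmorph1 /= ?hornerM ?hornerC. Qed.
HB.instance Definition _ x y := GRing.isAdditive.Build _ _ (ev x y) (ev_is_add x y).
HB.instance Definition _ x y := GRing.isMultiplicative.Build _ _ (ev x y) (ev_is_mul x y).
Lemma evC x y q : ev x y q%:P = ev1 x q.
Proof. by rewrite evE' map_polyC hornerC. Qed.
Lemma evX x y : ev x y 'X = y.
Proof. by rewrite evE' map_polyX hornerX. Qed.
Lemma evE x y P : ev x y P = \sum_(j < size P) ev1 x P`_j * y ^+ j.
Proof.
rewrite evE' (@horner_coef_wide _ (size P)) ?size_poly //.
by apply: eq_bigr => i _; rewrite coef_map.
Qed.
Lemma evE_wide x y P m : (size P <= m)%N -> ev x y P = \sum_(j < m) ev1 x P`_j * y ^+ j.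
Proof.
move=> le; rewrite evE' (@horner_coef_wide _ m); last exact: leq_trans (size_poly _ _) le.
by apply: eq_bigr => i _; rewrite coef_map.
Qed.

(** [b] bounds the degree in the outer variable, evaluated at [y], and [e] the degree in the inner
    variable, evaluated at [x]. *)
Definition bideg b e P := (size P <= b.+1)%N /\ forall j, (size (P`_j)%R <= e.+1)%N.

Lemma bidegM b e b' e' P Q : bideg b e P -> bideg b' e' Q -> bideg (b + b') (e + e') (P * Q).
Proof.
move=> [sP cP] [sQ cQ]; split.
  apply: leq_trans (size_polyMleq _ _) _; lia.
move=> j; rewrite coefM; apply: leq_trans (size_sum _ _ _) _.
apply/bigmax_leqP => i _; apply: leq_trans (size_polyMleq _ _) _.
by move: (cP i) (cQ (j - i)%N); lia.
Qed.

Lemma bideg1 : bideg 0 0 1.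
Proof.
split=> [|j]; first by rewrite size_poly1.
by rewrite coef1; case: (j == 0%N); rewrite ?size_poly1 ?size_poly0.
Qed.

Lemma bidegXn b e P m : bideg b e P -> bideg (m * b) (m * e) (P ^+ m).
Proof.
move=> bP; elim: m => [|m IH]; first by rewrite expr0 !mul0n; exact: bideg1.
by rewrite exprS !mulSn; exact: bidegM.
Qed.

Lemma bideg_le b e b' e' P : (b <= b')%N -> (e <= e')%N -> bideg b e P -> bideg b' e' P.
Proof. by move=> hb he [h1 h2]; split=> [|j]; [|move: (h2 j)]; lia. Qed.

Lemma bideg_ex P : exists b, bideg b b P.
Proof.
exists (maxn (size P) (\max_(i < size P) size (P`_i)%R)); split; first by rewrite leqW // leq_maxl.
move=> j; case: (ltnP j (size P)) => [lt|ge]; last by rewrite nth_default ?size_poly0.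
rewrite leqW // leq_max; apply/orP; right.
exact: (leq_bigmax (Ordinal lt)).
Qed.

End BivariateEvaluation.

(** * Transcendence degree one, by dimension counts *)

Section AlgebraicDependence.
Variables (k : closedFieldType) (K : fieldType) (iota : {rmorphism k -> K}).

Notation ev1 := (ev1 iota).
Notation ev := (ev iota).

Section Generators.
Variables (x y : K) (P : {poly {poly k}}).
Hypothesis x_trans : forall p : {poly k}, p != 0 -> ev1 x p != 0.
Hypothesis P_neq0 : P != 0.
Hypothesis Pxy : ev x y P = 0.

Let N := (size P).-1.

Lemma ev1_eq0 p : ev1 x p = 0 -> p = 0.
Proof. by move=> H; apply: contra_eq (@x_trans p) H. Qed.

(** A k-space spanned by N(m+1) products, a number linear in [m]; the counts below rest on this. *)
Definition inLam m z := exists p : 'I_N -> {poly k},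
  (forall i, (size (p i) <= m.+1)%N) /\ z = \sum_i ev1 x (p i) * y ^+ i.

Lemma inLamD m z z' : inLam m z -> inLam m z' -> inLam m (z + z').
Proof.
move=> [p [sp ->]] [p' [sp' ->]]; exists (fun i => p i + p' i); split=> [i|].
  by apply: leq_trans (size_polyD _ _) _; rewrite geq_max sp sp'.
by rewrite -big_split; apply: eq_bigr => i _; rewrite rmorphD mulrDl.
Qed.

Lemma inLam0 m : inLam m 0.
Proof.
exists (fun _ => 0); split=> [i|]; first by rewrite size_poly0.
by rewrite big1 // => i _; rewrite rmorph0 mul0r.
Qed.

Lemma inLam_sum (I : finType) m (z : I -> K) : (forall i, inLam m (z i)) -> inLam m (\sum_i z i).
Proof. by move=> H; apply: big_ind => //; [exact: inLam0 | exact: inLamD]. Qed.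

Lemma inLamM m m' (q : {poly k}) z : (size q <= m'.+1)%N -> inLam m z -> inLam (m' + m) (ev1 x q * z).
Proof.
move=> sq [p [sp ->]]; exists (fun i => q * p i); split=> [i|].
  by apply: leq_trans (size_polyMleq _ _) _; move: (sp i); lia.
by rewrite mulr_sumr; apply: eq_bigr => i _; rewrite rmorphM mulrA.
Qed.

Definition lamb m (ij : 'I_N * 'I_m.+1) : K := x ^+ ij.2 * y ^+ ij.1.

Lemma inLam_span m z : inLam m z -> kspan iota (@lamb m) z.
Proof.
move=> [p [sp ->]]; exists (fun ij : 'I_N * 'I_m.+1 => (p ij.1)`_ij.2).
rewrite sum_pair.
apply: eq_bigr => i _.
rewrite (ev1E_wide _ _ (sp i)) mulr_suml; apply: eq_bigr => j _.
by rewrite /lamb /= mulrA.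
Qed.

(** Multiplication by the leading coefficient of [P] trades the top power of y for lower ones and
    costs at most [e0] in the degree in x. Repeating this [b] times is enough for degree [b] in y,
    so the degree in x stays linear in the bidegree. *)
Lemma reduce : exists e0, forall b e (A : {poly {poly k}}), bideg b e A ->
  inLam (e + b * e0) (ev1 x (lead_coef P) ^+ b * ev x y A).
Proof.
have [e0 [_ Pe0]] := bideg_ex P; exists e0.
pose a := lead_coef P.
have sa : (size a <= e0.+1)%N by rewrite /a lead_coefE.
have N_gt0 : (0 < N)%N.
  rewrite lt0n; apply/eqP => N0.
  have sP : (size P <= 1)%N by move: N0; rewrite /N; lia.
  move: Pxy; rewrite (size1_polyC sP) evC => /ev1_eq0 P00.
  by move: P_neq0; rewrite (size1_polyC sP) P00 eqxx.
have Nlast : (size P = N.+1)%N by rewrite /N prednK // lt0n size_poly_eq0.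
have top : ev1 x a * y ^+ N = - \sum_(i < N) ev1 x P`_i * y ^+ i.
  apply/eqP; rewrite -addr_eq0 addrC; apply/eqP; rewrite -[RHS]Pxy evE Nlast big_ord_recr /=.
  by rewrite /a lead_coefE.
have mono : forall M j, (j < N + M)%N -> inLam (M * e0) (ev1 x a ^+ M * y ^+ j).
  elim=> [|M IH] j; rewrite ?addn0 => ltj.
    exists (fun i => (nat_of_ord i == j)%:R); split=> [i|].
      by case: (nat_of_ord i == j); rewrite ?size_poly1 ?size_poly0.
    rewrite (bigD1 (Ordinal ltj)) //= eqxx rmorph1 expr0 big1 ?addr0 // => i.
    by rewrite -val_eqE /= => /negPf ->; rewrite rmorph0 mul0r.
  case: (ltnP j (N + M)) => [lt|ge].
    by rewrite exprS -mulrA mulSn; apply: inLamM => //; apply: IH.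
  have -> : j = (N + M)%N by lia.
  have -> : ev1 x a ^+ M.+1 * y ^+ (N + M) =
      \sum_(i < N) ev1 x (- P`_i) * (ev1 x a ^+ M * y ^+ (M + i)).
    transitivity (ev1 x a ^+ M * y ^+ M * (ev1 x a * y ^+ N)).
      by rewrite exprD exprS; ring.
    rewrite top mulrN -mulNr mulr_sumr; apply: eq_bigr => i _.
    by rewrite rmorphN exprD /=; ring.
  apply: inLam_sum => i; rewrite mulSn; apply: inLamM; first by rewrite size_polyN.
  apply: IH; move: (ltn_ord i); lia.
move=> b e A [sA cA].
rewrite (evE_wide _ _ _ sA) mulr_sumr; apply: inLam_sum => j.
rewrite mulrCA; apply: inLamM => //; apply: mono.
move: (ltn_ord j); lia.
Qed.

Hypothesis gen : forall z : K, exists A B : {poly {poly k}},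
  ev x y B != 0 /\ z = ev x y A / ev x y B.

Lemma common_denominator m (z : 'I_m -> K) : exists (C : {poly {poly k}}) (A : 'I_m -> {poly {poly k}}) b,
  [/\ ev x y C != 0, forall i, z i = ev x y (A i) / ev x y C, bideg b b C
    & forall i, bideg b b (A i)].
Proof.
pose AB i := constructive_indefinite_description _ (gen (z i)).
pose A i := proj1_sig (AB i).
pose BB i := constructive_indefinite_description _ (proj2_sig (AB i)).
pose B i := proj1_sig (BB i).
have HB i : ev x y (B i) != 0 /\ z i = ev x y (A i) / ev x y (B i) by exact: (proj2_sig (BB i)).
pose C := \prod_i B i.
have C0 : ev x y C != 0.
  by rewrite rmorph_prod; apply/prodf_neq0 => i _; case: (HB i).
pose A' i := A i * \prod_(j | j != i) B j.
have [bC HbC] := bideg_ex C.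
pose bA i := proj1_sig (constructive_indefinite_description _ (bideg_ex (A' i))).
have HbA i : bideg (bA i) (bA i) (A' i).
  by rewrite /bA; case: constructive_indefinite_description.
exists C, A', (maxn bC (\max_i bA i)); split=> //.
- move=> i; have [Bi ->] := HB i.
  apply/eqP; rewrite eqr_div // /A' /C (bigD1 i) //= !rmorphM /=; apply/eqP; ring.
- by apply: bideg_le HbC; rewrite leq_maxl.
- by move=> i; apply: bideg_le (HbA i); rewrite leq_max (leq_bigmax i) orbT.
Qed.

(** Cleared of denominators, the (m+1)^2 products z1^i z2^j lie in a space whose dimension is linear
    in m. The value m = 2NE + N makes the quadratic count win. *)
Lemma alg_dep_gen (z1 z2 : K) : exists G, G != 0 /\ ev z1 z2 G = 0.
Proof.
have [C [A [b [C0 zE bC bA]]]] := common_denominator (fun i : 'I_2 => if i == 0 then z1 else z2).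
have [e0 red] := reduce.
pose a := ev1 x (lead_coef P).
have a0 : a != 0 by apply: x_trans; rewrite lead_coef_eq0.
pose E := (b + b * e0)%N.
pose m := (2 * N * E + N)%N.
pose c := ev x y C.
pose f (ij : 'I_m.+1 * 'I_m.+1) : K := a ^+ (2 * m * b) * (z1 ^+ ij.1 * z2 ^+ ij.2 * c ^+ (2 * m)).
have E1 : z1 * c = ev x y (A 0) by have := zE 0; rewrite eqxx => ->; rewrite divfK.
have E2 : z2 * c = ev x y (A 1) by have := zE 1; rewrite /= => ->; rewrite divfK.
have fL ij : kspan iota (@lamb (2 * m * b + 2 * m * b * e0)) (f ij).
  case: ij => i j; apply: inLam_span.
  suff -> : f (i, j) = a ^+ (2 * m * b) * ev x y (A 0 ^+ i * A 1 ^+ j * C ^+ (2 * m - i - j)).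
    apply: red; have -> : (2 * m * b = i * b + j * b + (2 * m - i - j) * b)%N.
      by rewrite -!mulnDl; congr (_ * _)%N; move: (ltn_ord i) (ltn_ord j); lia.
    by apply: bidegM; [apply: bidegM|]; apply: bidegXn.
  rewrite /f /=; congr (_ * _).
  rewrite !rmorphM !rmorphXn /= -/c -E1 -E2 !exprMn.
  have -> : c ^+ (2 * m) = c ^+ i * c ^+ j * c ^+ (2 * m - i - j).
    by rewrite -!exprD; congr (_ ^+ _); move: (ltn_ord i) (ltn_ord j); lia.
  ring.
have [|g [[ij gij] gsum]] := span_dep fL.
  rewrite !card_prod !card_ord -mulnA.
  have -> : (2 * (m * b) + 2 * (m * b) * e0 = 2 * m * E)%N by rewrite /E; nia.
  have : (N * (2 * m * E).+1 = 2 * N * E * m + N)%N by nia.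
  move=> ->; have : (2 * N * E <= m)%N by rewrite /m; lia.
  have : (N <= m)%N by rewrite /m; lia.
  nia.
pose G := \poly_(j < m.+1) \poly_(i < m.+1) g (inord i, inord j).
exists G; split.
  apply: contra_neq gij => G0; case: ij => i j.
  have := congr1 (fun G : {poly {poly k}} => (G`_j)`_i) G0; rewrite !coef0 => <-.
  by rewrite !coef_poly !ltn_ord coef_poly ltn_ord !inord_val.
have ac0 : a ^+ (2 * m * b) * c ^+ (2 * m) != 0 by rewrite mulf_neq0 // expf_neq0.
apply: (mulfI ac0); rewrite mulr0 -[RHS]gsum (evE_wide _ _ _ (size_poly _ _)) mulr_sumr.
rewrite sum_pair exchange_big /=.
apply: eq_bigr => j _; rewrite coef_poly ltn_ord (ev1E_wide _ _ (size_poly _ _)) mulr_suml mulr_sumr.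
apply: eq_bigr => i _; rewrite coef_poly ltn_ord !inord_val /f /=.
ring.
Qed.

(** The degree of K over k(x) is at most N: the (N+1)(m+1) products x^j z_i, cleared of
    denominators, lie in a space of dimension at most N(m+E+1), which is smaller as soon as m =
    NE. *)
Lemma dep_over_kx (z : 'I_N.+1 -> K) :
  exists p : 'I_N.+1 -> {poly k}, (exists i, p i != 0) /\ \sum_i ev1 x (p i) * z i = 0.
Proof.
have [C [A [b [C0 zE bC bA]]]] := common_denominator z.
have [e0 red] := reduce.
pose a := ev1 x (lead_coef P).
have a0 : a != 0 by apply: x_trans; rewrite lead_coef_eq0.
pose E := (b + b * e0)%N.
pose m := (N * E)%N.
pose f (ij : 'I_N.+1 * 'I_m.+1) : K := a ^+ b * (x ^+ ij.2 * (z ij.1 * ev x y C)).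
have fL ij : kspan iota (@lamb (m + E)) (f ij).
  case: ij => i j; apply: inLam_span.
  suff -> : f (i, j) = ev1 x ('X^j) * (a ^+ b * ev x y (A i)).
    apply: inLamM; last exact: red.
    by rewrite size_polyXn; apply: ltn_ord.
  by rewrite /f /= zE divfK // rmorphXn /= ev1X mulrCA.
have [|g [[[i j] gij] gsum]] := span_dep fL.
  rewrite !card_prod !card_ord /m; nia.
exists (fun i => \poly_(j < m.+1) g (i, inord j)); split.
  exists i; apply: contra_neq gij => G0.
  have := congr1 (fun G : {poly k} => G`_j) G0; rewrite !coef0 => <-.
  by rewrite coef_poly ltn_ord inord_val.
have ac0 : a ^+ b * ev x y C != 0 by rewrite mulf_neq0 // expf_neq0.
apply: (mulfI ac0); rewrite mulr0 -[RHS]gsum mulr_sumr.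
rewrite sum_pair.
apply: eq_bigr => i' _; rewrite (ev1E_wide _ _ (size_poly _ _)) mulr_suml mulr_sumr.
apply: eq_bigr => j' _; rewrite coef_poly ltn_ord inord_val /f /=.
ring.
Qed.

End Generators.

Hypothesis ff : is_function_field iota.

Lemma alg_dep (z1 z2 : K) : exists G, G != 0 /\ ev z1 z2 G = 0.
Proof.
case: ff => x [y [tr [[P [P0 Pxy]] gen]]].
exact: (alg_dep_gen tr P0 Pxy gen).
Qed.

End AlgebraicDependence.

(* lia compares atoms syntactically; terms P f may differ by convertible canonical instances *)
Ltac plia :=
  repeat match goal with H : context [bigop] |- _ => revert H end;
  repeat match goal with H : context [pval _ _] |- _ => revert H end;
  repeat match goal with |- context [@bigop ?R ?I ?z ?r ?F] => move: (@bigop R I z r F) => ? end;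
  repeat match goal with |- context [pval ?P ?f] => move: (pval P f) => ? end; lia.

(** * Places: ultrametric calculus, residues, orders *)

Section Places.
Variables (k : closedFieldType) (K : fieldType) (iota : {rmorphism k -> K}).
Notation place := (place iota).
Notation ev1 := (ev1 iota).
Notation ev := (ev iota).

Lemma place_eq_dec (P Q : place) : {P = Q} + {P <> Q}.
Proof. exact: excluded_middle_informative. Qed.
Lemma place_eqP : Equality.axiom (fun P Q : place => if place_eq_dec P Q then true else false).
Proof. by move=> P Q; case: place_eq_dec => H; constructor. Qed.
HB.instance Definition _ := hasDecEq.Build place place_eqP.

Lemma List_InP (T : eqType) (x : T) (s : seq T) : List.In x s <-> x \in s.
Proof.
elim: s => //= y s IH; rewrite inE IH; split=> [[->|->]|/orP[/eqP ->|]]; rewrite ?eqxx ?orbT //; by [left|right].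
Qed.

Lemma List_NoDupP (T : eqType) (s : seq T) : List.NoDup s <-> uniq s.
Proof.
elim: s => /= [|y s IH]; first by split=> // _; exact: List.NoDup_nil.
rewrite List.NoDup_cons_iff IH List_InP; split=> [[/negP -> ->] //|/andP[/negP]]; by split.
Qed.

Implicit Types (P Q : place) (f h : K) (m : int).

Lemma placeM P f h : f != 0 -> h != 0 -> P (f * h) = P f + P h.
Proof. by case: P => v [? H ? ? ?]; exact: H. Qed.
Lemma placeD P f h : f != 0 -> h != 0 -> f + h != 0 -> Num.min (P f) (P h) <= P (f + h).
Proof. by case: P => v [? ? H ? ?]; exact: H. Qed.
Lemma placeC P (c : k) : c != 0 -> P (iota c) = 0.
Proof. by case: P => v [? ? ? H ?]; exact: H. Qed.
Lemma place0 P : P 0 = 0.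
Proof. by case: P => v []. Qed.
Lemma place_unif P : exists t, t != 0 /\ P t = 1.
Proof.
case: P => v [v0 ? ? ? [t vt]]; exists t; split=> //.
by apply: contra_eq_neq vt => /= ->; rewrite v0.
Qed.
Lemma place1 P : P 1 = 0.
Proof. by rewrite -(rmorph1 iota) placeC // oner_neq0. Qed.
Lemma placeN P f : P (- f) = P f.
Proof.
case: (eqVneq f 0) => [->|f0]; first by rewrite oppr0.
rewrite -mulN1r placeM ?oppr_eq0 ?oner_neq0 //.
by rewrite -(rmorph1 iota) -rmorphN placeC ?add0r // oppr_eq0 oner_neq0.
Qed.
Lemma placeV P f : f != 0 -> P f^-1 = - P f.
Proof.
move=> f0; apply/eqP; rewrite -addr_eq0 -placeM ?invr_eq0 // mulVf // place1 //.
Qed.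
Lemma placeX P f (n : nat) : f != 0 -> P (f ^+ n) = n%:Z * P f.
Proof.
move=> f0; elim: n => [|n IH]; first by rewrite expr0 place1 mul0r.
by rewrite exprS placeM ?expf_neq0 // IH; plia.
Qed.
Lemma placeXz P f (z : int) : f != 0 -> P (f ^ z) = z * P f.
Proof.
move=> f0; case: z => n; first exact: placeX.
by rewrite NegzE -exprz_inv -exprnP placeX ?invr_eq0 // placeV //; plia.
Qed.
Lemma place_prod P (I : Type) (r : seq I) (F : I -> K) :
  (forall i, F i != 0) -> P (\prod_(i <- r) F i) = \sum_(i <- r) P (F i).
Proof.
move=> F0; elim: r => [|i r IH]; first by rewrite !big_nil place1.
rewrite !big_cons placeM ?IH //.
by elim: r {IH} => [|j r IH]; rewrite ?big_nil ?oner_neq0 // big_cons mulf_neq0.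
Qed.

(* The junk value v(0) = 0 is avoided by this encoding of "v(f) >= m", in which 0 has valuation +oo. *)
Definition vge P m f := (f == 0) || (m <= P f).

Lemma vge0 P m : vge P m 0. Proof. by rewrite /vge eqxx. Qed.
Lemma vgeE P m f : f != 0 -> vge P m f = (m <= P f).
Proof. by rewrite /vge => /negPf ->. Qed.
Lemma vge_self P f : vge P (P f) f. Proof. by rewrite /vge lexx orbT. Qed.
Lemma vgeW P m m' f : m' <= m -> vge P m f -> vge P m' f.
Proof. by rewrite /vge => le /orP[-> //|H]; rewrite (le_trans le H) orbT. Qed.
Lemma vgeD P m f h : vge P m f -> vge P m h -> vge P m (f + h).
Proof.
case: (eqVneq f 0) => [->|f0]; first by rewrite add0r.
case: (eqVneq h 0) => [->|h0]; first by rewrite addr0.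
case: (eqVneq (f + h) 0) => [->|fh0]; first by rewrite vge0.
by rewrite !vgeE // => H1 H2; apply: le_trans (placeD P f0 h0 fh0); rewrite le_min H1.
Qed.
Lemma vgeN P m f : vge P m (- f) = vge P m f.
Proof. by rewrite /vge oppr_eq0 placeN. Qed.
Lemma vgeB P m f h : vge P m f -> vge P m h -> vge P m (f - h).
Proof. by move=> H1 H2; apply: vgeD; rewrite ?vgeN. Qed.
Lemma vgeM P m m' f h : vge P m f -> vge P m' h -> vge P (m + m') (f * h).
Proof.
case: (eqVneq f 0) => [->|f0]; first by rewrite mul0r !vge0.
case: (eqVneq h 0) => [->|h0]; first by rewrite mulr0 !vge0.
rewrite !vgeE ?mulf_neq0 // placeM //; exact: lerD.
Qed.
Lemma vgeC P c : vge P 0 (iota c).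
Proof.
case: (eqVneq c 0) => [->|c0]; first by rewrite rmorph0 vge0.
by rewrite vgeE ?fmorph_eq0 // placeC.
Qed.
Lemma vge1 P : vge P 0 1.
Proof. by rewrite -(rmorph1 iota) vgeC. Qed.
Lemma vgeZ P m c f : vge P m f -> vge P m (iota c * f).
Proof. by move=> H; rewrite -[m]add0r vgeM ?vgeC. Qed.
Lemma vge_sum P m (I : Type) (r : seq I) (p : pred I) (F : I -> K) :
  (forall i, p i -> vge P m (F i)) -> vge P m (\sum_(i <- r | p i) F i).
Proof. by move=> H; elim/big_ind: _ => //; [exact: vge0 | move=> ? ?; exact: vgeD]. Qed.
Lemma vgeX P m f (n : nat) : vge P m f -> vge P (n%:Z * m) (f ^+ n).
Proof.
move=> H; elim: n => [|n IH]; first by rewrite expr0 mul0r; exact: vge1.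
rewrite exprS; have -> : n.+1%:Z * m = m + n%:Z * m by rewrite intS mulrDl mul1r.
exact: vgeM.
Qed.
Lemma vge0M P f h : vge P 0 f -> vge P 0 h -> vge P 0 (f * h).
Proof. by move=> H1 H2; rewrite -[0]addr0 vgeM. Qed.
Lemma vge0X P f (n : nat) : vge P 0 f -> vge P 0 (f ^+ n).
Proof. by move/(vgeX n); rewrite mulr0. Qed.
Lemma vge_mulr P m h f : h != 0 -> vge P (m + P h) (f * h) = vge P m f.
Proof.
move=> h0; rewrite /vge mulf_eq0 (negPf h0) orbF.
case: (eqVneq f 0) => //= f0; rewrite placeM //; plia.
Qed.
Lemma vge_nat P (n : nat) : vge P 0 n%:R.
Proof. by rewrite -(rmorph_nat iota) vgeC. Qed.
Lemma vge_ev1 P x q : vge P 0 x -> vge P 0 (ev1 x q).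
Proof.
by move=> Hx; rewrite ev1E; apply: vge_sum => i _; apply: vgeZ; apply: vge0X.
Qed.
Lemma vge_ev P x y q : vge P 0 x -> vge P 0 y -> vge P 0 (ev x y q).
Proof.
by move=> Hx Hy; rewrite evE; apply: vge_sum => i _; apply: vge0M; [exact: vge_ev1|exact: vge0X].
Qed.

(** The strict ultrametric rule. Its main use is to show that a sum with a single term of least
    order is nonzero. *)
Lemma place_add_lt P f h : f != 0 -> vge P (P f + 1) h -> f + h != 0 /\ P (f + h) = P f.
Proof.
move=> f0 Hh; have fh0 : f + h != 0.
  apply/eqP => fh; move: Hh; have -> : h = - f by rewrite -[h]addr0 -(subrr f) addrA (addrC h) fh sub0r.
  by rewrite vgeN vgeE //; plia.
split=> //; apply/eqP; rewrite eq_le; apply/andP; split; last first.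
  rewrite -vgeE //; apply: vgeD; first exact: vge_self.
  by apply: vgeW Hh; plia.
rewrite leNgt; apply/negP => lt.
have : vge P (P f + 1) f; last by rewrite vgeE //; plia.
rewrite -[X in vge _ _ X](addrK h); apply: vgeB => //.
by rewrite (vgeE _ _ fh0); plia.
Qed.

Definition nonconst f := forall c, f != iota c.

Lemma nonconst_neq0 f : nonconst f -> f != 0.
Proof. by move/(_ 0); rewrite rmorph0. Qed.

Lemma nonconstP f : nonconst f \/ exists c, f = iota c.
Proof.
case: (excluded_middle_informative (exists c, f = iota c)) => H; [by right|left=> c].
by apply/eqP => E; apply: H; exists c.
Qed.

Lemma nonconst_trans f p : nonconst f -> p != 0 -> ev1 f p != 0.
Proof.
move=> nf p0; have [r ->] := closed_field_poly_normal p.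
rewrite -mul_polyC rmorphM /= ev1C mulf_neq0 ?fmorph_eq0 ?lead_coef_eq0 //.
rewrite rmorph_prod /=; elim: r => [|c r IH]; rewrite ?big_nil ?oner_neq0 //.
by rewrite big_cons mulf_neq0 // rmorphB /= ev1X ev1C subr_eq0.
Qed.

Hypothesis ff : is_function_field iota.

(** If no f - c vanished at [P], every nonzero polynomial in f would have order 0, since it splits
    into linear factors over k. In an algebraic relation between f and a uniformizer t the terms
    G_j(f) t^j would then have distinct orders, and their sum could not be 0. *)
Lemma residue P f : vge P 0 f -> exists c, vge P 1 (f - iota c).
Proof.
move=> f_int; case: (excluded_middle_informative (exists c, vge P 1 (f - iota c))) => // no.
have no' c : ~~ vge P 1 (f - iota c) by apply/negP => H; apply: no; exists c.
have nf : nonconst f.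
  by move=> c; apply/eqP => E; move: (no' c); rewrite E subrr vge0.
have vunit p : p != 0 -> P (ev1 f p) = 0.
  move=> p0; have [r ->] := closed_field_poly_normal p.
  rewrite -mul_polyC rmorphM /= ev1C.
  have pr0 : ev1 f (\prod_(z <- r) ('X - z%:P)) != 0.
    by apply: nonconst_trans => //; rewrite monic_neq0 // monic_prod_XsubC.
  rewrite placeM ?fmorph_eq0 ?lead_coef_eq0 // placeC ?lead_coef_eq0 // add0r.
  rewrite rmorph_prod /= place_prod; last first.
    by move=> c; rewrite rmorphB /= ev1X ev1C subr_eq0.
  rewrite big1 // => c _; rewrite rmorphB /= ev1X ev1C.
  have fc0 : f - iota c != 0 by rewrite subr_eq0.
  move: (no' c); rewrite vgeE //.
  have : vge P 0 (f - iota c) by apply: vgeB => //; exact: vgeC.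
  by rewrite vgeE //; plia.
have [t [t0 vt]] := place_unif P.
have [G [G0 Gft]] := alg_dep ff f t.
have [j [Gj minj]] : exists j, G`_j != 0 /\ forall i, (i < j)%N -> G`_i = 0.
  have ex : exists j, G`_j != 0.
    by exists (size G).-1; rewrite -lead_coefE lead_coef_eq0.
  case: (ex_minnP ex) => j Gj minj; exists j; split=> // i lt.
  by apply/eqP/negPn/negP => H; move: (minj _ H); plia.
have ltj : (j < size G)%N by rewrite ltnNge; apply: contraNN Gj => le; rewrite nth_default.
have : ev f t G != 0; last by rewrite Gft eqxx.
rewrite evE (bigD1 (Ordinal ltj)) //=.
apply: (proj1 (place_add_lt (P := P) _ _)).
  by rewrite mulf_neq0 ?expf_neq0 // nonconst_trans.
rewrite placeM ?expf_neq0 ?nonconst_trans // vunit // placeX // vt.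
apply: vge_sum => i; rewrite -val_eqE /= => ij.
case: (ltnP i j) => [lt|ge]; first by rewrite minj // rmorph0 mul0r vge0.
case: (eqVneq G`_i 0) => [->|Gi]; first by rewrite rmorph0 mul0r vge0.
rewrite vgeE ?mulf_neq0 ?expf_neq0 ?nonconst_trans //.
rewrite placeM ?expf_neq0 ?nonconst_trans // vunit // placeX // vt; plia.
Qed.

Lemma residue_quot P f h : f != 0 -> vge P (P f) h -> exists c, vge P (P f + 1) (h - iota c * f).
Proof.
move=> f0 Hh.
have [|c Hc] := @residue P (h / f).
  by rewrite -(@vge_mulr P _ f) // add0r divfK.
exists c; have -> : h - iota c * f = (h / f - iota c) * f by rewrite mulrBl divfK.
by rewrite addrC vge_mulr.
Qed.

Definition ksubspace (V : K -> Prop) :=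
  V 0 /\ forall (a : k) f h, V f -> V h -> V (iota a * f + h).

Lemma seq_min_ord P n (f : 'I_n.+1 -> K) : exists p, forall i, P (f p) <= P (f i).
Proof.
have [p _ Hp] := @Order.TotalTheory.arg_minP _ _ 'I_n.+1 ord0 xpredT (fun i => P (f i)) isT.
by exists p => i; apply: Hp.
Qed.

Lemma kfree_neq0 (I : finType) (f : I -> K) i : kfree iota f -> f i != 0.
Proof.
move=> H; apply/eqP => fi0; have := H (fun j => (j == i)%:R).
rewrite (bigD1 i) //= eqxx fi0 mulr0 big1 ?addr0; last by move=> j /negPf ->; rewrite rmorph0 mul0r.
by move/(_ erefl i)/eqP; rewrite eqxx oner_eq0.
Qed.

(** Gaussian elimination: an element of least order is the pivot, residues remove its leading part
    from the others, and the recursion runs in the subspace of elements of larger order. *)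
Lemma distinct_orders P n (f : 'I_n -> K) (V : K -> Prop) :
  kfree iota f -> ksubspace V -> (forall i, V (f i)) ->
  exists h : 'I_n -> K,
    [/\ forall i, V (h i), forall i, h i != 0 &
        forall i j : 'I_n, (i < j)%N -> P (h i) < P (h j)].
Proof.
elim: n f V => [|n IH] f V ff0 sV Vf; first by exists f; split=> //; case.
have [p Hp] := seq_min_ord P f.
have fp0 := kfree_neq0 p ff0.
pose piv i := constructive_indefinite_description _ (@residue_quot P (f p) (f i) fp0
  (@vgeW P _ _ _ (Hp i) (vge_self P (f i)))).
pose c i := proj1_sig (piv i).
have Hc i : vge P (P (f p) + 1) (f i - iota (c i) * f p) by exact: (proj2_sig (piv i)).
pose f' (j : 'I_n) := f (lift p j) - iota (c (lift p j)) * f p.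
pose V' z := V z /\ vge P (P (f p) + 1) z.
have [||j|h [hV h0 hlt]] := IH f' V'.
- move=> a; rewrite /f'.
  under eq_bigr => j _ do rewrite mulrBr mulrA -rmorphM.
  rewrite sumrB -mulr_suml -rmorph_sum => E.
  pose b i := if unlift p i is Some j then a j else - \sum_(i < n) a i * c (lift p i).
  have : \sum_i iota (b i) * f i = 0.
    rewrite (bigD1_ord p) //= {1}/b unlift_none rmorphN mulNr addrC -[RHS]E; congr (_ - _).
    by apply: eq_bigr => j _; rewrite /b liftK.
  move/ff0 => B j; have := B (lift p j); by rewrite /b liftK.
- split; first by split; [case: sV | exact: vge0].
  move=> a z z' [Vz vz] [Vz' vz']; split; first by case: sV => _; apply.
  by apply: vgeD => //; apply: vgeZ.
- split; last exact: Hc.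
  by rewrite /f' addrC -mulNr -rmorphN; case: sV => _; apply.
exists (fun i => if unlift ord0 i is Some j then h j else f p); split.
- by move=> i; case: unliftP => [j _|_] //; case: (hV j).
- by move=> i; case: unliftP.
- move=> i j; case: unliftP => [i' ->|->]; case: unliftP => [j' ->|->] //=.
    by rewrite /bump /= !add1n ltnS => /hlt.
  by move=> _; have [_] := hV j'; rewrite vgeE //; plia.
Qed.

End Places.

(** * Consequences of Riemann's inequality: product formula, finite supports *)

Section Genus.
Variables (k : closedFieldType) (K : fieldType) (iota : {rmorphism k -> K}).
Notation place := (place iota).
Notation ev1 := (ev1 iota).
Notation ev := (ev iota).
Implicit Types (P Q : place) (f h : K) (m : int) (D : place -> int).

Definition covers (s : seq place) (D : place -> int) := uniq s /\ forall P, P \notin s -> D P = 0.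

Lemma covers_fin_supp s D : covers s D <-> fin_supp D s.
Proof.
split=> [[us H]|[us H]]; split; rewrite ?List_NoDupP // in us *.
  move=> P DP; apply/List_InP; apply: contraNT DP => nP; apply/eqP; exact: H.
by move=> P; apply: contraNeq => /H /List_InP.
Qed.

Lemma sum_covers s s' D : covers s D -> covers s' D -> \sum_(P <- s) D P = \sum_(P <- s') D P.
Proof.
move=> [us Hs] [us' Hs'].
have red t : \sum_(P <- t) D P = \sum_(P <- [seq P <- t | D P != 0]) D P.
  rewrite big_filter [RHS]big_mkcond; apply: eq_bigr => P _.
  by case: eqVneq => [->|].
rewrite (red s) (red s'); apply: perm_big; apply: uniq_perm; rewrite ?filter_uniq // => P.
rewrite !mem_filter; case: eqVneq => //= DP.
have -> : P \in s by apply: contraT => /Hs E; rewrite E eqxx in DP.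
by have -> : P \in s' by apply: contraT => /Hs' E; rewrite E eqxx in DP.
Qed.

Lemma fsumE s D : covers s D -> fsum D = \sum_(P <- s) D P.
Proof.
move=> cs; rewrite /fsum; case: excluded_middle_informative => [H|H].
  case: constructive_indefinite_description => s' /= /covers_fin_supp cs'; exact: sum_covers.
by case: H; exists s; apply/covers_fin_supp.
Qed.

Lemma covers_sub s s' D : covers s D -> uniq s' -> {subset s <= s'} -> covers s' D.
Proof. by move=> [us H] us' sub; split=> // P nP; apply: H; apply: contra nP; exact: sub. Qed.

Lemma covers_undup s D : (forall P, P \notin s -> D P = 0) -> covers (undup s) D.
Proof. by move=> H; split; [exact: undup_uniq | move=> P; rewrite mem_undup; exact: H]. Qed.

Definition inLs D f := forall P, vge P (- D P) f.

Lemma inLsE D f : inL D f <-> inLs D f.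
Proof.
split=> [[->|H] P|H]; [exact: vge0 | by rewrite /vge H orbT |].
case: (eqVneq f 0) => [->|f0]; [by left|right=> P].
by move: (H P); rewrite vgeE.
Qed.

Lemma inLs_subspace D : ksubspace iota (inLs D).
Proof.
split=> [P|a f h Hf Hh P]; first exact: vge0.
by apply: vgeD => //; apply: vgeZ.
Qed.

Lemma kfree_nth (s : seq K) n : k_lin_indep iota s -> (n <= size s)%N ->
  kfree iota (fun i : 'I_n => s`_i).
Proof.
move=> ind le c E i.
pose F (j : nat) := oapp c 0 (insub j : option 'I_n).
have FE (j : 'I_n) : F j = c j by rewrite /F valK.
have E' : \sum_(j < size s) iota (F j) * s`_j = 0.
  rewrite -[RHS]E; under [RHS]eq_bigr => j _ do rewrite -FE.
  rewrite (big_ord_widen _ (fun j => iota (F j) * s`_j) le) [LHS](bigID (fun j : 'I_(size s) => (j < n)%N)) /=.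
  rewrite [X in _ + X]big1 ?addr0 // => j ge.
  by rewrite /F insubF ?rmorph0 ?mul0r //; apply: negbTE.
by have := ind (fun j => F j) E' (widen_ord le i); rewrite /= FE.
Qed.

Variables (g : nat).
Hypothesis ff : is_function_field iota.
Hypothesis hg : is_genus iota g.

Lemma riemann s D (n : nat) : covers s D -> n%:Z <= \sum_(P <- s) D P + 1 - g%:Z ->
  exists f : 'I_n -> K, kfree iota f /\ forall i, inLs D (f i).
Proof.
move=> cs le; case: hg => H _.
have [|t [szt [tL tind]]] := H D; first by exists s; apply/covers_fin_supp.
rewrite /ddeg (fsumE cs) in szt.
have le' : (n <= size t)%N by move: (le_trans le szt); lia.
exists (fun i => t`_i); split; first exact: kfree_nth.
by move=> i; apply/inLsE; apply: tL; rewrite mem_nth //; apply: leq_trans (ltn_ord i) le'.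
Qed.

Lemma riemann_sharp : exists D s, covers s D /\
  forall n (f : 'I_n -> K), kfree iota f -> (forall i, inLs D (f i)) ->
    n%:Z < \sum_(P <- s) D P + 2 - g%:Z.
Proof.
case: hg => _ [D [[s /covers_fin_supp cs] H]].
exists D, s; split=> // n f fr fL; rewrite ltNge; apply/negP => le; apply: H.
exists (codom f); rewrite /ddeg (fsumE cs) size_codom card_ord; split=> //; split.
  by move=> h /codomP [i ->]; apply/inLsE.
move=> c; rewrite size_codom card_ord in c * => E i.
have := fr c; apply; rewrite -[RHS]E; apply: eq_bigr => j _.
by rewrite codomE (nth_map j) ?size_enum_ord // nth_ord_enum.
Qed.

Lemma placeM_free n (f : 'I_n -> K) h : h != 0 -> kfree iota f -> kfree iota (fun i => f i * h).
Proof.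
move=> h0 fr c E; apply: fr; apply: (mulIf h0); rewrite mul0r -[RHS]E mulr_suml.
by apply: eq_bigr => i _; rewrite mulrA.
Qed.

(** If div(f) had positive degree, Riemann's inequality for D + div(f) would give deg D + 2 - g
    independent functions, and multiplication by f would carry them into L(D), where D is the
    divisor at which the inequality is sharp. *)
Lemma product_formula_le f s : f != 0 -> covers s (fun P => P f) -> \sum_(P <- s) P f <= 0.
Proof.
move=> f0 cs; rewrite leNgt; apply/negP => gt.
have [D [s0 [cs0 H]]] := riemann_sharp.
pose t := undup (s ++ s0).
have ct : covers t (fun P => P f).
  by apply: covers_sub cs _ _; rewrite ?undup_uniq // => P; rewrite mem_undup mem_cat => ->.
have ct0 : covers t D.
  by apply: covers_sub cs0 _ _; rewrite ?undup_uniq // => P; rewrite mem_undup mem_cat => ->; rewrite orbT.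
rewrite (sum_covers cs ct) in gt; rewrite (sum_covers cs0 ct0) in H.
have ctD : covers t (fun P => D P + P f).
  by split; [exact: undup_uniq | move=> P nP; rewrite (proj2 ct) ?(proj2 ct0)].
pose d : int := \sum_(P <- t) D P; rewrite -/d in H.
(* For the sharp divisor this number is positive: the empty family already satisfies the strict
   bound. *)
case: (lerP 0 (d + 2 - g%:Z)) => [pos|neg]; last first.
  have : 0%:Z < d + 2 - g%:Z by apply: (H 0%N (fun _ => 0)) => [c _ []|[]].
  by rewrite ltNge (ltW neg).
have [n En] : exists n : nat, n%:Z = d + 2 - g%:Z by exists (absz (d + 2 - g%:Z)%R); lia.
have [|h [fr hL]] := @riemann t _ n ctD.
  rewrite big_split /= -/d En; clear -gt; plia.
suff L : forall i, inLs D (h i * f).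
  by have := H n (fun i => h i * f) (placeM_free f0 fr) L; rewrite -En ltxx.
move=> i P; have := hL i P; rewrite -(@vge_mulr _ _ _ P _ f) // => X.
by apply: vgeW X; plia.
Qed.

Lemma product_formula f s : f != 0 -> covers s (fun P => P f) -> \sum_(P <- s) P f = 0.
Proof.
move=> f0 cs; apply/eqP; rewrite eq_le product_formula_le //=.
have cs' : covers s (fun P => P f^-1).
  by case: cs => us H; split=> // P nP; rewrite /= placeV // H ?oppr0.
have f1 : f^-1 != 0 by rewrite invr_eq0.
have := product_formula_le f1 cs'.
rewrite (eq_bigr (fun P : place => - P f)); last by move=> P _; rewrite placeV.
by rewrite sumrN oppr_le0.
Qed.

Lemma kfree_orders P n (f : 'I_n -> K) : (forall i, f i != 0) ->
  (forall i j : 'I_n, (i < j)%N -> P (f i) < P (f j)) -> kfree iota f.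
Proof.
move=> f0 lt c E i; apply/eqP; apply: contraTT isT => ci.
have [j [cj minj]] : exists j : 'I_n, c j != 0 /\ forall l : 'I_n, (l < j)%N -> c l = 0.
  have [j cj minj] := @arg_minnP _ i (fun j => c j != 0) (@nat_of_ord n) ci.
  exists j; split=> // l lt_lj; apply/eqP/negPn/negP => cl.
  by move: (minj l cl); lia.
have : \sum_i iota (c i) * f i != 0; last by rewrite E eqxx.
rewrite (bigD1 j) //=.
have cf0 : iota (c j) * f j != 0 by rewrite mulf_neq0 ?fmorph_eq0.
apply: (proj1 (place_add_lt (P := P) cf0 _)).
apply: vge_sum => l lj; rewrite placeM ?fmorph_eq0 // placeC // add0r.
case: (ltnP l j) => [/minj ->|ge]; first by rewrite rmorph0 mul0r vge0.
apply: vgeZ; rewrite vgeE //.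
have /lt : (j < l)%N by rewrite ltn_neqAle ge andbT eq_sym.
plia.
Qed.

(** Of a family with distinct orders at [P], all but the element of lowest order vanish once more
    than [D] requires. *)
Lemma drop_one P D n (f : 'I_n.+1 -> K) : kfree iota f -> (forall i, inLs D (f i)) ->
  exists h : 'I_n -> K, kfree iota h /\ forall i, inLs (fun Q => D Q - (Q == P)%:R) (h i).
Proof.
move=> fr fL.
have [h [hL h0 hlt]] := distinct_orders ff P fr (inLs_subspace D) fL.
exists (fun i => h (lift ord0 i)); split.
  apply: (@kfree_orders P) => // i j lt; apply: hlt.
  by rewrite /= /bump /= !add1n ltnS.
move=> i Q; have := hL (lift ord0 i) Q; case: eqVneq => [->|_]; last by rewrite subr0.
move=> _; have := hL ord0 P; have := hlt ord0 (lift ord0 i) isT.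
rewrite !vgeE //; plia.
Qed.

(** D is at most the sharp divisor plus finitely many points, and removing a point costs at most one
    dimension. *)
Lemma L_finite s D : covers s D -> exists B : nat,
  forall n (f : 'I_n -> K), kfree iota f -> (forall i, inLs D (f i)) -> (n <= B)%N.
Proof.
move=> cs; have [D0 [s0 [cs0 H]]] := riemann_sharp.
pose d : int := \sum_(P <- s0) D0 P; rewrite -/d in H.
(* The points to be removed, each repeated |D P - D0 P| times. *)
pose ps := flatten [seq nseq (absz (D P - D0 P)%R) P | P <- undup (s ++ s0)].
have cnt P : absz (D P - D0 P)%R = count_mem P ps.
  rewrite /ps; set t := undup _.
  have ut : uniq t by exact: undup_uniq.
  have nt : P \notin t -> absz (D P - D0 P)%R = 0%N.
    by rewrite mem_undup mem_cat negb_or => /andP[n1 n2]; rewrite (proj2 cs) // (proj2 cs0).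
  elim: t ut nt => [|Q t IH] /=; first by move=> _ ->.
  move=> /andP[Qt ut] nt; rewrite count_cat count_nseq /=.
  case: (eqVneq Q P) => [E|ne].
    rewrite mul1n E; suff -> : count_mem P (flatten [seq nseq (absz (D R - D0 R)%R) R | R <- t]) = 0%N by rewrite addn0.
    apply/count_memPn; apply/flattenP => -[r /mapP [R Rt ->]].
    rewrite mem_nseq => /andP[_ /eqP PR]; by rewrite E PR Rt in Qt.
  rewrite mul0n add0n; apply: IH => // nP; apply: nt.
  by rewrite inE negb_or eq_sym ne.
have le P : D P <= D0 P + (count_mem P ps)%:Z by rewrite -cnt; lia.
exists (absz (d + 2 - g%:Z)%R + size ps)%N => n f fr fL.
have {fL} : forall i, inLs (fun P => D0 P + (count_mem P ps)%:Z) (f i).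
  by move=> i P; apply: vgeW (fL i P); move: (le P); lia.
clear cnt le; elim: ps n f fr => [|P ps IH] n f fr fL /=.
  rewrite addn0; suff : n%:Z < d + 2 - g%:Z by lia.
  apply: (H n f fr) => i P; have := fL i P; by rewrite /= addr0.
case: n f fr fL => [|n] f fr fL //.
have [h [fr' hL]] := drop_one P fr fL.
rewrite addnS ltnS; apply: (IH n h fr') => i Q.
by apply: vgeW (hL i Q); rewrite /= [Q == P]eq_sym; case: (P == Q) => /=; lia.
Qed.

Lemma powers_free f n : nonconst iota f -> kfree iota (fun i : 'I_n => f ^+ i).
Proof.
move=> nf c E i; pose p := \poly_(j < n) oapp c 0 (insub j : option 'I_n).
have pc (j : 'I_n) : p`_j = c j by rewrite coef_poly ltn_ord valK.
case: (eqVneq p 0) => [p0|p0]; first by rewrite -pc p0 coef0.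
have := nonconst_trans nf p0; rewrite (ev1E_wide _ _ (size_poly _ _)).
rewrite (_ : \sum_(j < n) _ = 0) ?eqxx // -[RHS]E.
by apply: eq_bigr => j _; rewrite pc.
Qed.

(** Without poles all powers of f would be independent elements of L(0), which has finite
    dimension. *)
Lemma nonconst_pole f : nonconst iota f -> exists P, P f < 0.
Proof.
move=> nf; apply: NNPP => no; apply: notF.
have [|B HB] := @L_finite [::] (fun=> 0); first by split.
have := HB B.+1 _ (powers_free nf); rewrite ltnn; apply=> i P.
rewrite oppr0; apply: vge0X; rewrite vgeE ?(nonconst_neq0 nf) //.
by rewrite leNgt; apply/negP => lt; apply: no; exists P.
Qed.

Lemma two_dim D (f : 'I_2 -> K) : kfree iota f -> (forall i, inLs D (f i)) ->
  exists z, inLs D z /\ nonconst iota z.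
Proof.
move=> fr fL.
case: (nonconstP iota (f 0)) => [|[a Ea]]; first by exists (f 0).
case: (nonconstP iota (f 1)) => [|[b Eb]]; first by exists (f 1).
have /= := fr (fun i => if i == 0 then b else - a).
rewrite big_ord_recl big_ord1 /= (_ : lift ord0 ord0 = 1); last by apply: val_inj.
rewrite Ea Eb -!rmorphM -rmorphD mulNr mulrC subrr rmorph0 => /(_ erefl) /(_ 1) /= /eqP.
rewrite oppr_eq0 => /eqP a0; have := kfree_neq0 0 fr; by rewrite Ea a0 rmorph0 eqxx.
Qed.

(** L((g+1)P) has dimension at least 2, so it contains a nonconstant function, whose pole can only
    be at P. *)
Lemma pole_at P : exists z, P z < 0 /\ forall Q, Q != P -> vge Q 0 z.
Proof.
pose D Q : int := if Q == P then (g.+1)%:Z else 0.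
have cD : covers [:: P] D by split=> // Q; rewrite inE /D => /negPf ->.
have [|f [fr fL]] := @riemann _ D 2 cD; first by rewrite big_seq1 /D eqxx; lia.
have [z [zL nz]] := two_dim fr fL.
exists z; have reg Q : Q != P -> vge Q 0 z.
  by move=> QP; move: (zL Q); rewrite /D (negPf QP) oppr0.
split=> //; have [Q neg] := nonconst_pole nz.
case: (eqVneq Q P) => [<- //|/reg]; rewrite vgeE ?(nonconst_neq0 nz) //; plia.
Qed.

Lemma finite_or_many (Z : place -> Prop) n :
  (exists s, uniq s /\ forall P, Z P -> P \in s) \/
  (exists s, [/\ uniq s, size s = n & forall P, P \in s -> Z P]).
Proof.
case: (excluded_middle_informative (exists s, uniq s /\ forall P, Z P -> P \in s)) => fin; [by left|right].
elim: n => [|n [s [us sz sZ]]]; first by exists [::].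
have [P [ZP nP]] : exists P, Z P /\ P \notin s.
  apply: NNPP => no; apply: fin; exists s; split=> // P ZP.
  by apply/negPn/negP => nP; apply: no; exists P.
exists (P :: s); split=> //=; rewrite ?nP ?sz //.
by move=> Q; rewrite inE => /orP[/eqP -> //|/sZ].
Qed.

(** All places of [Z] induce on k(x) a multiple of the same valuation [mu]; there are at most
    [K : k(x)] of them. Otherwise take functions z_i with a pole at R_i only and a relation between
    them over k(x). At the place R_i for which mu(p_i) is least, the i-th term has strictly least
    order. *)
Lemma finite_fiber x y (P : {poly {poly k}}) (mu : {poly k} -> int) (Z : place -> Prop) :
  (forall p : {poly k}, p != 0 -> ev1 x p != 0) -> P != 0 -> ev x y P = 0 ->
  (forall z : K, exists A B : {poly {poly k}}, ev x y B != 0 /\ z = ev x y A / ev x y B) ->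
  (forall R, Z R -> exists e : int, 0 < e /\ forall p, p != 0 -> R (ev1 x p) = e * mu p) ->
  exists s, uniq s /\ forall R, Z R -> R \in s.
Proof.
move=> tr P0 Pxy gen HZ.
have [//|[s [us sz sZ]]] := finite_or_many Z (size P).-1.+1.
case Es: s => [|R0 s0]; first by rewrite Es in sz.
pose R (i : 'I_(size P).-1.+1) := nth R0 s i.
have Rs i : R i \in s by rewrite mem_nth // sz.
pose z i := proj1_sig (constructive_indefinite_description _ (pole_at (R i))).
have Hz i : R i (z i) < 0 /\ forall Q, Q != R i -> vge Q 0 (z i).
  by rewrite /z; case: constructive_indefinite_description.
have [p [[i0 pi0] E]] := dep_over_kx tr P0 Pxy gen z.
have [i [pi mini]] : exists i, p i != 0 /\ forall j, p j != 0 -> mu (p i) <= mu (p j).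
  have [i pi mini] := @Order.TotalTheory.arg_minP _ _ _ i0 (fun i => p i != 0) (fun i => mu (p i)) pi0.
  by exists i.
have [e [epos He]] := HZ _ (sZ _ (Rs i)).
have [zneg zreg] := Hz i.
have z0 : z i != 0.
  by apply/negP => /eqP zi0; move: zneg; rewrite zi0 place0 ltxx.
have : \sum_i ev1 x (p i) * z i != 0; last by rewrite E eqxx.
have pz0 : ev1 x (p i) * z i != 0 by rewrite mulf_neq0 // tr.
rewrite (bigD1 i) //=; apply: (proj1 (place_add_lt (P := R i) pz0 _)).
apply: vge_sum => j ji.
case: (eqVneq (p j) 0) => [->|pj]; first by rewrite rmorph0 mul0r vge0.
have zj : vge (R i) 0 (z j).
  apply: (proj2 (Hz j)); rewrite /R nth_uniq ?sz //; by rewrite eq_sym.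
have : vge (R i) (e * mu (p j) + 0) (ev1 x (p j) * z j).
  by apply: vgeM => //; rewrite vgeE ?tr // He.
apply: vgeW; rewrite placeM ?tr // He // addr0.
have : e * mu (p i) <= e * mu (p j) by rewrite ler_pM2l // mini.
move: zneg; plia.
Qed.

Lemma fin_zeros_gen x y (P : {poly {poly k}}) c :
  (forall p : {poly k}, p != 0 -> ev1 x p != 0) -> P != 0 -> ev x y P = 0 ->
  (forall z : K, exists A B : {poly {poly k}}, ev x y B != 0 /\ z = ev x y A / ev x y B) ->
  exists s, uniq s /\ forall R : place, 0 < R (x - iota c) -> R \in s.
Proof.
move=> tr P0 Pxy gen.
(* The valuation of k(x) at c, namely the multiplicity of the root c. *)
pose mu (p : {poly k}) : int := (projT1 (multiplicity_XsubC p c))%:Z.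
apply: (@finite_fiber x y P mu) => // R Rpos.
exists (R (x - iota c)); split=> // p p0; rewrite /mu.
case: multiplicity_XsubC => m /= /= [q]; rewrite p0 /= => nroot ->.
have q0 : q != 0 by apply: contraNneq nroot => ->; rewrite root0.
have xc0 : x - iota c != 0.
  by apply: contraTneq Rpos => ->; rewrite place0 ltxx.
rewrite rmorphM rmorphXn rmorphB /= ev1X ev1C placeM ?tr ?expf_neq0 // placeX // addrC mulrC.
suff -> : R (ev1 x q) = 0 by rewrite addr0.
have xint : vge R 0 x by rewrite -(subrK (iota c) x); apply: vgeD; rewrite ?vgeC // vgeE // ltW.
have [q' [r qE]] : exists q' r, q = q' * ('X - c%:P) + r%:P.
  exists (q %/ ('X - c%:P)), q.[c]; by rewrite {1}(divp_eq q ('X - c%:P)) modp_XsubC.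
have r0 : r != 0.
  apply: contraNneq nroot => r0; by rewrite qE r0 addr0 rootM root_XsubC eqxx orbT.
rewrite qE rmorphD rmorphM rmorphB /= ev1X !ev1C addrC.
have rr0 : iota r != 0 by rewrite fmorph_eq0.
have [|_ ->] := @place_add_lt _ _ _ R (iota r) (ev1 x q' * (x - iota c)) rr0; last by rewrite placeC.
rewrite placeC // add0r -[1]add0r; apply: vgeM; first exact: vge_ev1.
by rewrite vgeE.
Qed.

Lemma fin_poles_gen x y (P : {poly {poly k}}) :
  (forall p : {poly k}, p != 0 -> ev1 x p != 0) -> P != 0 -> ev x y P = 0 ->
  (forall z : K, exists A B : {poly {poly k}}, ev x y B != 0 /\ z = ev x y A / ev x y B) ->
  exists s, uniq s /\ forall R : place, R x < 0 -> R \in s.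
Proof.
move=> tr P0 Pxy gen.
(* The valuation of k(x) at infinity. *)
pose mu (p : {poly k}) : int := - ((size p).-1)%:Z.
apply: (@finite_fiber x y P mu) => // R Rneg.
exists (- R x); split; first by rewrite oppr_gt0.
move=> p p0; rewrite /mu ev1E.
have sp : size p = (size p).-1.+1 by rewrite prednK // lt0n size_poly_eq0.
have x0 : x != 0 by have := tr 'X; rewrite ev1X polyX_eq0 => /(_ isT).
rewrite sp big_ord_recr /= addrC.
have l0 : iota p`_(size p).-1 != 0 by rewrite fmorph_eq0 -lead_coefE lead_coef_eq0.
have t0 : iota p`_(size p).-1 * x ^+ (size p).-1 != 0 by rewrite mulf_neq0 ?expf_neq0.
have vt : R (iota p`_(size p).-1 * x ^+ (size p).-1) = (size p).-1%:Z * R x.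
  by rewrite placeM ?expf_neq0 // placeX // placeC ?add0r // -lead_coefE lead_coef_eq0.
have [|_ ->] := @place_add_lt _ _ _ R _ (\sum_(i < (size p).-1) iota p`_i * x ^+ i) t0.
  apply: vge_sum => i _; apply: vgeZ; rewrite vgeE ?expf_neq0 // vt placeX //.
  have := ltn_ord i; move: Rneg; clear; move: (R x) => a; move: (size p).-1 (nat_of_ord i) => u w; nia.
by rewrite vt mulrNN mulrC.
Qed.

(** In a relation G(x, f) = 0, at a zero of f which is no pole of x, the lowest nonzero coefficient
    G_j(x) must vanish. So x takes one of finitely many values there, and each fibre of x is
    finite. *)
Lemma fin_zeros f : f != 0 -> exists s, uniq s /\ forall R : place, 0 < R f -> R \in s.
Proof.
move=> f0; case: (ff) => x [y [tr [[P [P0 Pxy]] gen]]].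
have {}tr : forall p : {poly k}, p != 0 -> ev1 x p != 0 by [].
have [G [G0 Gxf]] := alg_dep ff x f.
have [j [Gj minj]] : exists j, G`_j != 0 /\ forall i, (i < j)%N -> G`_i = 0.
  have ex : exists j, G`_j != 0.
    by exists (size G).-1; rewrite -lead_coefE lead_coef_eq0.
  case: (ex_minnP ex) => j Gj minj; exists j; split=> // i lt.
  by apply/eqP/negPn/negP => H; move: (minj _ H); lia.
have [s1 [us1 Hs1]] := fin_poles_gen tr P0 Pxy gen.
have [r Er] := closed_field_poly_normal G`_j.
pose zs c := proj1_sig (constructive_indefinite_description _ (fin_zeros_gen c tr P0 Pxy gen)).
have Hzs c (R : place) : 0 < R (x - iota c) -> R \in zs c.
  by rewrite /zs; case: constructive_indefinite_description => s' /= [_ H]; exact: H.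
exists (undup (s1 ++ flatten [seq zs c | c <- r])); split; first exact: undup_uniq.
move=> R Rf; rewrite mem_undup mem_cat.
have x0 : x != 0 by have := tr 'X; rewrite ev1X polyX_eq0 => /(_ isT).
case: (ltrP (R x) 0) => [/Hs1 -> //|xint]; apply/orP; right.
have Gpos : vge R 1 (ev1 x G`_j).
  have : ev1 x G`_j = - \sum_(i < size G | (j < i)%N) ev1 x G`_i * f ^+ (i - j).
    apply/eqP; rewrite -addr_eq0; apply/eqP.
    have fj0 : f ^+ j != 0 by rewrite expf_neq0.
    apply: (mulIf fj0); rewrite mul0r -[RHS]Gxf evE mulrDl mulr_suml.
    have ltj : (j < size G)%N by rewrite ltnNge; apply: contraNN Gj => le; rewrite nth_default.
    rewrite [RHS](bigD1 (Ordinal ltj)) //=; congr (_ + _).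
    rewrite [RHS](bigID (fun i : 'I_(size G) => (j < i)%N)) /= [X in _ = _ + X]big1 ?addr0.
      apply: eq_big => i.
        by rewrite -val_eqE /= neq_ltn; case: ltngtP.
      by move=> lt; rewrite -mulrA -exprD subnK // ltnW.
    move=> i; rewrite -val_eqE /= -leqNgt => /andP[ne le].
    by rewrite minj ?rmorph0 ?mul0r // ltn_neqAle ne.
  move=> ->; rewrite vgeN; apply: vge_sum => i lt; rewrite -[1]add0r; apply: vgeM.
    by apply: vge_ev1; rewrite vgeE.
  by rewrite vgeE ?expf_neq0 // placeX //; move: Rf lt; case: (nat_of_ord i) => // i' + lt; rewrite subSn //; move: (R f) (i' - j)%N => a b; nia.
have Gx0 : ev1 x G`_j != 0 := tr _ Gj.
move: Gpos; rewrite vgeE // Er -mul_polyC rmorphM /= ev1C rmorph_prod /=.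
rewrite placeM ?fmorph_eq0 ?lead_coef_eq0 //; last first.
  by rewrite -rmorph_prod tr // monic_neq0 // monic_prod_XsubC.
rewrite placeC ?lead_coef_eq0 // add0r place_prod; last first.
  by move=> c; rewrite tr // polyXsubC_eq0.
move=> pos; have [c cr cpos] : exists2 c, c \in r & 0 < R (ev1 x ('X - c%:P)).
  apply: NNPP => no; move: pos; apply/negP; rewrite -ltNge.
  apply: le_lt_trans (_ : 0 < 1) => //; rewrite big_seq; apply: sumr_le0 => c cr.
  by rewrite leNgt; apply/negP => cpos; apply: no; exists c.
rewrite rmorphB /= ev1X ev1C in cpos.
by apply/flattenP; exists (zs c); [apply/mapP; exists c | exact: Hzs].
Qed.

Lemma fin_support f : f != 0 -> exists s, covers s (fun P : place => P f).
Proof.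
move=> f0; have [s [us Hs]] := fin_zeros f0.
have [|s' [us' Hs']] := @fin_zeros f^-1; first by rewrite invr_eq0.
exists (undup (s ++ s')); apply: covers_undup => P.
rewrite mem_cat negb_or => /andP[n1 n2]; apply/eqP; rewrite eq_le; apply/andP; split.
  by rewrite leNgt; apply: contra n1; exact: Hs.
rewrite leNgt; apply: contra n2 => neg; apply: Hs'; rewrite placeV // oppr_gt0 //.
Qed.

End Genus.

(** * Degree bounds for nonnegative functions on places *)

Section Mass.
Variables (k : closedFieldType) (K : fieldType) (iota : {rmorphism k -> K}).
Notation place := (place iota).
Implicit Types (P Q : place) (f h : K) (rho sigma : place -> int) (c : int).

(** An effective divisor of degree at most [c]. Testing all finite lists avoids carrying a support,
    so bounds can be added and compared freely. *)
Definition bdd rho c := (forall P, 0 <= rho P) /\ forall s, uniq s -> \sum_(P <- s) rho P <= c.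

Lemma bdd_ge0 rho c : bdd rho c -> 0 <= c.
Proof. by case=> _ /(_ [::] isT); rewrite big_nil. Qed.

Lemma bdd_single rho c P : bdd rho c -> rho P <= c.
Proof. by case=> _ /(_ [:: P] isT); rewrite big_seq1. Qed.

Lemma bddW rho sigma c c' : (forall P, 0 <= rho P) -> (forall P, rho P <= sigma P) -> c <= c' ->
  bdd sigma c -> bdd rho c'.
Proof.
move=> r0 le lec [_ H]; split=> // s us; apply: le_trans lec; apply: le_trans (H s us).
by apply: ler_sum.
Qed.

Lemma bddD rho sigma c c' : bdd rho c -> bdd sigma c' -> bdd (fun P => rho P + sigma P) (c + c').
Proof.
move=> [r0 H] [s0 H']; split=> [P|s us]; first by rewrite addr_ge0.
by rewrite big_split /= lerD ?H ?H'.
Qed.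

Lemma bddZ (n : nat) rho c : bdd rho c -> bdd (fun P => n%:Z * rho P) (n%:Z * c).
Proof.
move=> [r0 H]; split=> [P|s us]; first by rewrite mulr_ge0.
by rewrite -mulr_sumr ler_wpM2l ?H.
Qed.

Lemma bdd_mem (s : seq place) : uniq s -> bdd (fun P => (P \in s)%:R) (size s)%:Z.
Proof.
move=> us; split=> [P|t ut]; first by case: (P \in s).
have -> : \sum_(P <- t) (P \in s)%:R = (count (mem s) t)%:Z :> int.
  elim: (t) => [|P t' IH] /=; first by rewrite big_nil.
  by rewrite big_cons IH PoszD; case: (P \in s).
rewrite lez_nat -size_filter.
by apply: uniq_leq_size; rewrite ?filter_uniq // => P; rewrite mem_filter => /andP[].
Qed.

Lemma bdd_sum (I : Type) (r : seq I) (rho : I -> place -> int) (c : I -> int) :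
  (forall i, bdd (rho i) (c i)) ->
  bdd (fun P => \sum_(i <- r) rho i P) (\sum_(i <- r) c i).
Proof.
move=> H; elim: r => [|i r IH].
  by split=> [P|s us]; rewrite ?big_nil // big1 // => P _; rewrite big_nil.
rewrite big_cons; apply: bddW (bddD (H i) IH) => // P; rewrite big_cons //.
by apply: addr_ge0; [case: (H i)|case: IH].
Qed.

Variables (g : nat).
Hypothesis ff : is_function_field iota.
Hypothesis hg : is_genus iota g.

Definition pol f P := Num.max 0 (- P f).
Definition zer f P := Num.max 0 (P f).

Lemma cover_list (s : seq place) f : f != 0 -> exists t, [/\ uniq t, {subset s <= t} &
  covers t (fun P => P f)].
Proof.
move=> f0; have [s' cs'] := fin_support ff hg f0.
exists (undup (s ++ s')); split; first exact: undup_uniq.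
  by move=> P Ps; rewrite mem_undup mem_cat Ps.
by apply: covers_sub cs' _ _; rewrite ?undup_uniq // => P Ps; rewrite mem_undup mem_cat Ps orbT.
Qed.

Lemma sum_subset rho (s t : seq place) : (forall P, 0 <= rho P) -> uniq s -> uniq t -> {subset s <= t} ->
  \sum_(P <- s) rho P <= \sum_(P <- t) rho P.
Proof.
move=> r0 us ut sub; rewrite [leRHS](bigID (fun P => P \in s)) /=.
have -> : \sum_(P <- t | P \in s) rho P = \sum_(P <- s) rho P.
  rewrite -big_filter; apply: perm_big; apply: uniq_perm; rewrite ?filter_uniq // => P.
  by rewrite mem_filter; case Ps: (P \in s); rewrite //= sub.
by rewrite lerDl sumr_ge0.
Qed.

Lemma zeros_bdd f rho c : f != 0 -> (forall P, vge P (- rho P) f) -> bdd rho c -> bdd (zer f) c.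
Proof.
move=> f0 H [r0 br]; split=> [P|s us]; first by rewrite /zer le_max lexx.
have [t [ut st ct]] := cover_list s f0.
have z0 P : 0 <= zer f P by rewrite /zer le_max lexx.
apply: le_trans (sum_subset z0 us ut st) _; apply: le_trans (br t ut).
rewrite -[leRHS]add0r -[X in X + _](product_formula hg f0 ct) -big_split /=.
apply: ler_sum => P _; have := H P; rewrite /zer vgeE //.
move: (r0 P); case: leP; plia.
Qed.

Lemma height_bdd f : f != 0 -> bdd (pol f) (height iota f).
Proof.
move=> f0; split=> [P|s us]; first by rewrite /pol le_max lexx.
have [t [ut st ct]] := cover_list s f0.
have p0 P : 0 <= pol f P by rewrite /pol le_max lexx.
apply: le_trans (sum_subset p0 us ut st) _; rewrite /height (@fsumE _ _ _ t) //.
by split=> // P nP; rewrite (proj2 ct) // oppr0 maxxx.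
Qed.

Lemma vge_pol f P : vge P (- pol f P) f.
Proof. by rewrite /vge /pol; apply/orP; right; case: leP; plia. Qed.

Lemma pol_bdd f c : bdd (pol f) c -> f != 0 -> bdd (zer f) c.
Proof. by move=> H f0; apply: zeros_bdd H => // P; apply: vge_pol. Qed.

Lemma exists_nonconst : exists x : K, nonconst iota x.
Proof.
case: ff => x [y [tr _]]; exists x => c; apply/eqP => E.
have /tr : ('X - c%:P) != 0 by rewrite polyXsubC_eq0.
by rewrite rmorphB /= map_polyX map_polyC hornerD hornerN hornerX hornerC E subrr eqxx.
Qed.

(** With n + 1 independent elements brought to distinct orders at one place P, the last has order at
    least n - rho P there; its divisor has degree 0, so n is at most c. *)
Lemma L_dim n (f : 'I_n -> K) rho c : kfree iota f -> bdd rho c -> (forall i, inLs rho (f i)) ->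
  n%:Z <= c + 1.
Proof.
case: n f => [|n] f fr br fL; first by move: (bdd_ge0 br); lia.
have [x nx] := exists_nonconst; have [P _] := nonconst_pole ff hg nx.
have [h [hL h0 hlt]] := distinct_orders ff P fr (inLs_subspace rho) fL.
have ord (i : 'I_n.+1) : i%:Z - rho P <= P (h i).
  case: i => i; elim: i => [|i IH] lt.
    by have := hL (Ordinal lt) P; rewrite vgeE // sub0r.
  have lt' : (i < n.+1)%N by lia.
  have := IH lt'; have := hlt (Ordinal lt') (Ordinal lt) (ltnSn i); rewrite /=; plia.
pose b Q := (if Q == P then n%:Z else 0) - rho Q.
have [t [ut st ct]] := cover_list [:: P] (h0 ord_max).
have Pt : P \in t by apply: st; rewrite inE.
have : \sum_(Q <- t) b Q <= 0.
  rewrite -[leRHS](product_formula hg (h0 ord_max) ct); apply: ler_sum => Q _; rewrite /b.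
  case: eqVneq => [->|_]; first by have := ord ord_max.
  by have := hL ord_max Q; rewrite vgeE // sub0r.
rewrite sumrB (bigD1_seq P) //= eqxx big1 ?addr0; last by move=> Q /negPf ->.
by case: br => _ /(_ t ut); plia.
Qed.

(* At most g integers fail to be pole orders at Q, so some j e + 1 with 1 <= j <= g+1 is one. *)
Lemma pole_order Q (e : nat) : (0 < e)%N -> exists j z, [/\ (0 < j <= g.+1)%N, z != 0,
  Q z = - (j * e + 1)%:Z & forall P, P != Q -> vge P 0 z].
Proof.
move=> e0; pose m := (g.+1 * e + 1)%N.
pose D P : int := if P == Q then m%:Z else 0.
have cD : covers [:: Q] D by split=> // P; rewrite inE /D => /negPf ->.
have gm : (g <= m)%N by rewrite /m; nia.
have [|f [fr fL]] := @riemann _ _ _ g hg _ D (m.+1 - g) cD; first by rewrite big_seq1 /D eqxx; lia.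
have [h [hL h0 hlt]] := distinct_orders ff Q fr (inLs_subspace D) fL.
have reg i P : P != Q -> vge P 0 (h i).
  by move=> PQ; move: (hL i P); rewrite /D (negPf PQ) oppr0.
have hle i : Q (h i) <= 0.
  rewrite leNgt; apply/negP => pos.
  case: (nonconstP iota (h i)) => [nh|[c E]].
    have [P neg] := nonconst_pole ff hg nh.
    have PQ : P != Q by apply: contraTneq neg => ->; rewrite -leNgt ltW.
    by have := reg i P PQ; rewrite vgeE // leNgt neg.
  move: pos (h0 i); rewrite E fmorph_eq0 => + c0; by rewrite placeC // ltxx.
have hge i : - m%:Z <= Q (h i) by move: (hL i Q); rewrite /D eqxx vgeE.
apply: NNPP => no.
(* Pigeonhole in the interval from 0 to m: at least m + 1 - g attained pole orders and g + 1
   candidates cannot be disjoint. *)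
pose O := [seq absz (Q (h i)) | i <- enum 'I_(m.+1 - g)].
pose J := [seq (j * e + 1)%N | j <- seq.iota 1 g.+1].
have : (size (O ++ J) <= size (seq.iota 0 m.+1))%N.
  apply: uniq_leq_size.
    rewrite cat_uniq; apply/and3P; split.
    - rewrite map_inj_in_uniq ?enum_uniq // => i j _ _ E.
      have Eq : Q (h i) = Q (h j) by move: (hle i) (hle j) E; plia.
      apply: val_inj => /=; case: (ltngtP i j) => // /hlt; by rewrite Eq ltxx.
    - apply/hasPn => _ /mapP [j jr ->]; apply/negP => /mapP [i _ E].
      apply: no; exists j, (h i); split=> //; last exact: reg.
        by move: jr; rewrite mem_iota; lia.
      by move: E (hle i); plia.
    - by rewrite map_inj_uniq ?iota_uniq // => a b; nia.
  move=> a; rewrite mem_cat mem_iota add0n leq0n /= => /orP [/mapP [i _ ->]|/mapP [j jr ->]].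
    by move: (hle i) (hge i); plia.
  move: jr; rewrite mem_iota => /andP[_ le]; rewrite /m ltnS leq_add2r leq_mul2r; apply/orP; right; lia.
have sO : size O = (m.+1 - g)%N by rewrite [LHS](size_map _ (enum 'I_(m.+1 - g))) size_enum_ord.
have sJ : size J = g.+1 by rewrite [LHS]size_map size_iota.
by rewrite size_cat sO sJ size_iota; lia.
Qed.

End Mass.

(** * Derivations of K over k and their existence *)

Section Derivations.
Variables (k : closedFieldType) (K : fieldType) (iota : {rmorphism k -> K}).
Notation ev1 := (ev1 iota).
Notation ev := (ev iota).
Implicit Types (P G A B : {poly {poly k}}) (f h x y : K).

Definition derivation (D : K -> K) :=
  [/\ forall a b, D (a + b) = D a + D b, forall a b, D (a * b) = D a * b + a * D b
    & forall c, D (iota c) = 0].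

Definition dX P : {poly {poly k}} := map_poly deriv P.

Lemma dXD A B : dX (A + B) = dX A + dX B.
Proof. by rewrite /dX raddfD. Qed.
Lemma coef_dX A i : (dX A)`_i = (A`_i)^`().
Proof. by rewrite coef_map. Qed.
Lemma dXM A B : dX (A * B) = dX A * B + A * dX B.
Proof.
apply/polyP => i; rewrite coefD coef_dX !coefM raddf_sum -big_split /=.
by apply: eq_bigr => j _; rewrite derivM !coef_dX.
Qed.
Lemma dXC c : dX c%:P = (c^`())%:P.
Proof. by rewrite /dX map_polyC. Qed.

Section Calculus.
Variable D : K -> K.
Hypothesis derD : derivation D.

Lemma derD_add a b : D (a + b) = D a + D b. Proof. by case: derD. Qed.
Lemma derD_mul a b : D (a * b) = D a * b + a * D b. Proof. by case: derD. Qed.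
Lemma derD_const c : D (iota c) = 0. Proof. by case: derD. Qed.
Lemma derD0 : D 0 = 0. Proof. by have := derD_const 0; rewrite rmorph0. Qed.
Lemma derD1 : D 1 = 0. Proof. by rewrite -(rmorph1 iota) derD_const. Qed.
Lemma derDN a : D (- a) = - D a.
Proof. by apply/eqP; rewrite -addr_eq0 -derD_add addNr derD0. Qed.
Lemma derD_sum (I : Type) (r : seq I) (p : pred I) (F : I -> K) :
  D (\sum_(i <- r | p i) F i) = \sum_(i <- r | p i) D (F i).
Proof. exact: (big_morph D derD_add derD0). Qed.
Lemma derDZ c a : D (iota c * a) = iota c * D a.
Proof. by rewrite derD_mul derD_const mul0r add0r. Qed.
Lemma derDX a n : D (a ^+ n) = n%:R * a ^+ n.-1 * D a.
Proof.
elim: n => [|n IH]; first by rewrite expr0 derD1 !mul0r.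
case: n IH => [|n] IH; first by rewrite expr1 /= expr0 mulr1 mul1r.
by rewrite exprS derD_mul IH /= -[n.+2]addn1 natrD exprS; ring.
Qed.
Lemma derDV a : a != 0 -> D a^-1 = - D a / a ^+ 2.
Proof.
move=> a0; have : D (a * a^-1) = 0 by rewrite divff // derD1.
rewrite derD_mul => /eqP; rewrite addrC addr_eq0 => /eqP H.
by apply: (mulfI a0); rewrite H; field.
Qed.
Lemma derD_div a b : b != 0 -> D (a / b) = (D a * b - a * D b) / b ^+ 2.
Proof. by move=> b0; rewrite derD_mul derDV //; field. Qed.
Lemma derD_logM a b : a != 0 -> b != 0 -> D (a * b) / (a * b) = D a / a + D b / b.
Proof. by move=> a0 b0; rewrite derD_mul; field; apply/andP. Qed.

Lemma derD_ev1 x q : D (ev1 x q) = ev1 x q^`() * D x.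
Proof.
elim/poly_ind: q => [|q c IH]; first by rewrite deriv0 !rmorph0 derD0 mul0r.
rewrite rmorphD rmorphM /= ev1X ev1C derD_add derD_const addr0 derD_mul IH.
by rewrite derivMXaddC rmorphD rmorphM /= ev1X; ring.
Qed.

Lemma derD_ev x y A : D (ev x y A) = ev x y (dX A) * D x + ev x y A^`() * D y.
Proof.
elim/poly_ind: A => [|A c IH].
  by rewrite deriv0 /dX map_poly0 !rmorph0 derD0 !mul0r addr0.
rewrite rmorphD rmorphM /= evX evC derD_add derD_mul IH derD_ev1.
rewrite derivMXaddC dXD dXM dXC /dX !rmorphD !rmorphM /= evX evC /=.
have -> : map_poly deriv ('X : {poly {poly k}}) = 0.
  by apply/polyP => i; rewrite coef_map coefX coef0 /=; case: (i == 1%N); rewrite ?derivC ?raddf0 // -(polyC1 k) derivC.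
by rewrite rmorph0; ring.
Qed.

End Calculus.

Hypothesis char0 : [pchar k] =i pred0.

Lemma natk_neq0 (n : nat) : (n.+1%:R : k) != 0.
Proof. by rewrite (proj1 (pcharf0P k) char0). Qed.

Lemma mulrn_poly_neq0 (p : {poly k}) (n : nat) : p != 0 -> p *+ n.+1 != 0.
Proof.
move=> p0; rewrite -[_ *+ _]mulr_natr mulf_neq0 //.
by rewrite -polyC_natr polyC_eq0 natk_neq0.
Qed.

Hypothesis ff : is_function_field iota.

(** While the derivative in the outer variable vanishes at (f, h) it replaces [G]: it is nonzero in
    characteristic 0, of smaller degree and of no larger bidegree. The descent stops because f is
    transcendental. *)
Lemma sep_dep_bideg b e f h G : nonconst iota f -> G != 0 -> ev f h G = 0 -> bideg b e G ->
  exists G', [/\ ev f h G' = 0, ev f h G'^`() != 0 & bideg b e G'].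
Proof.
move=> nf; elim: {G}(size G) {-2}G (leqnn (size G)) => [|s IH] G.
  by rewrite leqn0 size_poly_eq0 => ->.
move=> sG G0 GE bG; case: (eqVneq (ev f h G^`()) 0) => [dG0|]; last by exists G.
case: (leqP (size G) 1) => [le1|lt1].
  move: GE; rewrite (size1_polyC le1) evC => E.
  have G00 : G`_0 != 0 by apply: contraNneq G0 => G00; rewrite (size1_polyC le1) G00.
  by have := nonconst_trans nf G00; rewrite E eqxx.
have sd : (size G^`() < size G)%N by apply: lt_size_deriv.
apply: (IH G^`()) => //; first by lia.
  apply/eqP => d0; have := congr1 (fun p : {poly {poly k}} => p`_(size G).-2) d0.
  rewrite coef_deriv coef0 => /eqP; apply/negP.
  have -> : (size G).-2.+1 = (size G).-1 by lia.
  have -> : (size G).-1 = (size G).-2.+1 by lia.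
  by apply: mulrn_poly_neq0; have -> : (size G).-2.+1 = (size G).-1 by [lia]; rewrite -lead_coefE lead_coef_eq0.
case: bG => sb cb; split=> [|j]; first by lia.
by rewrite coef_deriv; apply: leq_trans (cb j.+1); rewrite -scaler_nat size_scale_leq.
Qed.

Lemma sep_dep f h : nonconst iota f -> exists G, ev f h G = 0 /\ ev f h G^`() != 0.
Proof.
move=> nf; have [G [G0 GE]] := alg_dep ff f h; have [b bG] := bideg_ex G.
by have [G' [? ? _]] := sep_dep_bideg nf G0 GE bG; exists G'.
Qed.

(** Every h is separably algebraic over k(f), and a derivation extends uniquely along such
    extensions. *)
Lemma der_zero D f : derivation D -> nonconst iota f -> D f = 0 -> forall h, D h = 0.
Proof.
move=> dD nf Df h; have [G [GE GY]] := sep_dep h nf.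
have := derD_ev dD f h G; rewrite GE (derD0 dD) Df mulr0 add0r => /esym/eqP.
by rewrite mulf_eq0 (negPf GY) => /eqP.
Qed.

Lemma der_const D f : derivation D -> (exists h, D h != 0) -> D f = 0 -> exists c, f = iota c.
Proof.
move=> dD [h Dh] Df; case: (nonconstP iota f) => // nf.
by move: Dh; rewrite (der_zero dD nf Df) eqxx.
Qed.

Lemma derivation_ex : exists D, derivation D /\ exists x, D x = 1.
Proof.
case: (ff) => x [y [tr [[P0 [P0neq P0xy]] gen]]].
have nx : nonconst iota x.
  move=> c; apply/eqP => E; have /tr : ('X - c%:P) != 0 by rewrite polyXsubC_eq0.
  by rewrite rmorphB /= map_polyX map_polyC hornerD hornerN hornerX hornerC E subrr eqxx.
have [P [Pxy PY minP]] : exists P, [/\ ev x y P = 0, ev x y P^`() != 0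
    & forall A, ev x y A = 0 -> (size A < size P)%N -> A = 0].
  pose Q n := exists P, [/\ P != 0, ev x y P = 0 & size P = n].
  have exQ : exists n, (if excluded_middle_informative (Q n) then true else false).
    by exists (size P0); case: excluded_middle_informative => // -[]; exists P0.
  have [n] := ex_minnP exQ; case: excluded_middle_informative => // -[P [Pn PE Ps]] _ minn.
  have mP A : ev x y A = 0 -> (size A < size P)%N -> A = 0.
    move=> AE As; apply: contraTeq isT => A0; move: (minn (size A)).
    case: excluded_middle_informative => [_ /(_ isT)|[]]; last by exists A.
    lia.
  exists P; split=> //; apply/eqP => PY0.
  have [b bP] := bideg_ex P; have [G [GE GY _]] := sep_dep_bideg nx Pn PE bP.
  have P'0 : P^`() = 0 by apply: mP => //; apply: lt_size_deriv.
  case: (leqP (size P) 1) => [le1|lt1].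
    move: PE; rewrite (size1_polyC le1) evC => E.
    have P00 : P`_0 != 0 by apply: contraNneq Pn => G00; rewrite (size1_polyC le1) G00.
    by have := nonconst_trans nx P00; rewrite E eqxx.
  have := congr1 (fun p : {poly {poly k}} => p`_(size P).-2) P'0.
  rewrite coef_deriv coef0 => /eqP; apply/negP; apply: mulrn_poly_neq0.
  have -> : (size P).-2.+1 = (size P).-1 by lia.
  by rewrite -lead_coefE lead_coef_eq0.
(* The value forced on D y by differentiating P(x, y) = 0 with D x = 1. *)
pose c := - ev x y (dX P) / ev x y P^`().
pose D0 A := ev x y (dX A) + c * ev x y A^`().
have D0D A B : D0 (A + B) = D0 A + D0 B.
  by rewrite /D0 dXD derivD !rmorphD /=; ring.
have D0M A B : D0 (A * B) = D0 A * ev x y B + ev x y A * D0 B.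
  by rewrite /D0 dXM derivM !rmorphD !rmorphM /=; ring.
have D0P : D0 P = 0 by rewrite /D0 /c divfK // subrr.
have Pn0 : P != 0 by apply: contraNneq PY => ->; rewrite deriv0 rmorph0.
(* [P] has least degree in y among the relations, so pseudo-division of [A] by [P] leaves no
   remainder; since [P] and [D0 P] vanish, so does [D0 A]. *)
have D0wd A : ev x y A = 0 -> D0 A = 0.
  move=> AE.
  have := Pdiv.Idomain.divp_eq A P; set l := lead_coef P ^+ _ => E.
  have l0 : l != 0 by rewrite expf_neq0 // lead_coef_eq0.
  have R0 : A %% P = 0.
    apply: minP; last by rewrite Pdiv.Idomain.ltn_modp.
    have := congr1 (ev x y) E; rewrite -mul_polyC rmorphD !rmorphM /= AE Pxy !mulr0 add0r.
    by move=> <-.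
  have := congr1 D0 E; rewrite R0 addr0 -mul_polyC !D0M D0P Pxy AE !mulr0 addr0 add0r evC => /eqP.
  by rewrite mulf_eq0 (negPf (nonconst_trans nx l0)) => /eqP.
have D0B A B : D0 (A - B) = D0 A - D0 B.
  by have := D0D (A - B) B; rewrite subrK => ->; rewrite addrK.
have [num [den ND]] : exists num den : K -> {poly {poly k}},
    forall z, ev x y (den z) != 0 /\ z = ev x y (num z) / ev x y (den z).
  pose num z := proj1_sig (constructive_indefinite_description _ (gen z)).
  pose denS z := constructive_indefinite_description _ (proj2_sig (constructive_indefinite_description _ (gen z))).
  by exists num, (fun z => proj1_sig (denS z)) => z; exact: (proj2_sig (denS z)).
pose q A B := (D0 A * ev x y B - ev x y A * D0 B) / ev x y B ^+ 2.
pose D z := q (num z) (den z).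
have DE A B : ev x y B != 0 -> D (ev x y A / ev x y B) = q A B.
  move=> B0; rewrite /D; set z := ev x y A / ev x y B.
  have [d0 zE] := ND z.
  have : ev x y (A * den z - num z * B) = 0.
    rewrite rmorphD rmorphN !rmorphM /=.
  have -> : ev x y (num z) = z * ev x y (den z) by rewrite {2}zE divfK.
  by rewrite /z mulrAC divfK // subrr.
  move=> E; have := D0wd _ E; rewrite D0B !D0M => E1.
  have E2 : ev x y (num z) = ev x y A * ev x y (den z) / ev x y B.
    by move: E; rewrite rmorphD rmorphN !rmorphM /= => /eqP; rewrite subr_eq0 => /eqP ->; rewrite mulfK.
  have E3 : D0 (num z) = (D0 A * ev x y (den z) + ev x y A * D0 (den z) - ev x y (num z) * D0 B) / ev x y B.
    apply: (mulIf B0); rewrite divfK //; apply/eqP; rewrite eq_sym -subr_eq0 -[X in _ == X]E1; apply/eqP; ring.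
  by rewrite /q E3 E2; field; apply/andP.
have D01 : D0 1 = 0.
  have := D0M 1 1; rewrite mulr1 rmorph1 mulr1 mul1r => /eqP.
  by rewrite -subr_eq0 opprD addrA subrr sub0r oppr_eq0 => /eqP.
have DE1 A : D (ev x y A) = D0 A.
  have e1 : ev x y 1 = 1 by exact: rmorph1.
  have := DE A 1; rewrite /q e1 divr1 D01 mulr1 mulr0 subr0 expr1n divr1.
  by apply; rewrite oner_neq0.
exists D; split; last first.
  exists x; have -> : x = ev x y ('X)%:P by rewrite evC ev1X.
  by rewrite DE1 /D0 dXC derivX derivC rmorph0 mulr0 addr0 evC rmorph1.
split=> [a b|a b|c0].
- have [da aE] := ND a; have [db bE] := ND b.
  have -> : a + b = ev x y (num a * den b + num b * den a) / ev x y (den a * den b).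
    by rewrite rmorphD !rmorphM /= {1}aE {1}bE; field; apply/andP.
  rewrite DE ?rmorphM ?mulf_neq0 //= /D /q D0D !D0M rmorphD !rmorphM /=.
  by field; apply/andP.
- have [da aE] := ND a; have [db bE] := ND b.
  have -> : a * b = ev x y (num a * num b) / ev x y (den a * den b).
    by rewrite !rmorphM /= {1}aE {1}bE; field; apply/andP.
  rewrite DE ?rmorphM ?mulf_neq0 //= /D /q !D0M !rmorphM /=.
  move: (D0 (num a)) (D0 (den a)) (D0 (num b)) (D0 (den b)) da aE db bE.
  move: (ev x y (num a)) (ev x y (den a)) (ev x y (num b)) (ev x y (den b)).
  move=> na ma nb mb ? ? ? ? ? -> ? ->.
  by field; apply/andP.
- have -> : iota c0 = ev x y c0%:P%:P by rewrite evC ev1C.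
  by rewrite DE1 /D0 dXC !derivC !rmorph0 mulr0 addr0.
Qed.

End Derivations.

(** * Derivations at a single place *)

Section LocalDerivation.
Variables (k : closedFieldType) (K : fieldType) (iota : {rmorphism k -> K}).
Notation place := (place iota).
Notation ev1 := (ev1 iota).
Notation ev := (ev iota).
Notation derivation := (derivation iota).
Implicit Types (P Q : place) (f h w x y : K) (D : K -> K).

Lemma derivation_scale D a : derivation D -> derivation (fun z => a * D z).
Proof.
case=> DD DM DC; split=> [b c|b c|c]; first by rewrite DD mulrDr.
  by rewrite DM; ring.
by rewrite DC mulr0.
Qed.

Lemma derD_logXz D a (z : int) : derivation D -> a != 0 -> D (a ^ z) / a ^ z = z%:~R * (D a / a).
Proof.
move=> dD a0.
have pos (n : nat) : D (a ^+ n) / a ^+ n = n%:R * (D a / a).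
  case: n => [|n]; first by rewrite expr0 (derD1 dD) !mul0r.
  rewrite (derDX dD) /= exprS.
  have an0 : a ^+ n != 0 by rewrite expf_neq0.
  by field; apply/andP.
case: z => n; first by rewrite -exprnP pos.
have an0 : a ^+ n.+1 != 0 by rewrite expf_neq0.
have -> : a ^ (Negz n) = (a ^+ n.+1)^-1 by rewrite NegzE -exprz_inv -exprnP exprVn.
have -> : (Negz n)%:~R * (D a / a) = - (D (a ^+ n.+1) / a ^+ n.+1).
  by rewrite pos NegzE mulrNz mulNr.
rewrite (derDV dD an0); move: (D _) an0; move: (a ^+ n.+1) => b c b0.
by field; rewrite b0 oner_neq0.
Qed.

Variable P : place.

Lemma vge_ev_diff (j : int) x w w' A : vge P 0 x -> vge P 0 w -> vge P 0 w' -> vge P j (w - w') ->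
  vge P j (ev x w A - ev x w' A).
Proof.
move=> Hx Hw Hw' Hd; elim/poly_ind: A => [|A c IH]; first by rewrite !rmorph0 subrr vge0.
rewrite !rmorphD !rmorphM /= !evX !evC.
have -> : ev x w A * w + ev1 x c - (ev x w' A * w' + ev1 x c) =
          (ev x w A - ev x w' A) * w + ev x w' A * (w - w') by ring.
apply: vgeD; first by rewrite -[j]addr0; apply: vgeM.
by rewrite -[j]add0r; apply: vgeM => //; apply: vge_ev.
Qed.

Variable t : K.
Hypothesis vt : P t = 1.

Lemma unif_neq0 : t != 0.
Proof. by apply/eqP => t0; have := vt; rewrite t0 place0. Qed.

Lemma unif_nonconst : nonconst iota t.
Proof.
move=> c; apply/eqP => E; have := vt; rewrite E.
case: (eqVneq c 0) => [->|c0]; first by rewrite rmorph0 place0.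
by rewrite placeC.
Qed.

Lemma vge_unif : vge P 0 t. Proof. by rewrite vgeE ?unif_neq0 // vt. Qed.

Lemma vge_iota1 c : vge P 1 (iota c) -> c = 0.
Proof.
by case: (eqVneq c 0) => // c0; rewrite vgeE ?fmorph_eq0 // placeC.
Qed.

(** As t has order 1 at P, the order of a polynomial in t is its multiplicity at 0. *)
Lemma dvd_Xn (a : nat) (B : {poly k}) : vge P a%:Z (ev1 t B) -> exists B', B = 'X^a * B'.
Proof.
elim: a B => [|a IH] B H; first by exists B; rewrite expr0 mul1r.
have [|B' BE] := IH B; first by apply: vgeW H; lia.
have [B'' [c B'E]] : exists B'' c, B' = B'' * 'X + c%:P.
  have := divp_eq B' ('X - 0%:P); rewrite modp_XsubC polyC0 subr0 => E.
  by exists (B' %/ 'X), B'.[0].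
suff c0 : c = 0 by exists B''; rewrite BE B'E c0 addr0 exprSr -mulrA [B'' * _]mulrC.
apply: vge_iota1; have -> : iota c = ev1 t B' - ev1 t B'' * t.
  by rewrite B'E rmorphD rmorphM /= ev1X ev1C addrC addKr.
apply: vgeB; last by rewrite -[1]add0r vgeM ?vge_ev1 ?vge_unif // vgeE ?unif_neq0 // vt.
have ta : t ^+ a != 0 by rewrite expf_neq0 // unif_neq0.
rewrite -(@vge_mulr _ _ _ P _ (t ^+ a)) // placeX ?unif_neq0 // vt mulr1.
by move: H; rewrite BE rmorphM rmorphXn /= ev1X mulrC; congr (vge P _ _); lia.
Qed.

Hypothesis ff : is_function_field iota.

Lemma approx w (j : nat) : vge P 0 w -> exists T, vge P j%:Z (w - ev1 t T).
Proof.
move=> Hw; elim: j => [|j [T HT]]; first by exists 0; have E : ev1 t 0 = 0 := rmorph0 _; rewrite E subr0.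
have tj : t ^+ j != 0 by rewrite expf_neq0 // unif_neq0.
have vtj : P (t ^+ j) = j%:Z by rewrite placeX ?unif_neq0 // vt mulr1.
have [|c Hc] := @residue_quot _ _ _ ff P (t ^+ j) (w - ev1 t T) tj; first by rewrite vtj.
exists (T + c%:P * 'X^j); rewrite rmorphD rmorphM rmorphXn /= ev1X ev1C opprD addrA.
by apply: vgeW Hc; rewrite vtj; lia.
Qed.

Hypothesis char0 : [pchar k] =i pred0.

Lemma der_hensel D x w (Q : {poly {poly k}}) : derivation D -> vge P 0 x -> vge P 0 w -> vge P 0 (D x) ->
  ev x w Q = 0 -> ev x w Q^`() != 0 -> P (ev x w Q^`()) = 0 -> vge P 0 (D w).
Proof.
move=> dD Hx Hw HDx QE Q0 Qu.
rewrite -(@vge_mulr _ _ _ P _ (ev x w Q^`())) // Qu addr0.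
have := derD_ev dD x w Q; rewrite QE (derD0 dD) => /esym/eqP.
rewrite addrC addr_eq0 mulrC => /eqP ->; rewrite vgeN.
by apply: vge0M => //; apply: vge_ev.
Qed.

Lemma nderiv_ev A (i : nat) T : (map_poly (ev1 t) A)^`N(i).[ev1 t T] = ev1 t (A^`N(i).[T]).
Proof. by rewrite nderivn_map horner_map. Qed.

(* Hensel-type argument: after replacing w by its Taylor remainder of high order, the
   equation of w over k(t) becomes one with a simple root. *)
Lemma der_cont1 D w : derivation D -> D t = 1 -> vge P 0 w -> vge P 0 (D w).
Proof.
move=> dD Dt Hw.
have [G [GE GY]] := sep_dep char0 ff w unif_nonconst.
have [nu nuE] : exists nu : nat, P (ev t w G^`()) = nu%:Z.
  have := vge_ev G^`() vge_unif Hw; rewrite vgeE // => H.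
  by exists (absz (P (ev t w G^`()))); plia.
(* One more than the order of the derivative of the equation at w: this makes 2j = nu + j + 1, which
   leaves a spare factor t in the quadratic part below. *)
pose j := nu.+1.
have [T HT] := approx j Hw.
have t0 := unif_neq0.
have tn0 n : t ^+ n != 0 by rewrite expf_neq0.
have vtn n : P (t ^+ n) = n%:Z by rewrite placeX // vt mulr1.
pose om := (w - ev1 t T) / t ^+ j.
have omE : w = ev1 t T + t ^+ j * om by rewrite /om mulrC divfK // addrC subrK.
have Hom : vge P 0 om.
  by rewrite -(@vge_mulr _ _ _ P _ (t ^+ j)) // /om divfK // vtn add0r.
clearbody om.
have HT0 : vge P 0 (ev1 t T) by apply: vge_ev1; exact: vge_unif.
pose A i := (G^`N(i)).[T].
have taylor : ev t w G = \sum_(i < size G) ev1 t (A i) * (t ^+ j * om) ^+ i.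
  rewrite evE' {1}omE (@nderiv_taylor_wide _ (size G)); first last.
  - exact: size_poly.
  - exact: mulrC.
  by apply: eq_bigr => i _; rewrite nderiv_ev.
have [s Es] : exists s, size G = s.+2.
  case E: (size G) => [|[|s]]; last by exists s.
    by move: GY; have /eqP := E; rewrite size_poly_eq0 => /eqP ->; rewrite deriv0 rmorph0 eqxx.
  have le1 : (size G <= 1)%N by rewrite E.
  by move: GY; rewrite (size1_polyC le1) derivC rmorph0 eqxx.
rewrite GE Es !big_ord_recl /= expr0 mulr1 expr1 in taylor.
have A1 : ev1 t (A 1%N) != 0 /\ P (ev1 t (A 1%N)) = nu%:Z.
  have -> : ev1 t (A 1%N) = ev t w G^`() + (ev t (ev1 t T) G^`() - ev t w G^`()).
    by rewrite addrC subrK /A poly.nderivn1 evE' horner_map.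
  rewrite -nuE; apply: place_add_lt => //.
  have := @vge_ev_diff j%:Z t (ev1 t T) w G^`() vge_unif HT0 Hw.
  rewrite -opprB vgeN => /(_ HT); apply: vgeW; rewrite nuE /j; lia.
have Hh : vge P j%:Z (t ^+ j * om) by rewrite -[j%:Z]addr0; apply: vgeM => //; rewrite -vtn vge_self.
have [B1 B1E] : exists B1, A 1%N = 'X^nu * B1.
  by apply: dvd_Xn; rewrite -(proj2 A1) vge_self.
pose R2 := \sum_(i < s) (A (i.+2) * 'X^(j * i))%:P * 'X^i.
have R2E : ev t om R2 = \sum_(i < s) ev1 t (A i.+2) * (t ^+ j * om) ^+ i.
  rewrite rmorph_sum; apply: eq_bigr => i _.
  by rewrite rmorphM rmorphXn /= evC evX rmorphM rmorphXn /= ev1X exprMn exprM mulrA.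
have taylor2 : ev1 t (A 0%N) = - (ev1 t (A 1%N) * (t ^+ j * om) + (t ^+ j * om) ^+ 2 * ev t om R2).
  apply/eqP; rewrite -addr_eq0; apply/eqP; rewrite [RHS]taylor R2E mulr_sumr.
  congr (_ + (_ + _)); apply: eq_bigr => i _.
  by rewrite /bump /= !add1n -[i.+2]addn2 exprD; ring.
have [B0 B0E] : exists B0, A 0%N = 'X^(nu + j) * B0.
  apply: dvd_Xn; rewrite taylor2 vgeN; apply: vgeD.
    by rewrite PoszD; apply: vgeM => //; rewrite -(proj2 A1) vge_self.
  rewrite expr2; apply: (@vgeW _ _ _ P (j%:Z + j%:Z + 0)); first by rewrite /j; lia.
  by apply: vgeM; [exact: vgeM | apply: vge_ev; first exact: vge_unif].
(* The Taylor expansion at T divided by t^(nu+j). Its terms of degree at least 2 keep a factor t, so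
   the derivative at [om] is congruent to the unit B1(t) modulo t. *)
pose Q := B0%:P + B1%:P * 'X + ('X%:P * 'X^2 * R2).
have QE : ev t om Q = 0.
  apply: (mulfI (tn0 (nu + j)%N)); rewrite mulr0.
  rewrite /Q !rmorphD !rmorphM ?rmorphXn /= !evC !evX ev1X.
  have := taylor2; rewrite B0E B1E !rmorphM !rmorphXn /= !ev1X => /eqP.
  rewrite -addr_eq0 => /eqP E; rewrite -[RHS]E.
  by rewrite /j exprD exprS; ring.
have QY : ev t om Q^`() != 0 /\ P (ev t om Q^`()) = 0.
  have -> : ev t om Q^`() = ev1 t B1 + t * (2%:R * om * ev t om R2 + om ^+ 2 * ev t om R2^`()).
    rewrite /Q expr2 !derivD !derivM !derivC !derivX !mul0r !add0r !mulr1 !mul1r.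
    rewrite !rmorphD ?rmorphM /= ?rmorphD ?rmorphM /= ?rmorphD ?rmorphM /= ?rmorphM !evC !evX ev1X /=.
    by ring.
  have B1n0 : ev1 t B1 != 0 /\ P (ev1 t B1) = 0.
    case: A1; rewrite B1E rmorphM rmorphXn /= ev1X mulf_eq0 negb_or => /andP[_ b1].
    by rewrite placeM // vtn; split=> //; plia.
  case: B1n0 => b1 vb1; rewrite -vb1; apply: place_add_lt => //; rewrite vb1 add0r -[1]addr0.
  apply: vgeM; first by rewrite -vt vge_self.
  by apply: vgeD; apply: vge0M; rewrite ?vge0M ?vge_nat ?vge0X ?vge_ev ?vge_unif.
have HDt : vge P 0 (D t) by rewrite Dt vge1.
have HDom := der_hensel dD vge_unif Hom HDt QE (proj1 QY) (proj2 QY).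
have HDtj : vge P 0 (D (t ^+ j)).
  by rewrite (derDX dD) Dt mulr1; apply: vge0M; [exact: vge_nat | apply: vge0X; exact: vge_unif].
rewrite omE (derD_add dD) (derD_mul dD) (derD_ev1 dD) Dt mulr1.
apply: vgeD; first by apply: vge_ev1; exact: vge_unif.
apply: vgeD; apply: vge0M => //; apply: vge0X; exact: vge_unif.
Qed.

Lemma der_cont D w : derivation D -> D t != 0 -> vge P 0 w -> vge P (P (D t)) (D w).
Proof.
move=> dD Dt0 Hw; have dD' := derivation_scale (D t)^-1 dD.
have := der_cont1 dD'; rewrite mulVf // => /(_ w erefl Hw).
by rewrite -(@vge_mulr _ _ _ P _ (D t)) // mulrC mulrA divff // mul1r add0r.
Qed.

(** Write f as t^m times a unit a; D a / a is as regular as D t, so m D t / t carries the possible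
    extra pole. *)
Lemma der_log D f : derivation D -> D t != 0 -> f != 0 ->
  vge P (P (D t)) (D f / f - (P f)%:~R * (D t / t)).
Proof.
move=> dD Dt0 f0; pose m := P f; have t0 := unif_neq0.
have tm0 : t ^ m != 0 by rewrite expfz_neq0.
pose a := f / t ^ m.
have a0 : a != 0 by rewrite mulf_neq0 // invr_eq0.
have va : P a = 0 by rewrite placeM ?invr_eq0 // placeV // placeXz // vt mulr1 subrr.
have fE : f = a * t ^ m by rewrite divfK.
have -> : D f / f - m%:~R * (D t / t) = D a / a.
  by rewrite {1 2}fE (derD_logM dD) // derD_logXz // addrK.
rewrite -[P (D t)]addr0 -[X in _ + X]oppr0 -va -placeV //; apply: vgeM; last exact: vge_self.
by apply: der_cont => //; rewrite vgeE // va.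
Qed.

Lemma intK_neq0 (m : int) : m != 0 -> (m%:~R : K) != 0 /\ P (m%:~R) = 0.
Proof.
move=> m0; have mk : (m%:~R : k) != 0.
  case: m m0 => [[|n]|n] //= _; first exact: natk_neq0.
  by rewrite NegzE mulrNz oppr_eq0; exact: natk_neq0.
by rewrite -(rmorph_int iota) fmorph_eq0 placeC.
Qed.

Lemma der_exact_t D f : derivation D -> D t != 0 -> P f != 0 ->
  D f != 0 /\ P (D f) = P f - 1 + P (D t).
Proof.
move=> dD Dt0 vf; have f0 : f != 0 by apply: contraNneq vf => ->; rewrite place0.
have [m0 vm] := intK_neq0 vf; have t0 := unif_neq0.
have a0 : (P f)%:~R * (D t / t) != 0 by rewrite !mulf_neq0 // invr_eq0.
have va : P ((P f)%:~R * (D t / t)) = P (D t) - 1.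
  by rewrite !placeM ?mulf_neq0 ?invr_eq0 // placeV // vm vt add0r.
have := der_log dD Dt0 f0; set r := (X in vge _ _ X) => Hr.
have [|s0 sE] := @place_add_lt _ _ _ P _ r a0; first by rewrite va subrK.
have E : D f = ((P f)%:~R * (D t / t) + r) * f by rewrite /r addrC subrK divfK.
by rewrite E mulf_neq0 // placeM // sE va; split=> //; plia.
Qed.

End LocalDerivation.

(** * Pole orders of a derivation at all places *)

Section Different.
Variables (k : closedFieldType) (K : fieldType) (iota : {rmorphism k -> K}).
Notation place := (place iota).
Notation derivation := (derivation iota).
Implicit Types (P Q : place) (f h w : K) (D : K -> K).

Definition unif P : K := proj1_sig (constructive_indefinite_description _ (place_unif P)).
Lemma unifP P : P (unif P) = 1.
Proof. by rewrite /unif; case: constructive_indefinite_description => t []. Qed.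

(* Pole order at P of the vector field D; minus the order at P of the dual differential. *)
Definition kap D P : int := - P (D (unif P)).

Hypothesis ff : is_function_field iota.
Hypothesis char0 : [pchar k] =i pred0.
Variable D : K -> K.
Hypothesis dD : derivation D.
Hypothesis D0 : exists h, D h != 0.

Lemma der_unif_neq0 P : D (unif P) != 0.
Proof.
apply/eqP => E; case: D0 => h; rewrite (der_zero char0 ff dD _ E) ?eqxx //.
exact: unif_nonconst (unifP P).
Qed.

Lemma der_reg P w : vge P 0 w -> vge P (- kap D P) (D w).
Proof. by move=> Hw; rewrite /kap opprK; apply: (der_cont (unifP P)) => //; exact: der_unif_neq0. Qed.

Lemma der_exact P f : P f != 0 -> D f != 0 /\ P (D f) = P f - 1 - kap D P.
Proof. by move=> Hf; rewrite /kap opprK; apply: (der_exact_t (unifP P)) => //; exact: der_unif_neq0. Qed.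

Lemma der_any P f : f != 0 -> vge P (P f - 1 - kap D P) (D f).
Proof.
move=> f0; case: (eqVneq (P f) 0) => [E|/der_exact [D0' <-]]; last exact: vge_self.
have H : vge P 0 f by rewrite vgeE // E.
by apply: vgeW (der_reg H); rewrite E; lia.
Qed.

Lemma der_vge P (m : int) f : vge P m f -> vge P (m - 1 - kap D P) (D f).
Proof.
case: (eqVneq f 0) => [->|f0]; first by rewrite (derD0 dD) !vge0.
by rewrite vgeE // => H; apply: vgeW (der_any P f0); plia.
Qed.

(* If D preserves a subring with fraction field K that is regular at P, then D is regular at P:
   otherwise differentiation would lower valuations by kap + 1, which would divide all of them. *)
Lemma seidenberg P (A : K -> Prop) : (forall a, A a -> vge P 0 a) -> (forall a, A a -> A (D a)) ->
  (forall f, exists a b, [/\ A a, A b, b != 0 & f = a / b]) -> kap D P <= 0.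
Proof.
move=> Areg AD Afrac; rewrite leNgt; apply/negP => pos.
pose q := absz (kap D P + 1)%R.
have qE : q%:Z = kap D P + 1 by rewrite /q; plia.
have dvdA a : A a -> a != 0 -> (q %| absz (P a))%N.
  move: a; suff H n a : A a -> a != 0 -> (absz (P a) <= n)%N -> (q %| absz (P a))%N.
    by move=> a Aa a0; apply: (H (absz (P a))).
  elim: n a => [|n IH] a Aa a0 le; first by move: le; rewrite leqn0 => /eqP ->; rewrite dvdn0.
  have := Areg a Aa; rewrite vgeE // => va.
  case: (eqVneq (P a) 0) => [->|va0]; first by rewrite dvdn0.
  have [Da0 vDa] := der_exact va0.
  have vDa_ge : 0 <= P (D a) by have := Areg _ (AD _ Aa); rewrite vgeE.
  have -> : absz (P a) = (absz (P (D a)) + q)%N by move: vDa_ge va vDa qE; clear; move: (P a) (P (D a)) (kap D P); lia.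
  rewrite dvdn_addl //; apply: IH => //; first exact: AD.
  move: le pos vDa va vDa_ge; clear; move: (P a) (P (D a)) (kap D P); lia.
have [a [b [Aa Ab b0 tE]]] := Afrac (unif P).
have t0 := unif_neq0 (unifP P).
have a0 : a != 0 by apply: contraNneq t0 => a0; rewrite tE a0 mul0r.
have va := Areg a Aa; have vb := Areg b Ab; rewrite vgeE // in va; rewrite vgeE // in vb.
have := unifP P; rewrite tE placeM ?invr_eq0 // placeV // => E.
have Eab : absz (P a) = (absz (P b) + 1)%N by move: E va vb; clear; move: (P a) (P b); lia.
have := dvdA a Aa a0; rewrite Eab dvdn_addr ?dvdA // dvdn1 => /eqP q1.
by move: pos qE; rewrite q1; move: (kap D P); lia.
Qed.

End Different.

(** * A plane model and a derivation with few poles *)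

Section VectorField.
Variables (k : closedFieldType) (K : fieldType) (iota : {rmorphism k -> K}).
Notation place := (place iota).
Notation ev1 := (ev1 iota).
Notation ev := (ev iota).
Notation derivation := (derivation iota).
Notation pol := (@pol k K iota).
Implicit Types (P Q : place) (f h w : K) (D : K -> K) (A B G : {poly {poly k}}).

Lemma not_kfree (I : finType) (f : I -> K) : ~ kfree iota f ->
  exists c : I -> k, (exists i, c i != 0) /\ \sum_i iota (c i) * f i = 0.
Proof.
move=> nf; apply: NNPP => no; apply: nf => c E i.
by apply/eqP/negPn/negP => ci; apply: no; exists c; split=> //; exists i.
Qed.

Lemma ev_mapC x y p : ev x y (map_poly polyC p) = ev1 y p.
Proof.
elim/poly_ind: p => [|p c IH]; first by rewrite map_poly0 !rmorph0.
by rewrite !rmorphD !rmorphM /= map_polyX map_polyC /= evX evC ev1X !ev1C IH.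
Qed.

Lemma kfree_ord_of (I : finType) (f : I -> K) :
  kfree iota f -> kfree iota (fun i : 'I_#|I| => f (enum_val i)).
Proof.
move=> fr c E i; have := fr (fun j => c (enum_rank j)) _ (enum_val i).
rewrite enum_valK; apply; rewrite -[RHS]E (reindex (@enum_val I (mem I))) /=; last first.
  by apply: onW_bij; exact: enum_val_bij.
by apply: eq_bigr => j _; rewrite enum_valK.
Qed.

Variables (g : nat).
Hypothesis ff : is_function_field iota.
Hypothesis hg : is_genus iota g.
Hypothesis char0 : [pchar k] =i pred0.

Lemma L_dep (I : finType) (f : I -> K) (rho : place -> int) c : bdd rho c -> (forall i, inLs rho (f i)) ->
  c + 1 < #|I|%:Z -> exists a : I -> k, (exists i, a i != 0) /\ \sum_i iota (a i) * f i = 0.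
Proof.
move=> br fL lt; apply: not_kfree => /kfree_ord_of fr.
by have := L_dim ff hg fr br (fun i => fL (enum_val i)); rewrite leNgt lt.
Qed.

Section Generation.
Variables (u z : K) (Q : place) (e j : nat).
Hypothesis nu : nonconst iota u.
Hypothesis vQu : Q u = e%:Z.
Let m := (j * e + 1)%N.
Hypothesis z0 : z != 0.
Hypothesis vQz : Q z = - m%:Z.
Hypothesis zreg : forall P, P != Q -> vge P 0 z.
Hypothesis e_gt0 : (0 < e)%N.

Let rho P := m%:Z * pol u P.

Lemma pol_ge0 f P : 0 <= pol f P. Proof. by rewrite /pol le_max lexx. Qed.

Lemma polQu : pol u Q = 0.
Proof. by rewrite /pol vQu; lia. Qed.

Lemma z_nonconst : nonconst iota z.
Proof.
move=> c; apply/eqP => zE; have := vQz; rewrite zE.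
have c0 : c != 0 by apply: contraNneq z0 => c0; rewrite zE c0 rmorph0.
by rewrite placeC // /m; lia.
Qed.

(** The orders e and -(j e + 1) of u and z at Q are coprime, so every pole at Q can be cancelled by
    a monomial in u and z. *)
Lemma reduce_pole (N : nat) f : (forall P, P != Q -> vge P (- rho P) f) -> vge Q (- N%:Z) f ->
  exists A, inLs rho (f - ev u z A).
Proof.
elim: N f => [|N IH] f freg fQ.
  exists 0; have E : ev u z 0 = 0 := rmorph0 _.
  by rewrite E subr0 => P; case: (eqVneq P Q) => [->|/freg //]; rewrite /rho polQu mulr0.
have u0 := nonconst_neq0 nu.
(* Since j e is -1 modulo m, this [i] makes m divide i e + N + 1, and u^i z^l has order exactly
   -(N+1) at Q. The bound i < m keeps its poles away from Q below [rho]. *)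
pose i := ((j * N.+1) %% m)%N.
pose l := ((i * e + N.+1) %/ m)%N.
have lE : (l * m = i * e + N.+1)%N.
  rewrite /l divnK //.
  have -> : (m %| i * e + N.+1)%N = (m %| j * N.+1 * e + N.+1)%N.
    rewrite [in RHS](divn_eq (j * N.+1) m) -/i mulnDl -addnA [RHS]dvdn_addr //.
    by rewrite -mulnA mulnCA dvdn_mulr.
  have -> : (j * N.+1 * e + N.+1 = m * N.+1)%N by rewrite /m; lia.
  exact: dvdn_mulr.
have im : (i < m)%N by rewrite ltn_mod /m addn1.
pose w := u ^+ i * z ^+ l.
have w0 : w != 0 by rewrite mulf_neq0 ?expf_neq0.
have vw : Q w = - N.+1%:Z.
  rewrite placeM ?expf_neq0 // !placeX // vQu vQz.
  have : (l * m)%:Z = (i * e + N.+1)%:Z by rewrite lE.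
  by rewrite PoszD !PoszM; lia.
have [|c Hc] := @residue_quot _ _ _ ff Q w f w0; first by rewrite vw.
have [|| A HA] := IH (f - iota c * w).
- move=> P PQ; apply: vgeB; first exact: freg.
  apply: vgeZ; rewrite /w /rho -[- _]addr0; apply: vgeM.
    have := vgeX i (vge_pol u P); apply: vgeW.
    move: (pol_ge0 u P) im; clear; move: (pol u P) => a a0 im.
    by rewrite mulrN lerN2; apply: ler_wpM2r => //; rewrite lez_nat ltnW.
  by apply: vge0X; apply: zreg.
- by apply: vgeW Hc; rewrite vw; lia.
exists (A + (c%:P * 'X^i)%:P * 'X^l).
have -> : f - ev u z (A + (c%:P * 'X^i)%:P * 'X^l) = f - iota c * w - ev u z A.
  by rewrite rmorphD rmorphM rmorphXn /= evX evC rmorphM rmorphXn /= ev1X ev1C /w; ring.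
exact: HA.
Qed.

Lemma bdd_rho : bdd rho (m%:Z * height iota u).
Proof. by apply: bddZ; apply: (height_bdd ff hg); apply: nonconst_neq0. Qed.

(** Modulo k[u, z] all products f z^i fall into the space L(rho), whose dimension is finite, so a
    nontrivial combination of them lies in k[u, z]. *)
Lemma gen_regular f : (forall P, P != Q -> vge P 0 f) ->
  exists p A, p != 0 /\ ev1 z p * f = ev u z A.
Proof.
move=> freg.
pose T := absz (m%:Z * height iota u + 2)%R.
have rho0 P : 0 <= rho P by rewrite mulr_ge0 // pol_ge0.
have [N HN] : exists N : nat, forall i : 'I_T, vge Q (- N%:Z) (f * z ^+ i).
  pose a (i : 'I_T) := absz (Q (f * z ^+ i)).
  exists (\max_i a i) => i; rewrite /vge; apply/orP; right.
  have : (a i <= \max_i a i)%N by exact: leq_bigmax.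
  by rewrite /a; plia.
have red (i : 'I_T) : exists A, inLs rho (f * z ^+ i - ev u z A).
  apply: (@reduce_pole N) (HN i) => P PQ.
  apply: (@vgeW _ _ _ P 0); first by rewrite oppr_le0.
  by apply: vge0M; [exact: freg | apply: vge0X; exact: zreg].
pose A i := proj1_sig (constructive_indefinite_description _ (red i)).
have HA (i : 'I_T) : inLs rho (f * z ^+ i - ev u z (A i)).
  by rewrite /A; case: constructive_indefinite_description.
have [|c [[i0 ci] E]] := L_dep bdd_rho HA.
  have := bdd_ge0 bdd_rho; rewrite card_ord /T; lia.
exists (\poly_(i < T) oapp c 0 (insub i : option 'I_T)), (\sum_i (c i)%:P%:P * A i); split.
  apply: contra_neq ci => p0; have := congr1 (fun p : {poly k} => p`_i0) p0.
  by rewrite coef_poly ltn_ord valK coef0.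
rewrite (ev1E_wide _ _ (size_poly _ _)) mulr_suml rmorph_sum /=.
apply/eqP; rewrite -subr_eq0 -sumrB -[X in _ == X]E; apply/eqP; apply: eq_bigr => i _.
by rewrite coef_poly ltn_ord valK rmorphM /= evC ev1C; ring.
Qed.

Lemma field_gen f : exists A B, ev u z B != 0 /\ f = ev u z A / ev u z B.
Proof.
case: (eqVneq f 0) => [->|f0].
  by exists 0, 1; rewrite rmorph1 oner_neq0 rmorph0 mul0r.
have [s cs] := fin_support ff hg f0.
pose t := undup (Q :: s).
have Qt : Q \in t by rewrite mem_undup mem_head.
pose N := (absz (\sum_(P <- t) pol f P)%R + g)%N.
pose E P := (if P == Q then N%:Z else 0) - pol f P.
have cE : covers t E.
  split; first exact: undup_uniq.
  move=> P; rewrite mem_undup inE negb_or => /andP[PQ Ps].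
  by rewrite /E (negPf PQ) /pol (proj2 cs) // oppr0 maxxx subr0.
(* A nonzero w that vanishes at the poles of f outside Q, at the price of a pole at Q; then w and w
   f are both regular away from Q. *)
have [|b [bfr bL]] := @riemann _ _ _ g hg t E 1 cE.
  rewrite sumrB (bigD1_seq Q) ?undup_uniq //= eqxx big1 ?addr0; last by move=> P /negPf ->.
  by rewrite /N; plia.
have b0 := kfree_neq0 ord0 bfr; set w := b ord0 in b0.
have wreg P : P != Q -> vge P (pol f P) w.
  by move=> PQ; have := bL ord0 P; rewrite /E (negPf PQ) sub0r opprK.
have [|p1 [A1 [p10 E1]]] := gen_regular (_ : forall P, P != Q -> vge P 0 w).
  by move=> P PQ; apply: vgeW (wreg P PQ); exact: pol_ge0.
have [|p2 [A2 [p20 E2]]] := gen_regular (_ : forall P, P != Q -> vge P 0 (w * f)).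
  by move=> P PQ; rewrite -(subrr (pol f P)); apply: vgeM; [exact: wreg | exact: vge_pol].
have q1 := nonconst_trans z_nonconst p10; have q2 := nonconst_trans z_nonconst p20.
exists (A2 * map_poly polyC p1), (A1 * map_poly polyC p2).
rewrite !rmorphM /= !ev_mapC -E1 -E2; split; first by rewrite !mulf_neq0.
by field; rewrite q1 q2 b0.
Qed.

Hypothesis m_gt0 : (0 < m)%N.
Let hu : nat := absz (height iota u).

Lemma pol_z_bdd : bdd (pol z) m%:Z.
Proof.
pose sig (P : place) : int := if P == Q then m%:Z else 0.
have bs : bdd sig m%:Z.
  have := bddZ m (bdd_mem (isT : uniq [:: Q])); rewrite mulr1; apply: bddW => // P.
    by rewrite /sig; case: eqVneq.
  by rewrite /sig inE; case: eqVneq => _; rewrite ?mulr1 ?mulr0.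
apply: bddW bs => // [P|P]; first exact: pol_ge0.
rewrite /pol /sig; case: (eqVneq P Q) => [->|/zreg]; first by rewrite vQz opprK; lia.
by rewrite vgeE // => H; rewrite ge_max lexx oppr_le0.
Qed.

(** The (2m+1)(2h+1) monomials in u and z, with h the height of u, lie in a space of dimension at
    most 4mh + 1, because z has m poles. *)
Lemma equation_exists : exists G,
  [/\ ev u z G = 0, ev u z G^`() != 0 & bideg (2 * hu) (2 * m) G].
Proof.
have u0 := nonconst_neq0 nu.
have bu := height_bdd ff hg u0; have bz := pol_z_bdd.
have huE : height iota u = hu%:Z by rewrite /hu gez0_abs // (bdd_ge0 bu).
pose a := (2 * m)%N; pose b := (2 * hu)%N.
pose sig (P : place) : int := a%:Z * pol u P + b%:Z * pol z P.
have bs : bdd sig (a%:Z * hu%:Z + b%:Z * m%:Z) by apply: bddD; apply: bddZ; rewrite -?huE.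
pose F (il : 'I_a.+1 * 'I_b.+1) := u ^+ il.1 * z ^+ il.2.
have FL il : inLs sig (F il).
  move=> P; rewrite /F /sig opprD; apply: vgeM.
    have := vgeX il.1 (vge_pol u P); apply: vgeW; rewrite mulrN lerN2.
    by apply: ler_wpM2r; [exact: pol_ge0 | rewrite lez_nat -ltnS].
  have := vgeX il.2 (vge_pol z P); apply: vgeW; rewrite mulrN lerN2.
  by apply: ler_wpM2r; [exact: pol_ge0 | rewrite lez_nat -ltnS].
have [|c [[[i l] cil] E]] := L_dep bs FL.
  by rewrite card_prod !card_ord -!PoszM -!PoszD ltz_nat /a /b; move: m_gt0; clear; move: m hu; nia.
pose G := \poly_(l < b.+1) \poly_(i < a.+1) c (inord i, inord l).
apply: (@sep_dep_bideg _ _ _ char0 b a u z G) => //.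
- apply: contra_neq cil => G0; have := congr1 (fun G : {poly {poly k}} => (G`_l)`_i) G0.
  by rewrite !coef0 coef_poly ltn_ord coef_poly ltn_ord !inord_val => ->.
- rewrite -[RHS]E (evE_wide _ _ _ (size_poly _ _)) sum_pair exchange_big /=.
  apply: eq_bigr => l' _; rewrite coef_poly ltn_ord (ev1E_wide _ _ (size_poly _ _)) mulr_suml.
  by apply: eq_bigr => i' _; rewrite coef_poly ltn_ord !inord_val /F /= mulrA.
- split; first exact: size_poly.
  by move=> l'; rewrite coef_poly; case: ifP => _; rewrite ?size_poly0 ?size_poly.
Qed.

End Generation.

(* Affine charts: at a pole of x or y pass to 1/x or 1/y. *)
Section Chart.
Variables (x y : K) (P : place).
Hypothesis x0 : x != 0.
Hypothesis y0 : y != 0.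

Let cx := if P x < 0 then x^-1 else x.
Let cy := if P y < 0 then y^-1 else y.

Definition imA w := exists A, w = ev cx cy A.

Lemma imAD a b : imA a -> imA b -> imA (a + b).
Proof. by move=> [A ->] [B ->]; exists (A + B); rewrite rmorphD. Qed.
Lemma imAM a b : imA a -> imA b -> imA (a * b).
Proof. by move=> [A ->] [B ->]; exists (A * B); rewrite rmorphM. Qed.
Lemma imAC c : imA (iota c).
Proof. by exists c%:P%:P; rewrite evC ev1C. Qed.
Lemma imAN a : imA a -> imA (- a).
Proof. by move=> Ha; rewrite -mulN1r -(rmorphN1 iota); apply: imAM => //; exact: imAC. Qed.
Lemma imAX : imA cx.
Proof. by exists ('X%:P); rewrite evC ev1X. Qed.
Lemma imAY : imA cy.
Proof. by exists 'X; rewrite evX. Qed.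
Lemma imAexp a n : imA a -> imA (a ^+ n).
Proof. by move=> [A ->]; exists (A ^+ n); rewrite rmorphXn. Qed.
Lemma imA0 : imA 0.
Proof. by exists 0; rewrite rmorph0. Qed.
Lemma imA_sum (I : Type) (r : seq I) (F : I -> K) : (forall i, imA (F i)) -> imA (\sum_(i <- r) F i).
Proof. by move=> H; elim/big_ind: _ => //; [exact: imA0 | exact: imAD]. Qed.

Lemma imA_reg a : imA a -> vge P 0 a.
Proof.
move=> [A ->]; apply: vge_ev; rewrite /cx /cy; case: ifP => H.
- by rewrite vgeE ?invr_eq0 // placeV // oppr_ge0 ltW.
- by rewrite vgeE // leNgt H.
- by rewrite vgeE ?invr_eq0 // placeV // oppr_ge0 ltW.
- by rewrite vgeE // leNgt H.
Qed.

(** A local denominator: multiplication by [psi a b] brings polynomials of degree at most [a] in x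
    and [b] in y into the ring of the chart. *)
Definition psi (a b : nat) := (if P x < 0 then cx ^+ a else 1) * (if P y < 0 then cy ^+ b else 1).

Lemma chart_neq0 w n : w != 0 ->
  (if P w < 0 then (if P w < 0 then w^-1 else w) ^+ n else 1) != 0.
Proof. by move=> w0; case: (P w < 0); [apply: expf_neq0; rewrite invr_eq0 | exact: oner_neq0]. Qed.

Lemma psi_neq0 a b : psi a b != 0.
Proof. by rewrite /psi mulf_neq0 // chart_neq0. Qed.

Lemma place_psi a b : P (psi a b) = a%:Z * pol x P + b%:Z * pol y P.
Proof.
have H w (n : nat) : w != 0 ->
    P (if P w < 0 then (if P w < 0 then w^-1 else w) ^+ n else 1) = n%:Z * pol w P.
  move=> w0; rewrite /pol; case: ltrP => h.
    by rewrite placeX ?invr_eq0 // placeV //; congr (_ * _); move: h; plia.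
  by rewrite place1 (_ : Num.max 0 _ = 0) ?mulr0 //; move: h; plia.
by rewrite /psi placeM ?H // chart_neq0.
Qed.

Lemma imA_clear b a G : bideg b a G -> imA (psi a b * ev x y G).
Proof.
move=> [sG cG]; rewrite (evE_wide _ _ _ sG) mulr_sumr; apply: imA_sum => l.
rewrite (ev1E_wide _ _ (cG l)) mulr_suml mulr_sumr; apply: imA_sum => i.
have clr w (n i' : nat) : w != 0 -> (i' <= n)%N ->
    let c := if P w < 0 then w^-1 else w in
    exists i'', (if P w < 0 then c ^+ n else 1) * w ^+ i' = c ^+ i''.
  move=> w0 le; case: ifP => _ /=; last by exists i'; rewrite mul1r.
  exists (n - i')%N; rewrite -[in LHS](subnK le) exprD -mulrA -exprMn mulVf // expr1n mulr1 //.
have [i' Ei] := clr x a i x0 (ltn_ord i); have [l' El] := clr y b l y0 (ltn_ord l).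
have -> : psi a b * (iota (G`_l)`_i * x ^+ i * y ^+ l) = iota (G`_l)`_i * (cx ^+ i' * cy ^+ l').
  by rewrite /psi /cx /cy -Ei -El; ring.
by apply: imAM; [exact: imAC | apply: imAM; apply: imAexp; [exact: imAX | exact: imAY]].
Qed.

Lemma bideg_deriv b a G : bideg b a G -> bideg b a G^`().
Proof.
move=> [sG cG]; split=> [|i].
  by case: (eqVneq G 0) => [->|G0]; [rewrite deriv0 size_poly0 | apply: leq_trans (ltnW (lt_size_deriv G0)) sG].
by rewrite coef_deriv; apply: leq_trans (cG i.+1); rewrite -scaler_nat size_scale_leq.
Qed.

Lemma bideg_dX b a G : bideg b a G -> bideg b a (dX G).
Proof.
move=> [sG cG]; split=> [|i]; first by apply: leq_trans sG; rewrite /dX size_poly.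
rewrite coef_dX; case: (eqVneq (G`_i) 0) => [->|G0]; first by rewrite deriv0 size_poly0.
by apply: leq_trans (ltnW (lt_size_deriv G0)) (cG i).
Qed.

Variables (D : K -> K) (b a : nat) (G : {poly {poly k}}).
Hypothesis dD : derivation D.
Hypothesis D0 : exists h, D h != 0.
Hypothesis gen : forall f, exists A B, ev x y B != 0 /\ f = ev x y A / ev x y B.
Hypothesis Dx : D x = ev x y G^`().
Hypothesis Dy : D y = - ev x y (dX G).
Hypothesis bG : bideg b a G.

(** The derivation [psi a b] times [D] sends the chart coordinates into the chart ring, since D x
    and D y are partial derivatives of G up to sign. So [seidenberg] makes it regular at P, and the
    poles of D are at most the zeros of [psi a b]. *)
Lemma kap_chart : kap D P <= a%:Z * pol x P + b%:Z * pol y P.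
Proof.
pose D' w := psi a b * D w.
have dD' : derivation D' := derivation_scale (psi a b) dD.
have D'0 : exists h, D' h != 0.
  by case: D0 => h Dh; exists h; rewrite mulf_neq0 // psi_neq0.
have : kap D' P <= 0.
  apply: (@seidenberg _ _ _ ff char0 D' dD' D'0 P imA); first exact: imA_reg.
    move=> _ [A ->]; rewrite (derD_ev dD').
    have Dc w : w != 0 -> imA (D' w) ->
        imA (if P w < 0 then w^-1 else w) -> imA (D' (if P w < 0 then w^-1 else w)).
      move=> w0 Hw; case: ifP => _ // Hw'; rewrite (derDV dD') // mulNr; apply: imAN.
      by apply: imAM => //; rewrite -exprVn; apply: imAexp.
    apply: imAD; apply: imAM; try by eexists.
      by apply: Dc => //; [rewrite /D' Dx; apply: imA_clear; exact: bideg_deriv | exact: imAX].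
    apply: Dc => //; last exact: imAY.
    by rewrite /D' Dy mulrN; apply: imAN; apply: imA_clear; exact: bideg_dX.
  move=> f; have [A [B [B0 ->]]] := gen f.
  have [bA HA] := bideg_ex A; have [bB HB] := bideg_ex B.
  pose N := maxn bA bB.
  exists (psi N N * ev x y A), (psi N N * ev x y B); split.
  - by apply: imA_clear; apply: bideg_le HA; rewrite leq_maxl.
  - by apply: imA_clear; apply: bideg_le HB; rewrite leq_maxr.
  - by rewrite mulf_neq0 // psi_neq0.
  - by have p0 := psi_neq0 N N; field; rewrite B0 p0.
rewrite /kap /D' placeM ?psi_neq0 ?(der_unif_neq0 ff char0 dD D0) // place_psi.
by plia.
Qed.

End Chart.

(** On the curve G(u, z) = 0 the field D u = G_z, D z = -G_u has poles only where u or z has, with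
    multiplicities bounded by the bidegree of G. With h the height of u this gives total mass 2m h +
    2h m = 4hm, where m is at most (g+1)h + 1. *)
Lemma vector_field u : nonconst iota u -> exists D, [/\ derivation D, exists h, D h != 0 &
  bdd (fun P => Num.max 0 (kap D P)) (4 * height iota u * (g.+1%:Z * height iota u + 1))].
Proof.
move=> nu; have u0 := nonconst_neq0 nu.
have [Q] : exists Q : place, Q u^-1 < 0.
  apply: (nonconst_pole ff hg) => c; apply: contra_neq (nu c^-1) => E.
  by rewrite fmorphV -E invrK.
rewrite placeV // oppr_lt0 => Qpos.
pose e := absz (Q u).
have vQu : Q u = e%:Z by rewrite /e; plia.
have e0 : (0 < e)%N by rewrite /e; plia.
have bu := height_bdd ff hg u0.
have eh : e%:Z <= height iota u.
  have := bdd_single Q (pol_bdd ff hg bu u0); rewrite /zer vQu; lia.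
have [j [z [jb z0 vQz zreg]]] := pole_order ff hg Q e0.
have m0 : (0 < j * e + 1)%N by lia.
have [G [GE GY bG]] := equation_exists nu vQu z0 vQz zreg e0 m0.
have gen := field_gen nu vQu z0 vQz zreg e0.
have [D0 [dD0 [x0 D0x0]]] := derivation_ex char0 ff.
have D0u : D0 u != 0.
  apply/eqP => E; have := der_zero char0 ff dD0 nu E x0; rewrite D0x0 => /eqP.
  by rewrite oner_eq0.
(* The multiple of an arbitrary derivation for which D u = G_z(u, z); the relation G(u, z) = 0 then
   determines D z. *)
pose D w := ev u z G^`() / D0 u * D0 w.
have dD : derivation D := derivation_scale _ dD0.
have Du : D u = ev u z G^`() by rewrite /D divfK.
have Dn0 : exists h, D h != 0 by exists u; rewrite Du.
have Dz : D z = - ev u z (dX G).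
  have := derD_ev dD u z G; rewrite GE (derD0 dD) Du => /esym/eqP.
  rewrite mulrC -mulrDr mulf_eq0 (negPf GY) addrC addr_eq0 => /eqP //.
exists D; split=> //.
have bz := pol_z_bdd vQu z0 vQz zreg e0 m0.
have huE : height iota u = (absz (height iota u))%:Z by rewrite gez0_abs // (bdd_ge0 bu).
have B := bddD (bddZ (2 * (j * e + 1)) bu) (bddZ (2 * absz (height iota u)) bz).
apply: bddW B => [P|P|].
- by rewrite le_max lexx.
- rewrite ge_max; apply/andP; split; last exact: (@kap_chart u z P u0 z0 D _ _ G).
  by rewrite addr_ge0 // mulr_ge0 // pol_ge0.
rewrite {1 3 4}huE; move: eh; rewrite huE; move: (absz _) jb => hh jb.
rewrite lez_nat => eh; rewrite -(PoszM g.+1).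
have : (j * e <= g.+1 * hh)%N by apply: leq_mul => //; case/andP: jb.
by move: (j * e)%N (g.+1 * hh)%N; clear; nia.
Qed.

End VectorField.

(** * Linear independence of units over functions of small height *)

Section UnitEquations.
Variables (k : closedFieldType) (K : fieldType) (iota : {rmorphism k -> K}).
Notation place := (place iota).
Notation derivation := (derivation iota).
Notation zer := (@zer k K iota).
Variables (g : nat).
Hypothesis ff : is_function_field iota.
Hypothesis hg : is_genus iota g.
Hypothesis char0 : [pchar k] =i pred0.
Variable D : K -> K.
Hypothesis dD : derivation D.
Hypothesis D0 : exists h, D h != 0.

Definition kp (P : place) : int := Num.max 0 (kap D P).

Lemma kp_ge0 P : 0 <= kp P. Proof. by rewrite /kp le_max lexx. Qed.
Lemma kap_le P : kap D P <= kp P. Proof. by rewrite /kp le_max lexx orbT. Qed.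

Lemma der_kp P w : vge P 0 w -> vge P (- kp P) (D w).
Proof. by move/(der_reg ff char0 dD D0); apply: vgeW; rewrite lerN2 kap_le. Qed.

(** A pole of order r > 0 grows to at most r + 1 + kp, hence to at most 2r + kp, and nothing is lost
    where r and kp vanish. Only a bound of this shape can be summed over all places; the next lemma
    is its iterate. *)
Lemma der_pole P (r : int) w : 0 <= r -> vge P (- r) w -> vge P (- (2 * r + kp P)) (D w).
Proof.
move=> r0 H; case: (eqVneq r 0) => [E|rn].
  by apply: vgeW (der_kp (_ : vge P 0 w)); [rewrite E mulr0 add0r | move: H; rewrite E oppr0].
apply: vgeW (der_vge ff char0 dD D0 H); have := kap_le P.
by move: (kap D P) (kp P) => a b; lia.
Qed.

Lemma iter_der_pole P (r : int) w (j : nat) : 0 <= r -> vge P (- r) w ->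
  vge P (- (j.+1%:Z * r + 2 * j%:Z * kp P)) (iter j D w).
Proof.
move=> r0 H; have kp0 := kp_ge0 P; have kl := kap_le P.
case: (lerP (r + kp P) 0) => [le|lt].
  have rE : r = 0 by lia.
  have kE : kp P = 0 by lia.
  rewrite rE kE !mulr0 addr0 oppr0; elim: j => [|j IH] /=; first by rewrite -oppr0 -rE.
  by have := der_kp IH; rewrite kE oppr0.
suff : vge P (- (r + j%:Z * (1 + kp P))) (iter j D w).
  by apply: vgeW; move: lt kp0 r0; move: (kp P) => a; clear; nia.
elim: j => [|j IH] /=; first by rewrite mul0r addr0.
apply: vgeW (der_vge ff char0 dD D0 IH); move: kl kp0; move: (kp P) (kap D P) => a b; clear; nia.
Qed.

Lemma iter_der_any P (m : int) w (j : nat) : vge P m w ->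
  vge P (m - j%:Z * (1 + kp P)) (iter j D w).
Proof.
move=> H; elim: j => [|j IH] /=; first by rewrite mul0r subr0.
apply: vgeW (der_vge ff char0 dD D0 IH); have := kap_le P.
by move: (kp P) (kap D P) => a b; clear; nia.
Qed.

Variables (T : eqType) (X : T -> K).
Hypothesis X0 : forall i, X i != 0.
Definition dlog (i : T) := D (X i) / X i.

Lemma D_term a i : D (a * X i) = (D a + a * dlog i) * X i.
Proof. by rewrite (derD_mul dD) /dlog mulrDl -mulrA divfK. Qed.

Variable l : int.
Definition separated (e : seq T) := forall i j, i \in e -> j \in e -> i != j ->
  exists P : place, l <= P (X i) - P (X j).

(** A vanishing derivative makes the ratio of the two terms constant, so a zero of X_i / X_j of
    order at least [l] would have to be cancelled by a pole of a_i / a_j, which has order at most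
    [c]. *)
Lemma const_ratio (e : seq T) (a : T -> K) i j (rho : place -> int) (c : int) :
  separated e -> i \in e -> j \in e -> i != j -> a i != 0 -> a j != 0 ->
  (forall P, vge P (- rho P) (a i / a j)) -> bdd rho c -> c < l ->
  D (a i * X i / (a j * X j)) = 0 -> False.
Proof.
move=> sep ie je ij ai aj H br lt E.
have [c0 Ec] := der_const char0 ff dD D0 E.
have [P HP] := sep i j ie je ij.
have r0 : a i * X i / (a j * X j) != 0 by rewrite !mulf_neq0 ?invr_eq0 ?mulf_neq0.
have c00 : c0 != 0 by apply: contraNneq r0 => c00; rewrite Ec c00 rmorph0.
have := placeC P c00; rewrite -Ec.
have -> : a i * X i / (a j * X j) = (a i / a j) * (X i / X j).
  by field; rewrite X0 aj.
rewrite !placeM ?invr_eq0 ?mulf_neq0 ?invr_eq0 // (placeV _ (X0 j)).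
have := H P; rewrite vgeE ?mulf_neq0 ?invr_eq0 // placeM ?invr_eq0 //.
have := bdd_single P br; plia.
Qed.

Variables (sigma : place -> int) (cs ck : int).
Hypothesis bsig : bdd sigma cs.
Hypothesis bkp : bdd kp ck.

Lemma vge_inv_zer P w : w != 0 -> vge P (- zer w P) w^-1.
Proof. by move=> w0; rewrite vgeE ?invr_eq0 // placeV // /zer lerN2 le_max lexx orbT. Qed.

(* Divide by one term and differentiate: the constant disappears and induction applies. *)
Lemma unit_indep (n : nat) (e : seq T) (a : T -> K) (rho : place -> int) (c : int) :
  size e = n -> uniq e -> separated e ->
  (forall i P, i \in e -> vge P (- sigma P) (dlog i)) ->
  (forall i P, i \in e -> vge P (- rho P) (a i)) -> bdd rho c ->
  4%:Z ^+ n * (c + (2 * cs + ck)) < l ->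
  \sum_(i <- e) a i * X i = 0 -> forall i, i \in e -> a i = 0.
Proof.
have cs0 := bdd_ge0 bsig; have ck0 := bdd_ge0 bkp.
elim: n e a rho c => [|n IH] e a rho c sz ue sep dl ap br small E i0 i0e.
  by move: i0e; rewrite (size0nil sz).
have c0 := bdd_ge0 br; have r0 := proj1 br.
apply: contraTeq isT => a0.
pose e' := rem i0 e.
have pe : perm_eq e (i0 :: e') by exact: perm_to_rem.
have ue' : uniq e' by exact: rem_uniq.
have sub : {subset e' <= e} by move=> i; exact: mem_rem.
have nie' i : i \in e' -> i != i0 by rewrite mem_rem_uniq // => /andP[].
have sz' : size e' = n by rewrite size_rem // sz.
pose b i := a i / a i0.
pose rb P := rho P + zer (a i0) P.
have bza : bdd (zer (a i0)) c by apply: (zeros_bdd ff hg a0 _ br) => P; exact: ap.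
have brb : bdd rb (c + c) by exact: bddD.
have bp i P : i \in e -> vge P (- rb P) (b i).
  by move=> ie; rewrite /rb opprD; apply: vgeM; [exact: ap | exact: vge_inv_zer].
pose Y i := X i / X i0.
have E1 : \sum_(i <- e') b i * Y i = - 1.
  apply/eqP; rewrite -subr_eq0 opprK; apply/eqP.
  have := E; rewrite (perm_big _ pe) big_cons addrC => E2.
  have n0 : a i0 * X i0 != 0 by rewrite mulf_neq0.
  apply: (mulIf n0); rewrite mul0r -[RHS]E2 mulrDl mul1r mulr_suml; congr (_ + _).
  by apply: eq_bigr => i _; rewrite /b /Y; field; rewrite X0 a0.
pose th i := dlog i - dlog i0.
have DY i : D (Y i) = th i * Y i.
  by rewrite /Y /th /dlog (derD_div dD) //; field; rewrite !X0.
have DbY i : D (b i * Y i) = (D (b i) + b i * th i) * Y i.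
  by rewrite (derD_mul dD) DY; ring.
pose a' i := D (b i) + b i * th i.
have E2 : \sum_(i <- e') a' i * X i = 0.
  have : D (\sum_(i <- e') b i * Y i) = 0 by rewrite E1 (derDN dD) (derD1 dD) oppr0.
  rewrite (derD_sum dD) => H.
  transitivity ((\sum_(i <- e') D (b i * Y i)) * X i0); last by rewrite H mul0r.
  rewrite mulr_suml; by apply: eq_bigr => i _; rewrite DbY /Y /a'; field; rewrite X0.
pose rho' P := 2 * rb P + kp P + sigma P.
have br' : bdd rho' (2 * (c + c) + ck + cs).
  by apply: bddD => //; apply: bddD => //; apply: (bddZ 2).
have ap' i P : i \in e' -> vge P (- rho' P) (a' i).
  move=> ie'; have ie := sub i ie'.
  have rb0 : 0 <= rb P by exact: (proj1 brb).
  have s0 : 0 <= sigma P by exact: (proj1 bsig).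
  have k0 := kp_ge0 P.
  apply: vgeD.
    apply: vgeW (der_pole rb0 (bp i P ie)); rewrite /rho'; move: (rb P) (kp P) (sigma P) s0; lia.
  apply: (@vgeW _ _ _ P (- rb P + - sigma P)).
    by rewrite /rho'; move: (rb P) (kp P) (sigma P) rb0 k0 s0; lia.
  by apply: vgeM; [exact: bp | apply: vgeB; apply: dl].
(* The new coefficients have mass 4c + ck + cs, and adding 2cs + ck still gives at most 4(c + 2cs +
   ck): hence the factor 4 per term. *)
have small' : 4%:Z ^+ n * (2 * (c + c) + ck + cs + (2 * cs + ck)) < l.
  apply: le_lt_trans small; rewrite exprSr -mulrA.
  by apply: ler_wpM2l; [rewrite exprn_ge0 | lia].
have sep' : separated e' by move=> i j ie je; apply: sep; exact: sub.
have all0 := IH e' a' rho' _ sz' ue' sep' (fun i P ie => dl i P (sub i ie)) ap' br' small' E2.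
have [j je' bj] : exists2 j, j \in e' & b j != 0.
  apply: NNPP => no; move: E1; rewrite big_seq big1 => [/eqP|i ie].
    by rewrite eq_sym oppr_eq0 oner_eq0.
  have -> : b i = 0 by apply/eqP/negPn/negP => bi; apply: no; exists i.
  by rewrite mul0r.
have aj : a j != 0 by apply: contraNneq bj => aj; rewrite /b aj mul0r.
case: (@const_ratio e a j i0 rb (c + c) sep (sub j je') i0e (nie' j je') aj a0) => //.
- by move=> P; apply: bp; exact: sub.
- apply: le_lt_trans small; have : 1 <= 4%:Z ^+ n :> int by rewrite exprn_ege1.
  by rewrite exprS; move: (4%:Z ^+ n) => q q1; nia.
- have -> : a j * X j / (a i0 * X i0) = b j * Y j by rewrite /b /Y; field; rewrite X0 a0.
  by rewrite DbY -/(a' j) all0 // mul0r.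
Qed.

(** Two terms with the same logarithmic derivative have a constant ratio. *)
Lemma no_eigen (e : seq T) (a : T -> K) (rho : place -> int) (c : int) (lam : K) i j :
  separated e -> i \in e -> j \in e -> i != j -> a i != 0 -> a j != 0 ->
  (forall P, vge P (- rho P) (a i)) -> (forall P, vge P (- rho P) (a j)) -> bdd rho c ->
  2 * c < l -> D (a i) + a i * dlog i = lam * a i -> D (a j) + a j * dlog j = lam * a j -> False.
Proof.
move=> sep ie je ij ai aj Hi Hj br lt Ei Ej.
have bz := zeros_bdd ff hg aj Hj br.
apply: (@const_ratio e a i j (fun P => rho P + zer (a j) P) (c + c)) => //.
- by move=> P; rewrite opprD; apply: vgeM => //; exact: vge_inv_zer.
- exact: bddD.
- by lia.
have aXj : a j * X j != 0 by rewrite mulf_neq0.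
by rewrite (derD_div dD) // !D_term Ei Ej; ring.
Qed.

End UnitEquations.

From mathcomp Require Import perm.

(** * Wronskians and their orders at a place *)

Section Wronskian.
Variables (k : closedFieldType) (K : fieldType) (iota : {rmorphism k -> K}).
Notation place := (place iota).
Notation derivation := (derivation iota).
Hypothesis ff : is_function_field iota.
Hypothesis char0 : [pchar k] =i pred0.
Variable D : K -> K.
Hypothesis dD : derivation D.
Hypothesis D0 : exists h, D h != 0.

Definition wronskian n (f : 'I_n -> K) : 'M[K]_n := \matrix_(s, j) iter j D (f s).

Lemma wronskian_neq0 n (f : 'I_n -> K) : kfree iota f -> \det (wronskian f) != 0.
Proof.
elim: n f => [|n IH] f fr; first by rewrite det_mx00 oner_neq0.
apply/negP => /det0P [v v0 vM].
have E (j : 'I_n.+1) : \sum_s v 0 s * iter j D (f s) = 0.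
  have := congr1 (fun M : 'rV_n.+1 => M 0 j) vM; rewrite !mxE => H.
  by rewrite -[RHS]H; apply: eq_bigr => s _; rewrite mxE.
pose w := widen_ord (leqnSn n).
pose f' (i : 'I_n) := f (w i).
have fr' : kfree iota f'.
  move=> c Ec i; pose c' (s : 'I_n.+1) := oapp c 0 (insub (s : nat) : option 'I_n).
  have cw (i' : 'I_n) : c' (w i') = c i' by rewrite /c' /= valK.
  have cm : c' ord_max = 0 by rewrite /c' insubF //= ltnn.
  rewrite -cw; apply: fr; rewrite big_ord_recr /= cm rmorph0 mul0r addr0 -[RHS]Ec.
  by apply: eq_bigr => i' _; rewrite cw.
have det' := IH f' fr'.
have inj (b : 'I_n -> K) : (forall j : 'I_n, \sum_s b s * iter j D (f' s) = 0) -> forall s, b s = 0.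
  move=> Eb s; have : (\row_s b s) *m wronskian f' = 0.
    by apply/rowP => j; rewrite !mxE -[RHS](Eb j); apply: eq_bigr => i _; rewrite !mxE.
  move=> rw0; case: (eqVneq (\row_s b s) 0) => [r0|r0].
    by have := congr1 (fun M : 'rV_n => M 0 s) r0; rewrite !mxE.
  by case/negP: det'; apply/det0P; exists (\row_s b s).
case: (eqVneq (v 0 ord_max) 0) => vm.
  case/eqP: v0; apply/rowP => s; rewrite mxE.
  have vw0 (i : 'I_n) : v 0 (w i) = 0.
    apply: (inj (fun i => v 0 (w i))) => j.
    by have := E (w j); rewrite big_ord_recr /= vm mul0r addr0.
  case: (unliftP ord_max s) => [i ->|-> //].
  by rewrite (_ : lift ord_max i = w i) //; apply: val_inj; rewrite /= /bump leqNgt ltn_ord.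
pose b i := v 0 (w i) / v 0 ord_max.
have Eb (j : 'I_n.+1) : \sum_i b i * iter j D (f' i) + iter j D (f ord_max) = 0.
  apply: (mulfI vm); rewrite mulr0 -[RHS](E j) big_ord_recr /= mulrDr mulr_sumr; congr (_ + _).
  by apply: eq_bigr => i _; rewrite /b mulrA [v 0 ord_max * _]mulrC divfK.
(* Differentiating the j-th relation and subtracting the next one leaves the relation with
   coefficients D b_i, which the smaller nonzero Wronskian forces to vanish. *)
have Db i : D (b i) = 0.
  apply: (inj (fun i => D (b i))) => j.
  have := congr1 D (Eb (w j)); rewrite (derD0 dD) (derD_add dD) (derD_sum dD).
  have := Eb (lift ord0 j); rewrite lift0 /= => E1 E2.
  transitivity ((\sum_i D (b i * iter j D (f' i)) + D (iter j D (f ord_max))) -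
    (\sum_i b i * D (iter j D (f' i)) + D (iter j D (f ord_max)))); last by rewrite E1 E2 subrr.
  rewrite opprD addrACA subrr addr0 -sumrB.
  by apply: eq_bigr => i' _; rewrite (derD_mul dD (b i')); ring.
have cb i : exists c, b i = iota c by apply: (der_const char0 ff dD D0 (Db i)).
pose c i := proj1_sig (constructive_indefinite_description _ (cb i)).
have cE i : b i = iota (c i) by rewrite /c; case: constructive_indefinite_description.
pose c' (s : 'I_n.+1) := oapp c 1 (insub (s : nat) : option 'I_n).
have := fr c' _ ord_max; rewrite /c' insubF /= ?ltnn // => H.
have /eqP : (1 : k) = 0; last by rewrite oner_eq0.
apply: H; rewrite big_ord_recr /= insubF /= ?ltnn // rmorph1 mul1r -[RHS](Eb ord0) /=.
by congr (_ + _); apply: eq_bigr => i _; rewrite valK /= cE.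
Qed.

(* D^j (h f) = sum_i leib h i j * D^i f *)
Fixpoint leib h (i j : nat) : K :=
  if j is j'.+1 then D (leib h i j') + (if i is i'.+1 then leib h i' j' else 0)
  else if i == 0%N then h else 0.

Lemma leib_gt h i j : (j < i)%N -> leib h i j = 0.
Proof.
elim: j i => [|j IH] i /=; first by case: i.
by case: i => // i lt; rewrite !IH ?(derD0 dD) ?addr0 //; lia.
Qed.

Lemma leib_diag h j : leib h j j = h.
Proof. by elim: j => //= j ->; rewrite leib_gt // (derD0 dD) add0r. Qed.

Lemma leibE h f n j : (j < n)%N -> iter j D (h * f) = \sum_(i < n) leib h i j * iter i D f.
Proof.
elim: j => [|j IH] lt /=.
  case: n lt => // n _; rewrite big_ord_recl /= big1 ?addr0 // => i _.
  by rewrite mul0r.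
rewrite IH; last by lia.
rewrite (derD_sum dD).
transitivity (\sum_(i < n) D (leib h i j) * iter i D f + \sum_(i < n) leib h i j * iter i.+1 D f).
  by rewrite -big_split; apply: eq_bigr => i _; rewrite (derD_mul dD).
under [RHS]eq_bigr => i _ do rewrite mulrDl.
rewrite [RHS]big_split /=; congr (_ + _).
case: n lt IH => // n lt IH.
rewrite [RHS]big_ord_recl /= mul0r add0r big_ord_recr /= leib_gt ?mul0r ?addr0 //; lia.
Qed.

(** By Leibniz, scaling by h is multiplication by a triangular matrix with h on the diagonal. *)
Lemma wronskian_scale n h (f : 'I_n -> K) :
  \det (wronskian (fun s => h * f s)) = h ^+ n * \det (wronskian f).
Proof.
have -> : wronskian (fun s => h * f s) = wronskian f *m \matrix_(i, j) leib h i j.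
  apply/matrixP => s j; rewrite !mxE (leibE h (f s) (ltn_ord j)).
  by apply: eq_bigr => i _; rewrite !mxE mulrC.
rewrite det_mulmx mulrC; congr (_ * _).
rewrite -det_tr det_trig; last first.
  by apply/is_trig_mxP => i j lt; rewrite !mxE leib_gt.
under eq_bigr => i _ do rewrite !mxE leib_diag.
by rewrite prodr_const card_ord.
Qed.

(** Multilinearity over k survives differentiation because constants pass through D. *)
Lemma wronskian_expand n (I : finType) (lam : 'I_n -> I -> k) (Y : I -> K) (f : 'I_n -> K) :
  (forall s, f s = \sum_t iota (lam s t) * Y t) ->
  \det (wronskian f) = \sum_(h : {ffun 'I_n -> I}) iota (\prod_s lam s (h s)) *
    \det (wronskian (fun s => Y (h s))).
Proof.
move=> fE.
have DE s (j : nat) : iter j D (f s) = \sum_t iota (lam s t) * iter j D (Y t).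
  elim: j => [|j IH] /=; first exact: fE.
  by rewrite IH (derD_sum dD); apply: eq_bigr => t _; rewrite (derDZ dD).
under [RHS]eq_bigr => h _ do rewrite /determinant mulr_sumr.
rewrite exchange_big /= /determinant; apply: eq_bigr => sg _.
under eq_bigr => s _ do rewrite !mxE DE.
rewrite bigA_distr_bigA mulr_sumr; apply: eq_bigr => h _.
rewrite big_split /= rmorph_prod mulrCA; congr (_ * (_ * _)).
by apply: eq_bigr => s _; rewrite !mxE.
Qed.

Lemma wronskian_noninj n (I : finType) (Y : I -> K) (h : 'I_n -> I) :
  ~ injective h -> \det (wronskian (fun s => Y (h s))) = 0.
Proof.
move=> ninj; have [s1 [s2 [ne E]]] : exists s1 s2, s1 != s2 /\ h s1 = h s2.
  apply: NNPP => no; apply: ninj => s1 s2 E; apply/eqP/negPn/negP => ne.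
  by apply: no; exists s1, s2.
by apply: (determinant_alternate ne) => j; rewrite !mxE E.
Qed.

Variable P : place.

Lemma vge_prod (I : finType) (m : I -> int) (F : I -> K) : (forall i, vge P (m i) (F i)) ->
  vge P (\sum_i m i) (\prod_i F i).
Proof.
move=> H; apply: (big_ind2 (fun a b => vge P a b)) => // [|a b c d]; first exact: vge1.
exact: vgeM.
Qed.

Lemma vge_det n (M : 'M[K]_n) (m : 'S_n -> 'I_n -> int) (b : int) :
  (forall sg s, vge P (m sg s) (M s (sg s))) -> (forall sg, b <= \sum_s m sg s) -> vge P b (\det M).
Proof.
move=> H le; rewrite /determinant; apply: vge_sum => sg _.
rewrite -[b]add0r; apply: vgeM.
  by apply: vge0X; rewrite vgeN; exact: vge1.
by apply: vgeW (le sg) _; apply: vge_prod.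
Qed.

Lemma wronskian_vge_any n (f : 'I_n -> K) (m : 'I_n -> int) : (forall s, vge P (m s) (f s)) ->
  vge P (\sum_s m s - n%:Z * (n%:Z * (1 + kp D P))) (\det (wronskian f)).
Proof.
move=> H; apply: (@vge_det _ _ (fun sg s => m s - n%:Z * (1 + kp D P))) => [sg s|sg].
  rewrite mxE; apply: vgeW (iter_der_any ff char0 dD D0 (sg s) (H s)).
  rewrite lerD2l lerN2; apply: ler_wpM2r; last by rewrite lez_nat ltnW.
  by rewrite addr_ge0 ?kp_ge0.
by rewrite big_split /= sumr_const card_ord -mulr_natl natz mulrN.
Qed.

Lemma wronskian_vge_pole n (f : 'I_n -> K) (r : int) : 0 <= r -> (forall s, vge P (- r) (f s)) ->
  vge P (- (n%:Z * (n%:Z * (r + 2 * kp D P)))) (\det (wronskian f)).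
Proof.
move=> r0 H; apply: (@vge_det _ _ (fun sg s => - (n%:Z * (r + 2 * kp D P)))) => [sg s|sg].
  rewrite mxE; apply: vgeW (iter_der_pole ff char0 dD D0 (sg s) r0 (H s)).
  have := kp_ge0 D P; have := ltn_ord (sg s); move: (kp D P) (nat_of_ord (sg s)) r0 => a b; clear; nia.
have E (x : int) : x *+ n = n%:Z * x by rewrite -mulr_natl natz.
by rewrite sumrN sumr_const card_ord E.
Qed.

(** Scaling out a uniformizer t gives the factor t^n; the remaining entries are regular because D is
    regular at P. Entrywise estimates would lose an order with each derivative. *)
Lemma wronskian_vge_zero n (f : 'I_n -> K) : kap D P <= 0 -> (forall s, vge P 1 (f s)) ->
  vge P n%:Z (\det (wronskian f)).
Proof.
move=> kap0 H; pose t := unif P; have vt := unifP P; have t0 := unif_neq0 vt.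
pose h s := f s / t.
have fE s : f s = t * h s by rewrite /h mulrC divfK.
have hreg s : vge P 0 (h s) by rewrite -(@vge_mulr _ _ _ P _ t) // vt add0r mulrC -fE.
have -> : wronskian f = wronskian (fun s => t * h s).
  by apply/matrixP => s j; rewrite !mxE fE.
rewrite wronskian_scale -[n%:Z]addr0; apply: vgeM.
  by rewrite vgeE ?expf_neq0 // placeX // vt mulr1.
apply: (@vge_det _ _ (fun _ _ => 0)) => [sg s|sg]; last by rewrite big1.
rewrite mxE; elim: (nat_of_ord _) => //= j IH.
by apply: vgeW (der_reg ff char0 dD D0 IH); rewrite oppr_ge0.
Qed.

(** Choices with a repeated function contribute 0, so a lower bound over n distinct spanning
    functions is enough. *)
Lemma wronskian_vge_span n (I : finType) (Y : I -> K) (y : I -> int) (f : 'I_n -> K) (b : int) :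
  (forall s, kspan iota Y (f s)) -> (forall t, vge P (y t) (Y t)) ->
  (forall h : 'I_n -> I, injective h -> b <= \sum_s y (h s)) ->
  vge P (b - n%:Z * (n%:Z * (1 + kp D P))) (\det (wronskian f)).
Proof.
move=> fY Hy Hb.
pose lam s := proj1_sig (constructive_indefinite_description _ (fY s)).
have fE s : f s = \sum_t iota (lam s t) * Y t.
  by rewrite /lam; case: constructive_indefinite_description.
rewrite (wronskian_expand fE); apply: vge_sum => h _; apply: vgeZ.
case: (excluded_middle_informative (injective h)) => [inj|/wronskian_noninj ->]; last exact: vge0.
apply: vgeW (wronskian_vge_any (fun s => Hy (h s))).
by rewrite lerD2r; exact: Hb.
Qed.

End Wronskian.

(** * Gauss's theorem: polynomial rings over factorial rings are factorial *)

Section Factorization.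
Implicit Types R S : idomainType.

Definition rdiv R (a b : R) := exists c, b = a * c.
Definition isunit R (a : R) := exists b, a * b = 1.
Definition rprime R (p : R) :=
  [/\ p != 0, ~ isunit p & forall a b, rdiv p (a * b) -> rdiv p a \/ rdiv p b].
Definition prime_factorial R := forall a : R, a != 0 ->
  exists (u : R) (s : seq R), [/\ isunit u, forall p, p \in s -> rprime p & a = u * \prod_(p <- s) p].

Lemma rdiv_refl R (a : R) : rdiv a a. Proof. by exists 1; rewrite mulr1. Qed.
Lemma rdiv_trans R (a b c : R) : rdiv a b -> rdiv b c -> rdiv a c.
Proof. by move=> [x ->] [y ->]; exists (x * y); rewrite mulrA. Qed.
Lemma rdiv_mull R (a b c : R) : rdiv a b -> rdiv a (c * b).
Proof. by move=> [x ->]; exists (c * x); rewrite mulrCA. Qed.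
Lemma rdiv_mulr R (a b c : R) : rdiv a b -> rdiv a (b * c).
Proof. by rewrite mulrC; exact: rdiv_mull. Qed.
Lemma rdivD R (a b c : R) : rdiv a b -> rdiv a c -> rdiv a (b + c).
Proof. by move=> [x ->] [y ->]; exists (x + y); rewrite mulrDr. Qed.
Lemma rdivN R (a b : R) : rdiv a b -> rdiv a (- b).
Proof. by move=> [x ->]; exists (- x); rewrite mulrN. Qed.
Lemma rdiv0 R (a : R) : rdiv a 0. Proof. by exists 0; rewrite mulr0. Qed.
Lemma rdiv_sum R (a : R) (I : Type) (r : seq I) (p : pred I) (F : I -> R) :
  (forall i, p i -> rdiv a (F i)) -> rdiv a (\sum_(i <- r | p i) F i).
Proof. by move=> H; elim/big_ind: _ => //; [exact: rdiv0 | move=> ? ?; exact: rdivD]. Qed.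
Lemma rprime_not1 R (p : R) : rprime p -> ~ rdiv p 1.
Proof. by case=> _ nu _ [c E]; apply: nu; exists c. Qed.
Lemma rprimeX R (p a : R) n : rprime p -> rdiv p (a ^+ n) -> rdiv p a.
Proof.
move=> pp; elim: n => [|n IH]; first by rewrite expr0 => /(rprime_not1 pp).
by rewrite exprS; case: (pp) => _ _ H /H [].
Qed.
Lemma rprime_prod R (p : R) (s : seq R) : rprime p -> rdiv p (\prod_(q <- s) q) ->
  exists2 q, q \in s & rdiv p q.
Proof.
move=> pp; elim: s => [|q s IH]; first by rewrite big_nil => /(rprime_not1 pp).
rewrite big_cons; case: (pp) => _ _ H /H [pq|/IH [r rs pr]].
  by exists q; rewrite // mem_head.
by exists r; rewrite // inE rs orbT.
Qed.
Lemma rprime_assoc R (p q : R) : rprime p -> rprime q -> rdiv p q -> rdiv q p.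
Proof.
move=> pp [q0 nq Hq] [v E]; case: (Hq p v); [by rewrite -E; exact: rdiv_refl|by []|].
move=> [v' E']; case: pp => _ np _; case: np; exists v'.
by apply: (mulfI q0); rewrite mulr1 {2}E E'; ring.
Qed.

Lemma factor_cancel R (a b p u : R) (s : seq R) : a != 0 -> a = p * b -> rprime p -> isunit u ->
  (forall q, q \in s -> rprime q) -> a = u * \prod_(q <- s) q ->
  exists u' s', [/\ isunit u', forall q, q \in s' -> rprime q, (size s').+1 = size s
    & b = u' * \prod_(q <- s') q].
Proof.
move=> a0 aE pp [u1 uu] sp fE; have [p0 np Hp] := pp.
have : rdiv p (u * \prod_(q <- s) q) by rewrite -fE; exists b.
case/Hp => [[w E]|/(rprime_prod pp) [q qs pq]].
  by case: np; exists (w * u1); rewrite mulrA -E.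
have [w qE] := rprime_assoc pp (sp q qs) pq.
have [w' qE'] := pq.
have ww : w' * w = 1 by apply: (mulfI p0); rewrite mulr1 mulrA -qE' -qE.
exists (u * w'), (rem q s); split.
- by exists (u1 * w); rewrite mulrACA uu ww mulr1.
- by move=> r /mem_rem /sp.
- by rewrite size_rem // prednK //; case: (s) qs.
- apply: (mulfI p0); rewrite -aE fE (perm_big _ (perm_to_rem qs)) big_cons /=; move: (\prod_(j <- rem q s) j) => Z; rewrite qE'; ring.
Qed.

Section Gauss.
Variable R : idomainType.
Hypothesis facR : prime_factorial R.
Implicit Types (f h w : {poly R}) (c p : R).

Lemma rdiv_polyC c f : rdiv c%:P f <-> forall i, rdiv c f`_i.
Proof.
split=> [[h ->] i|H]; first by rewrite coefCM; exists h`_i.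
pose b i := proj1_sig (constructive_indefinite_description _ (H i)).
have bE i : f`_i = c * b i by rewrite /b; case: constructive_indefinite_description.
exists (\poly_(i < size f) b i); apply/polyP => i; rewrite coefCM coef_poly.
by case: ltnP => [_|ge]; [exact: bE | rewrite mulr0 nth_default].
Qed.

Lemma first_nondiv c f : ~ rdiv c%:P f -> exists i, ~ rdiv c f`_i /\ forall j, (j < i)%N -> rdiv c f`_j.
Proof.
move=> nd; pose Q i := if excluded_middle_informative (rdiv c f`_i) then false else true.
have QP i : Q i <-> ~ rdiv c f`_i by rewrite /Q; case: excluded_middle_informative.
have ex : exists i, Q i.
  apply: NNPP => no; apply: nd; apply/rdiv_polyC => i; apply: NNPP => ni.
  by apply: no; exists i; apply/QP.
have [i /QP Qi mini] := ex_minnP ex; exists i; split=> // j lt.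
by apply: NNPP => /QP /mini; lia.
Qed.

(** In a product, the coefficient at the sum of the first indices where p fails to divide is not
    divisible by p. *)
Lemma rprime_polyC p : rprime p -> rprime p%:P.
Proof.
move=> pp; have [p0 np Hp] := pp; split; first by rewrite polyC_eq0.
  move=> [h E]; apply: np; exists h`_0.
  by have := congr1 (fun f : {poly R} => f`_0) E; rewrite coefCM coef1.
move=> a b ab; apply: NNPP => no.
have [|i [ni mini]] := @first_nondiv p a; first by move=> H; apply: no; left.
have [|j [nj minj]] := @first_nondiv p b; first by move=> H; apply: no; right.
have /rdiv_polyC/(_ (i + j)%N) := ab; rewrite coefM.
have lt : (i < (i + j).+1)%N by lia.
rewrite (bigD1 (Ordinal lt)) //= addKn => dv.
have : rdiv p (a`_i * b`_j).
  rewrite -[_ * _](addrK (\sum_(l < (i + j).+1 | l != Ordinal lt) a`_l * b`_(i + j - l))).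
  apply: rdivD => //; apply: rdivN; apply: rdiv_sum => l; rewrite -val_eqE /= => ne.
  case: (ltnP l i) => [/mini H|ge]; first exact: rdiv_mulr.
  by apply: rdiv_mull; apply: minj; move: (ltn_ord l) ne ge; lia.
by case/Hp.
Qed.

Definition primitive f := f != 0 /\ forall p, rprime p -> ~ rdiv p%:P f.

Lemma primitive_dvd f h : primitive f -> rdiv h f -> primitive h.
Proof.
move=> [f0 pf] hf; split; first by case: hf => c; apply: contra_eq_neq => ->; rewrite mul0r.
by move=> p pp ph; apply: (pf p pp); apply: rdiv_trans hf.
Qed.

(** Each prime constant taken out of f removes one prime factor of its leading coefficient, so the
    extraction ends. *)
Lemma primitive_part f : f != 0 -> exists c f0, [/\ c != 0, primitive f0 & f = c%:P * f0].
Proof.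
move=> f0; have l0 : lead_coef f != 0 by rewrite lead_coef_eq0.
have [u [s [uu sp E]]] := facR l0.
elim: {s}(size s) {-2}s (erefl (size s)) u uu sp f f0 l0 E => [|n IH] s sz u uu sp f f0 l0 E;
    case: (excluded_middle_informative (primitive f)) => [pf|npf].
- by exists 1, f; split=> //; rewrite ?oner_neq0 // polyC1 mul1r.
- case: npf; split=> // p pp [h fE].
  move: E; rewrite (size0nil sz) big_nil mulr1 fE lead_coefM lead_coefC => E.
  by case: pp => _ np _; case: np; case: uu => v uv; exists (lead_coef h * v); rewrite mulrA E.
- by exists 1, f; split=> //; rewrite ?oner_neq0 // polyC1 mul1r.
have [p [pp [h fE]]] : exists p, rprime p /\ rdiv p%:P f.
  apply: NNPP => no; apply: npf; split=> // p pp dv; apply: no; by exists p.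
have h0 : h != 0 by apply: contraNneq f0 => h0; rewrite fE h0 mulr0.
have lE : lead_coef f = p * lead_coef h by rewrite fE lead_coefM lead_coefC.
have [u' [s' [uu' sp' sz' E']]] := factor_cancel l0 lE pp uu sp E.
have ss' : size s' = n by move: sz'; rewrite sz => -[].
have lh0 : lead_coef h != 0 by rewrite lead_coef_eq0.
have [c [f1 [c0 pf1 hE]]] := IH s' ss' u' uu' sp' h h0 lh0 E'.
exists (p * c), f1; split=> //; first by rewrite mulf_neq0 //; case: pp.
by rewrite fE hE polyCM mulrA.
Qed.

(** The prime factors of c are stripped one at a time: such a prime does not divide the primitive f,
    hence divides the cofactor. *)
Lemma gauss_cancel c f h : c != 0 -> primitive f -> rdiv f (c%:P * h) -> rdiv f h.
Proof.
move=> c0 [f0 pf]; have [u [s [[v uv] sp ->]]] := facR c0.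
elim: s sp => [|p s IH] sp.
  rewrite big_nil mulr1 => -[q E]; exists (q * v%:P).
  by rewrite mulrA -E mulrAC -polyCM uv mul1r.
rewrite big_cons => -[q E]; apply: IH => [r rs|]; first by apply: sp; rewrite inE rs orbT.
have pp : rprime p by apply: sp; rewrite mem_head.
have [_ _ /(_ f q)] := rprime_polyC pp; case.
- by exists ((u * \prod_(j <- s) j)%:P * h); rewrite -E !polyCM; ring.
- by move/(pf p pp).
move=> [q' qE]; exists q'.
have pP0 : p%:P != 0 :> {poly R} by rewrite polyC_eq0; case: pp.
by apply: (mulfI pP0); rewrite [RHS]mulrCA -qE -E !polyCM; ring.
Qed.

Lemma primitive_const f : primitive f -> (size f <= 1)%N -> isunit f.
Proof.
move=> [f0 pf] sf; have fE := size1_polyC sf.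
have c0 : f`_0 != 0 by apply: contraNneq f0 => c0; rewrite fE c0.
have [u [s [[v uv] sp E]]] := facR c0; case: s sp E => [|p s] sp E.
  by exists v%:P; rewrite fE E big_nil mulr1 -polyCM uv.
case: (pf p (sp p (mem_head _ _))); exists ((u * \prod_(q <- s) q)%:P).
by rewrite fE E big_cons -polyCM; congr _%:P; ring.
Qed.

(** Only factorizations into two factors of positive degree are excluded; constant factors are
    handled by primitivity. *)
Definition weakly_irreducible f := forall a b, f = a * b -> (size a <= 1)%N \/ (size b <= 1)%N.

Lemma irreducible_prime f : primitive f -> (1 < size f)%N -> weakly_irreducible f -> rprime f.
Proof.
move=> pf sf irr; have [f0 _] := pf; split=> //.
  move=> [h E]; have h0 : h != 0.
    by apply: contra_eq_neq E => ->; rewrite mulr0 eq_sym oner_eq0.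
  have := congr1 (fun q : {poly R} => size q) E; rewrite size_mul // size_poly1.
  by have := size_poly_gt0 h; rewrite h0; lia.
move=> a b ab; apply: NNPP => no.
(* A nonzero w of least degree in the ideal (a, f) divides a constant multiple of each of its
   elements, so its primitive part divides a and f. Irreducibility then leaves two cases: this part
   is a unit and f divides b, or it is associated to f and f divides a. *)
pose J w := exists x y, w = x * a + y * f.
pose Q n := if excluded_middle_informative (exists w, [/\ J w, w != 0 & size w = n]) then true else false.
have ex : exists n, Q n.
  exists (size f); rewrite /Q; case: excluded_middle_informative => // -[].
  by exists f; split=> //; exists 0, 1; rewrite mul0r add0r mul1r.
have [n] := ex_minnP ex; rewrite {1}/Q.
case: excluded_middle_informative => // -[w [[x [y wE]] w0 sw]] _ minn.
have Jdvd h : J h -> exists2 l, l != 0 & rdiv w (l%:P * h).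
  move=> [x' [y' hE]].
  exists (lead_coef w ^+ scalp h w); first by rewrite expf_neq0 // lead_coef_eq0.
  have E := Pdiv.Idomain.divp_eq h w.
  suff r0 : h %% w = 0 by exists (h %/ w); rewrite mul_polyC E r0 addr0 mulrC.
  apply/eqP/negPn/negP => r0.
  have : Q (size (h %% w)).
    rewrite /Q; case: excluded_middle_informative => // -[]; exists (h %% w); split=> //.
    exists ((lead_coef w ^+ scalp h w)%:P * x' - h %/ w * x), ((lead_coef w ^+ scalp h w)%:P * y' - h %/ w * y).
    transitivity ((lead_coef w ^+ scalp h w)%:P * h - h %/ w * w).
      by rewrite mul_polyC E addrC addKr.
    by move: (_%:P) (h %/ w) => L q; rewrite hE wE; ring.
  move/minn; rewrite leqNgt -sw Pdiv.Idomain.ltn_modp w0 //.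
have [c [w1 [c0 pw1 wE1]]] := primitive_part w0.
have w1dvd h : J h -> rdiv w1 h.
  move=> /Jdvd [l l0 dv]; apply: (gauss_cancel l0 pw1).
  by apply: rdiv_trans dv; exists c%:P; rewrite wE1 mulrC.
have w1f : rdiv w1 f by apply: w1dvd; exists 0, 1; rewrite mul0r add0r mul1r.
have w1a : rdiv w1 a by apply: w1dvd; exists 1, 0; rewrite mul0r addr0 mul1r.
have [t fE] := w1f; case: (irr _ _ fE) => [s1|st].
  have [v w1v] := primitive_const pw1 s1.
  apply: no; right; apply: (gauss_cancel c0 pf).
  have : rdiv f (w * b).
    rewrite wE mulrDl; apply: rdivD; first by rewrite -mulrA; exact: rdiv_mull.
    by rewrite mulrAC; apply: rdiv_mull; exact: rdiv_refl.
  move/(fun H => @rdiv_mulr _ _ _ v H); rewrite wE1.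
  by have -> : c%:P * w1 * b * v = c%:P * b by rewrite -[RHS]mulr1 -w1v; ring.
have pt : primitive t by apply: primitive_dvd pf _; exists w1; rewrite mulrC.
have [v tv] := primitive_const pt st.
apply: no; left; apply: rdiv_trans w1a; exists v.
by rewrite fE -mulrA tv mulr1.
Qed.

Lemma factorial_poly : prime_factorial {poly R}.
Proof.
move=> f f0; have [c [f1 [c0 pf1 ->]]] := primitive_part f0.
have [u [s [[v uv] sp cE]]] := facR c0.
have H : exists (u1 : {poly R}) (s1 : seq {poly R}), [/\ isunit u1, forall p : {poly R}, p \in s1 -> rprime p & f1 = u1 * \prod_(p <- s1) p].
  elim: {f1}(size f1) {-2}f1 (leqnn (size f1)) pf1 => [|n IH] h sh ph.
    by case: ph => h0; move: sh; rewrite leqn0 size_poly_eq0 (negPf h0).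
  case: (leqP (size h) 1) => [s1|s1].
    by exists h, [::]; split=> //; [exact: primitive_const | rewrite big_nil mulr1].
  case: (excluded_middle_informative (weakly_irreducible h)) => irr.
    exists 1, [:: h]; split; [by exists 1; rewrite mulr1 | | by rewrite big_seq1 mul1r].
    by move=> p; rewrite inE => /eqP ->; exact: irreducible_prime.
  have [a [b [hE sa sb]]] : exists a b, [/\ h = a * b, (1 < size a)%N & (1 < size b)%N].
    apply: NNPP => no; apply: irr => a b E.
    case: (leqP (size a) 1) => la; [by left | right].
    by rewrite leqNgt; apply/negP => lb; apply: no; exists a, b.
  have a0 : a != 0 by rewrite -size_poly_gt0 ltnW.
  have b0 : b != 0 by rewrite -size_poly_gt0 ltnW.
  have pa : primitive a by apply: primitive_dvd ph _; exists b.
  have pb : primitive b by apply: primitive_dvd ph _; exists a; rewrite mulrC.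
  have sE : size h = (size a + size b).-1 by rewrite hE size_mul.
  have [|ua [sla [[va uva] spa aE]]] := IH a _ pa; first by lia.
  have [|ub [slb [[vb uvb] spb bE]]] := IH b _ pb; first by lia.
  exists (ua * ub), (sla ++ slb); split.
  - by exists (va * vb); rewrite mulrACA uva uvb mulr1.
  - by move=> p; rewrite mem_cat => /orP [/spa|/spb].
  - by rewrite hE aE bE big_cat /= mulrACA.
have [u1 [s1 [[v1 uv1] sp1 fE]]] := H.
exists (u%:P * u1), ([seq p%:P | p <- s] ++ s1); split.
- by exists (v%:P * v1); rewrite mulrACA -polyCM uv uv1 mulr1.
- by move=> p; rewrite mem_cat => /orP [/mapP [q qs ->]|/sp1 //]; apply: rprime_polyC; exact: sp.
- by rewrite cE fE big_cat /= big_map polyCM rmorph_prod /= mulrACA.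
Qed.

End Gauss.

Lemma factorial_iso R S (phi : R -> S) (psi : S -> R) :
  cancel phi psi -> cancel psi phi -> phi 0 = 0 -> phi 1 = 1 -> {morph phi : x y / x * y} ->
  prime_factorial R -> prime_factorial S.
Proof.
move=> K1 K2 phi0 phi1 phiM fac a a0.
have inj : injective phi := can_inj K1.
have unit_phi u : isunit u -> isunit (phi u).
  by move=> [v E]; exists (phi v); rewrite -phiM E phi1.
have prime_phi p : rprime p -> rprime (phi p).
  move=> [p0 np Hp]; split; first by rewrite -phi0 (inj_eq inj).
    move=> [v E]; apply: np; exists (psi v); apply: inj; by rewrite phiM K2 E phi1.
  move=> x y [z E].
  have /Hp : rdiv p (psi x * psi y) by exists (psi z); apply: inj; rewrite !phiM !K2.
  by case=> -[w E']; [left|right]; exists (phi w); rewrite -phiM -E' K2.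
have pa0 : psi a != 0 by apply: contraNneq a0 => E; rewrite -(K2 a) E phi0.
have [u [s [uu sp E]]] := fac _ pa0.
exists (phi u), [seq phi p | p <- s]; split; first exact: unit_phi.
  by move=> p /mapP [q qs ->]; apply: prime_phi; exact: sp.
rewrite -(K2 a) E phiM big_map; congr (_ * _).
by elim: (s) => [|q t IH]; rewrite ?big_nil ?big_cons ?phiM ?IH.
Qed.

End Factorization.

(** * Factoriality of multivariate polynomials over a field *)

Section MPolyFactorization.
Variable K : fieldType.

Section Iso.
Variable n : nat.

Definition phi (p : {poly {mpoly K[n]}}) : {mpoly K[n.+1]} :=
  (map_poly (@mwiden n K) p).['X_ord_max].

Lemma phiD : {morph phi : x y / x + y}.
Proof. by move=> p q; rewrite /phi raddfD hornerD. Qed.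
Lemma phiM : {morph phi : x y / x * y}.
Proof. by move=> p q; rewrite /phi rmorphM hornerM. Qed.
Lemma phiC c : phi c%:P = mwiden c.
Proof. by rewrite /phi map_polyC hornerC. Qed.
Lemma phiXn m : phi 'X^m = 'X_ord_max ^+ m.
Proof. by rewrite /phi map_polyXn hornerXn. Qed.

Let low (m : 'X_{1..n.+1}) : 'X_{1..n} := [multinom m (widen_ord (leqnSn n) i) | i < n].

Lemma muniX (m : 'X_{1..n.+1}) : muni ('X_[K, m]) = ('X_[low m])%:P * 'X^(m ord_max).
Proof.
rewrite muniE msuppX big_seq1 mcoeffX eqxx scale1r mul_polyC.
by congr (_ *: _); congr ('X_[_]); apply/mnmP => i; rewrite !mnmE.
Qed.

Lemma low_split (m : 'X_{1..n.+1}) : (mnmwiden (low m) + U_(ord_max) *+ m ord_max)%MM = m.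
Proof.
apply/mnmP => i; rewrite mnmDE mulmnE mnm1E.
case: (unliftP ord_max i) => [j ->|->]; last by rewrite mnmwiden_ordmax eqxx mul1n.
have -> : lift ord_max j = widen_ord (leqnSn n) j.
  by apply: val_inj; rewrite /= /bump leqNgt ltn_ord.
have -> : (ord_max == widen_ord (leqnSn n) j) = false.
  by apply/eqP => /(congr1 val) /= E; move: (ltn_ord j); rewrite -E ltnn.
rewrite mul0n addn0.
by rewrite mnmwiden_widen mnmE.
Qed.

Lemma phiK : cancel phi (@muni n K).
Proof.
have wid (c : {mpoly K[n]}) : muni (mwiden c) = c%:P.
  elim/mpolyind: c => [|a m c _ _ IH]; first by rewrite mwiden0 muni0 polyC0.
  rewrite mwidenD muniD IH polyCD; congr (_ + _).
  rewrite mwidenZ mwidenX muniZ muniX mnmwiden_ordmax expr0 mulr1 -mul_mpolyC polyCM mul_polyC.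
  congr (_ *: ('X_[_])%:P); apply/mnmP => i; rewrite mnmE.
  exact: mnmwiden_widen.
move=> p; rewrite /phi; elim/poly_ind: p => [|p c IH]; first by rewrite map_poly0 horner0 muni0.
rewrite rmorphD rmorphM /= map_polyX map_polyC /= hornerMXaddC muniD muniM IH wid.
congr (_ * _ + _); rewrite muniX mnm1E eqxx expr1.
rewrite (_ : low U_(ord_max) = 0%MM) ?mpolyX0 ?mul1r //.
apply/mnmP => i; rewrite !mnmE; apply/eqP; rewrite eqb0; apply/eqP => /(congr1 val) /= E.
by move: (ltn_ord i); rewrite -E ltnn.
Qed.

Lemma muniK : cancel (@muni n K) phi.
Proof.
move=> q; elim/mpolyind: q => [|a m q _ _ IH].
  by rewrite muni0 -polyC0 phiC mwiden0.
rewrite muniD phiD; apply: (congr2 +%R _ IH).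
rewrite muniZ muniX -mul_polyC !phiM !phiC phiXn mwidenC mwidenX mul_mpolyC.
by rewrite mpolyXn -mpolyXD low_split.
Qed.

End Iso.

Lemma factorial_field (F : fieldType) : prime_factorial F.
Proof.
move=> a a0; exists a, [::]; split=> //; last by rewrite big_nil mulr1.
by exists a^-1; rewrite divff.
Qed.

Lemma factorial_mpoly n : prime_factorial {mpoly K[n]}.
Proof.
elim: n => [|n IH].
  apply: (@factorial_iso K {mpoly K[0]} (@mpolyC 0 K) (@mcoeff 0 K 0%MM)).
  - exact: mpolyCK.
  - exact: mpolyKC.
  - exact: mpolyC0.
  - exact: mpolyC1.
  - exact: mpolyCM.
  - exact: factorial_field.
apply: (@factorial_iso {poly {mpoly K[n]}} {mpoly K[n.+1]} (@phi n) (@muni n K)).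
- exact: phiK.
- exact: muniK.
- by rewrite -polyC0 phiC mwiden0.
- by rewrite -polyC1 phiC mwiden1.
- exact: phiM.
- exact: factorial_poly.
Qed.

End MPolyFactorization.

Ltac mlia :=
  repeat match goal with H : context [mmeasure _ _] |- _ => revert H end;
  repeat match goal with |- context [@mmeasure ?n ?R ?mf ?p] => move: (@mmeasure n R mf p) => ? end; lia.

(** * A nonmonomial prime factor of multiplicity not divisible by d *)

Section PrimeSplit.
Variables (K : fieldType) (n : nat).
Implicit Types f h F : {mpoly K[n]}.

Lemma rprime_msize f : rprime f -> (1 < msize f)%N.
Proof.
case=> f0 nu _; rewrite ltnNge; apply/negP => le; apply: nu.
have fE := msize1_polyC le.
have c0 : f@_0%MM != 0 by apply: contraNneq f0 => c0; rewrite fE c0 mpolyC0.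
by exists ((f@_0%MM)^-1)%:MP; rewrite {1}fE -mpolyCM divff.
Qed.

Lemma msize_mulr f h : f != 0 -> (1 < msize f)%N -> h != 0 -> (msize h < msize (f * h))%N.
Proof.
move=> f0 sf h0; rewrite msizeM //.
have : (0 < msize h)%N by rewrite lt0n msize_poly_eq0.
mlia.
Qed.

Lemma power_split f F : rprime f -> F != 0 -> exists e h, F = f ^+ e * h /\ ~ rdiv f h.
Proof.
move=> pf; have sf := rprime_msize pf; have [f0 _ _] := pf.
elim: {F}(msize F) {-2}F (leqnn (msize F)) => [|s IH] F sF F0.
  by move: F0; rewrite -msize_poly_eq0 -leqn0 sF.
case: (excluded_middle_informative (rdiv f F)) => [[h FE]|nd]; last first.
  by exists 0%N, F; rewrite expr0 mul1r.
have h0 : h != 0 by apply: contraNneq F0 => h0; rewrite FE h0 mulr0.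
have [|e [h' [hE nd]]] := IH h _ h0.
  by have := msize_mulr f0 sf h0; rewrite -FE; mlia.
by exists e.+1, h'; rewrite FE hE exprS mulrA.
Qed.

Definition ismono f := exists (c : K) m, f = c *: 'X_[m].

Lemma nonmono_coeffs f : f != 0 -> ~ ismono f -> exists m1 m2, [/\ m1 != m2, f@_m1 != 0 & f@_m2 != 0].
Proof.
move=> f0 nm; have := mpolyE f; have us := msupp_uniq f.
have := mcoeff_msupp f; case: (msupp f) us => [|m1 [|m2 s]] us H E.
- by move: f0; rewrite E big_nil eqxx.
- by case: nm; exists (f@_m1), m1; rewrite {1}E big_seq1.
- exists m1, m2; split; rewrite -?H ?inE ?eqxx ?orbT //.
  by move: us; rewrite /= inE negb_or => /andP[/andP[]].
Qed.

Lemma isunit_mpoly (u : {mpoly K[n]}) : isunit u -> exists2 c, c != 0 & u = c%:MP.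
Proof.
move=> [v E]; have uv0 : u * v != 0 by rewrite E oner_neq0.
have u0 : u != 0 by apply: contraNneq uv0 => ->; rewrite mul0r.
have v0 : v != 0 by apply: contraNneq uv0 => ->; rewrite mulr0.
have := congr1 (fun p : {mpoly K[n]} => msize p) E; rewrite msizeM // msize1 => s1.
apply/msize_poly1P.
have : (0 < msize v)%N by rewrite lt0n msize_poly_eq0.
have : (0 < msize u)%N by rewrite lt0n msize_poly_eq0.
by move=> ? ?; apply/eqP; mlia.
Qed.

(** One prime is split off with its full multiplicity; a monomial prime goes into the monomial
    factor, any other into the d-th power. *)
Lemma mpoly_power_form (d : nat) F : F != 0 ->
  (forall f e h, rprime f -> ~ ismono f -> F = f ^+ e * h -> ~ rdiv f h -> (d %| e)%N) ->
  exists (a : K) (i : 'X_{1..n}) (G : {mpoly K[n]}), a != 0 /\ F = a *: 'X_[i] * G ^+ d.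
Proof.
elim: {F}(msize F) {-2}F (leqnn (msize F)) => [|s IH] F sF F0 H.
  by move: F0; rewrite -msize_poly_eq0 -leqn0 sF.
have [u [t [uu tp FE]]] := factorial_mpoly F0.
case: t tp FE => [|f t] tp FE.
  have [c c0 uE] := isunit_mpoly uu; exists c, 0%MM, 1; split=> //.
  by rewrite FE big_nil uE expr1n mpolyX0 !mulr1 -alg_mpolyC.
have pf : rprime f by apply: tp; rewrite mem_head.
have [f0 nuf primef] := pf.
have dvf : rdiv f F by exists (u * \prod_(q <- t) q); rewrite FE big_cons; ring.
have [e [h [FE' nd]]] := power_split pf F0.
have h0 : h != 0 by apply: contraNneq F0 => h0; rewrite FE' h0 mulr0.
have e0 : (0 < e)%N.
  by case: e FE' => // FE'; case: nd; rewrite expr0 mul1r in FE'; rewrite -FE'.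
have fe0 : f ^+ e != 0 by rewrite expf_neq0.
have sh : (msize h <= s)%N.
  have sfe : (1 < msize (f ^+ e))%N.
    case: (e) e0 => // e' _; rewrite exprS.
    have fe'0 : f ^+ e' != 0 by rewrite expf_neq0.
    have := msize_mulr f0 (rprime_msize pf) fe'0.
    have : (0 < msize (f ^+ e'))%N by rewrite lt0n msize_poly_eq0.
    by mlia.
  by have := msize_mulr fe0 sfe h0; rewrite -FE'; mlia.
have [|a [i [G [a0 hE]]]] := IH h sh h0.
  move=> f' e' h' pf' nm' hE nd'.
  (* A prime f' dividing f is associated to f, so it does not divide h and its multiplicity there is
     0. *)
  case: (excluded_middle_informative (rdiv f' f)) => ff'.
    have e'0 : e' = 0%N.
      case: e' hE => // e' hE; case: nd; rewrite hE exprS -mulrA; apply: rdiv_mulr.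
      exact: (rprime_assoc pf' pf).
    by rewrite e'0 dvdn0.
  apply: (H f' e' (f ^+ e * h')) => //; first by rewrite FE' hE; ring.
  by have [_ _ prime'] := pf'; case/prime' => // /(rprimeX pf').
case: (excluded_middle_informative (ismono f)) => [[c [m fE]]|nm].
  have c0 : c != 0 by apply: contraNneq f0 => c0; rewrite fE c0 scale0r.
  exists (c ^+ e * a), (m *+ e + i)%MM, G; split; first by rewrite mulf_neq0 // expf_neq0.
  rewrite FE' hE fE exprZn mpolyXn mpolyXD -!mul_mpolyC mpolyCM; ring.
have [q eE] := dvdnP (H f e h pf nm FE' nd).
exists a, i, (G * f ^+ q); split=> //.
by rewrite FE' hE eE exprMn exprM; ring.
Qed.

Lemma prime_split (d : nat) F : (2 <= d)%N ->
  (forall (a : K) (i : 'X_{1..n}) (G : {mpoly K[n]}), a != 0 -> F != a *: 'X_[i] * G ^+ d) ->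
  F != 0 /\ exists f e h, [/\ rprime f, ~ ismono f, F = f ^+ e * h, ~ rdiv f h & ~~ (d %| e)%N].
Proof.
move=> d2 H; have F0 : F != 0.
  have := H 1 0%MM 0 (oner_neq0 _); rewrite expr0n; have -> : (d == 0)%N = false by lia.
  by rewrite mulr0.
split=> //; apply: NNPP => no.
have [|a [i [G [a0 E]]]] := @mpoly_power_form d F F0.
  move=> f e h pf nm FE nd; apply/negPn/negP => de; apply: no; by exists f, e, h.
by move/eqP: (H a i G a0); apply.
Qed.

Lemma rprime_scale (c : K) f : c != 0 -> rprime f -> rprime (c *: f).
Proof.
move=> c0 [f0 nu Hp]; have fE : f = c^-1 *: (c *: f) by rewrite scalerA mulVf // scale1r.
have dv h : rdiv f h -> rdiv (c *: f) h.
  by move=> [q ->]; exists (c^-1 *: q); rewrite -scalerAl -scalerAr scalerA divff // scale1r.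
have dv' h : rdiv (c *: f) h -> rdiv f h.
  by move=> [q ->]; exists (c *: q); rewrite -scalerAl scalerAr.
split; first by rewrite mscalerI negb_or c0.
  by move=> [v E]; apply: nu; exists (c *: v); rewrite -scalerAr scalerAl.
by move=> a b /dv' /Hp [/dv|/dv]; [left|right].
Qed.

End PrimeSplit.

(** * Multiplicativity of the Gauss valuation *)

Section GaussValuation.
Variables (k : closedFieldType) (K : fieldType) (iota : {rmorphism k -> K}) (n : nat).
Notation place := (place iota).
Implicit Types (P : place) (A B F : {mpoly K[n]}).

Lemma vpolyP P A : A != 0 -> (forall m, m \in msupp A -> vpoly P A <= P (A@_m)) /\
  exists2 m, m \in msupp A & P (A@_m) = vpoly P A.
Proof.
move=> A0; rewrite /vpoly; have : msupp A != [::] by rewrite msupp_eq0.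
case: (msupp A) => // m s _; split.
  elim: s => [|m' s IH] m0 /=; first by rewrite inE => /eqP ->.
  rewrite !inE => /or3P [/eqP ->|/eqP ->|ms]; rewrite ge_min ?lexx ?orbT //.
    by rewrite IH ?mem_head ?orbT.
  by rewrite IH ?orbT // inE ms orbT.
elim: s => [|m' s [m0 m0s E]] /=; first by exists m; rewrite ?mem_head.
case: (lerP (P (A@_m')) (foldr (fun m' acc => Num.min (P A@_m') acc) (P A@_m) s)) => _.
  by exists m'; rewrite // !inE eqxx orbT.
by exists m0; rewrite // !inE; move: m0s; rewrite inE => /orP [->|->]; rewrite ?orbT.
Qed.

Lemma vge_vpoly P A m : vge P (vpoly P A) (A@_m).
Proof.
case: (eqVneq (A@_m) 0) => [->|Am]; first exact: vge0.
have A0 : A != 0 by apply: contraNneq Am => ->; rewrite mcoeff0.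
by rewrite vgeE //; apply: (proj1 (vpolyP P A0)); rewrite mcoeff_msupp.
Qed.

Lemma vpoly_top P A : A != 0 -> exists m, [/\ A@_m != 0, P (A@_m) = vpoly P A &
  forall m', (m < m')%O -> vge P (vpoly P A + 1) (A@_m')].
Proof.
move=> A0; have [m0 m0A E0] := proj2 (vpolyP P A0).
pose b := msize A; pose good (m : 'X_{1..n < b}) := (A@_m != 0) && (P (A@_m) == vpoly P A).
have g0 : good (BMultinom (msize_mdeg_lt m0A)) by rewrite /good /= -mcoeff_msupp m0A E0 eqxx.
have [m /andP[Am /eqP Em] maxm] := @Order.TotalTheory.arg_maxP _ _ _ _ good (fun m => m : 'X_{1..n}) g0.
exists m; split=> // m' lt.
have := vge_vpoly P A m'; rewrite /vge; case: eqVneq => //= Am' le.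
have m'A : m' \in msupp A by rewrite mcoeff_msupp.
have : P (A@_m') != vpoly P A.
  apply/negP => E'; have := maxm (BMultinom (msize_mdeg_lt m'A)); rewrite /good /= Am' E' => /(_ isT).
  by rewrite leNgt lt.
by move: le; plia.
Qed.

(** Take in each factor the largest monomial whose coefficient has least order. In the coefficient
    of the product at their sum exactly one term has least order. *)
Lemma vpolyM P A B : A != 0 -> B != 0 -> vpoly P (A * B) = vpoly P A + vpoly P B.
Proof.
move=> A0 B0; have AB0 : A * B != 0 by rewrite mulf_neq0.
have [mA [Am vA topA]] := vpoly_top P A0; have [mB [Bm vB topB]] := vpoly_top P B0.
apply/eqP; rewrite eq_le; apply/andP; split; last first.
  have [m mAB <-] := proj2 (vpolyP P AB0).
  rewrite -vgeE -?mcoeff_msupp // mcoeffM.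
  by apply: vge_sum => kk _; apply: vgeM; exact: vge_vpoly.
pose m := (mA + mB)%MM.
suff [c0 vc] : (A * B)@_m != 0 /\ P ((A * B)@_m) = vpoly P A + vpoly P B.
  by rewrite -vc; apply: (proj1 (vpolyP P AB0)); rewrite mcoeff_msupp.
rewrite mcoeffM.
have dA : (mdeg mA < (mdeg m).+1)%N by rewrite ltnS /m mdegD leq_addr.
have dB : (mdeg mB < (mdeg m).+1)%N by rewrite ltnS /m mdegD leq_addl.
rewrite (bigD1 (BMultinom dA, BMultinom dB)) //=.
have ab0 : A@_mA * B@_mB != 0 by rewrite mulf_neq0.
have vab : P (A@_mA * B@_mB) = vpoly P A + vpoly P B by rewrite placeM // vA vB.
rewrite -vab; apply: place_add_lt => //; rewrite vab.
apply: vge_sum => -[k1 k2] /andP[/eqP /= kE ne].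
case: (ltgtP (k1 : 'X_{1..n}) mA) => [lt|gt|E].
- have gt2 : (mB < k2)%O.
    rewrite ltNge; apply/negP => le2; have := ltmc_le_add lt le2.
    by rewrite -kE /m ltxx.
  by rewrite -addrA; apply: vgeM; [exact: vge_vpoly | exact: topB].
- have -> : vpoly P A + vpoly P B + 1 = vpoly P A + 1 + vpoly P B by rewrite addrAC.
  by apply: vgeM; [exact: topA | exact: vge_vpoly].
- case/eqP: ne; congr pair; apply: val_inj => //=.
  by apply: (@addmI _ mA); rewrite -{1}E -kE.
Qed.

End GaussValuation.

(** * Counting estimates for the choice of N and q *)

Section Counting.
Local Open Scope nat_scope.

Lemma leq_exp2r' a b m : a <= b -> a ^ m <= b ^ m.
Proof. by move=> le; elim: m => // m IH; rewrite !expnS leq_mul. Qed.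

(** The number of monomials of degree at most [x] in [n] variables. *)
Definition nmono (n x : nat) := 'C(x + n, n).

Lemma nmonoS n x : nmono n.+1 x.+1 = nmono n.+1 x + nmono n x.+1.
Proof. by rewrite /nmono addSn binS addnS addSn. Qed.

Lemma nmono_gt0 n x : 0 < nmono n x.
Proof. by rewrite bin_gt0 leq_addl. Qed.

Lemma nmono_mono n x y : x <= y -> nmono n x <= nmono n y.
Proof. by move=> le; apply: leq_bin2l; rewrite leq_add2r. Qed.

(** The mixed difference with steps a and b is a sum of a b ordinary second differences. *)
Lemma second_difference (F : nat -> nat) (U x : nat) a b :
  (forall y, y.+2 <= x + a + b -> F y.+2 + F y <= F y.+1 + F y.+1 + U) ->
  F (x + a + b) + F x <= F (x + a) + F (x + b) + a * b * U.
Proof.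
move=> H.
have step y c : (y + c).+1 <= x + a + b -> F (y + c).+1 + F y <= F y.+1 + F (y + c) + c * U.
  elim: c => [|c IH] lt; first by rewrite !addn0; lia.
  have h1 : (y + c).+1 <= x + a + b by lia.
  have h2 : (y + c).+2 <= x + a + b by lia.
  by have := IH h1; have := H _ h2; rewrite !addnS mulSn; lia.
elim: a H step => [|a IH] H step; first by rewrite addn0 mul0n addn0 addnC.
have h1 : forall y, y.+2 <= x + a + b -> F y.+2 + F y <= F y.+1 + F y.+1 + U.
  by move=> y le; apply: H; lia.
have h2 : forall y c, (y + c).+1 <= x + a + b -> F (y + c).+1 + F y <= F y.+1 + F (y + c) + c * U.
  by move=> y c le; apply: step; lia.
have h3 : (x + a + b).+1 <= x + a.+1 + b by lia.
by have := IH h1 h2; have := step (x + a) b h3; rewrite !addnS mulSn mulnDl !addSn; lia.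
Qed.

Lemma nmono_second n x : nmono n.+2 x.+2 + nmono n.+2 x = nmono n.+2 x.+1 + nmono n.+2 x.+1 + nmono n x.+2.
Proof. have := nmonoS n.+1 x.+1; have := nmonoS n.+1 x; have := nmonoS n x.+1; lia. Qed.

Lemma nmono_sq n x : x * x * nmono n x <= n.+2 * n.+2 * nmono n.+2 x.
Proof.
have E m y : m.+1 * nmono m.+1 y = (y + m.+1) * nmono m y.
  by rewrite /nmono -mul_bin_diag addnS.
have := E n.+1 x; have := E n x => E1 E2.
have : x * nmono n x <= n.+1 * nmono n.+1 x by rewrite E1 leq_mul2r; apply/orP; right; lia.
have : x * nmono n.+1 x <= n.+2 * nmono n.+2 x by rewrite E2 leq_mul2r; apply/orP; right; lia.
move: (nmono n x) (nmono n.+1 x) (nmono n.+2 x) => t0 t1 t2; clear; nia.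
Qed.

(** The mixed difference of [nmono n] is at most d1 d2 [nmono (n-2) N] when n is at least 2, of
    order N^(n-2), so it falls below the fraction 1/(A N) of [nmono n N]; for n at most 1 it is not
    positive. *)
Lemma choose_degree n A D1 D2 : exists N, D1 + D2 <= N /\ forall d1 d2, d1 <= D1 -> d2 <= D2 ->
  A * N * (nmono n N + nmono n (N - d1 - d2)) <=
  A * N * (nmono n (N - d1) + nmono n (N - d2)) + nmono n N.
Proof.
pose N := (A * D1 * D2 * n * n + D1 + D2).+1; exists N; split; first by rewrite /N; lia.
move=> d1 d2 le1 le2.
pose x := N - d1 - d2.
have xd1 : N - d2 = x + d1 by rewrite /x /N; lia.
have xd2 : N - d1 = x + d2 by rewrite /x /N; lia.
have xN : N = x + d1 + d2 by rewrite /x /N; lia.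
rewrite -/x xd1 xd2.
case: n @N x xd1 xd2 xN => [|[|n]] N x xd1 xd2 xN.
- by rewrite /nmono !bin0; lia.
- rewrite /nmono !bin1; have -> : N + 1 + (x + 1) = x + d2 + 1 + (x + d1 + 1) by lia.
  exact: leq_addr.
have sec : nmono n.+2 N + nmono n.+2 x <= nmono n.+2 (x + d1) + nmono n.+2 (x + d2) + d1 * d2 * nmono n N.
  rewrite {1}xN; apply: second_difference => y lt; rewrite nmono_second leq_add2l.
  by apply: nmono_mono; rewrite xN.
have sq := nmono_sq n N.
have dd : d1 * d2 <= D1 * D2 by apply: leq_mul.
have NA : A * D1 * D2 * n.+2 * n.+2 <= N by rewrite /N; lia.
move: sec sq; move: (nmono n.+2 N) (nmono n.+2 x) (nmono n.+2 (x + d1)) (nmono n.+2 (x + d2)) (nmono n N) => t0 t1 t2 t3 t4 sec sq.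
have main : A * N * (d1 * d2 * t4) <= t0.
  have N0 : 0 < N by [].
  rewrite -(leq_pmul2l N0).
  apply: leq_trans (_ : A * (D1 * D2) * (N * N * t4) <= _).
    have -> : N * (A * N * (d1 * d2 * t4)) = A * (d1 * d2) * (N * N * t4) by nia.
    by rewrite leq_mul2r leq_mul2l dd !orbT.
  apply: leq_trans (_ : A * (D1 * D2) * (n.+2 * n.+2 * t0) <= _).
    by rewrite leq_mul2l sq orbT.
  have -> : A * (D1 * D2) * (n.+2 * n.+2 * t0) = A * D1 * D2 * n.+2 * n.+2 * t0 by nia.
  by rewrite leq_mul2r NA orbT.
have := leq_mul (leqnn (A * N)) sec; rewrite !mulnDr.
lia.
Qed.

Lemma exp_beats_poly c m : 0 < c -> exists Q, c ^ Q * Q.+1 ^ m < c.+1 ^ Q.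
Proof.
move=> c0.
(* Bernoulli: (1 + 1/c)^c is at least 2, so with Q = c 2^i the ratio of the powers is at least
   2^(2^i). *)
have bern : 2 * c ^ c <= c.+1 ^ c.
  case: (c) c0 => // c' _.
  have H e : c'.+1 ^ e * c'.+1 + e * c'.+1 ^ e <= c'.+2 ^ e * c'.+1.
    elim: e => [|e IH]; first by rewrite !expn0 mul0n addn0.
    rewrite !expnS; move: IH; move: (c'.+1 ^ e) (c'.+2 ^ e); clear; nia.
  have := H c'.+1; rewrite -(leq_pmul2r (ltn0Sn c')); move: (c'.+1 ^ c'.+1) (c'.+2 ^ c'.+1); clear; nia.
have two_pow a : a < 2 ^ a by exact: ltn_expl.
pose i := 4 * (c + m).+2.
have Hi : (c + i) * m < 2 ^ i.
  rewrite /i; set a := (c + m).+2.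
  have : 2 ^ (4 * a) = (2 ^ a * 2 ^ a) * (2 ^ a * 2 ^ a) by rewrite -!expnD; congr (_ ^ _); lia.
  move=> ->; have := two_pow a; move: (2 ^ a) => p pa.
  have : a.+1 * a.+1 * (a.+1 * a.+1) <= p * p * (p * p) by apply: leq_mul; apply: leq_mul.
  have : (c + 4 * a) * m <= 5 * (a * a).
    have -> : 5 * (a * a) = 5 * a * a by rewrite mulnA.
    by apply: leq_mul; rewrite /a; lia.
  have : 2 <= a by [].
  clear; nia.
pose j := 2 ^ i; pose Q := c * j.
have Qj : Q.+1 ^ m < 2 ^ j.
  apply: leq_ltn_trans (_ : 2 ^ ((c + i) * m) < _); last by rewrite ltn_exp2l.
  rewrite expnM; apply: leq_exp2r' => //.
  rewrite expnD /Q -/j; have j0 : 0 < j by rewrite expn_gt0.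
  apply: leq_trans (_ : c.+1 * j <= _); first by rewrite mulSn; lia.
  by rewrite leq_mul2r two_pow orbT.
exists Q; rewrite /Q [c ^ _]expnM [c.+1 ^ _]expnM.
apply: leq_trans (_ : (2 * c ^ c) ^ j <= _); last exact: leq_exp2r'.
rewrite expnMn mulnC ltn_pmul2r // expn_gt0 expn_gt0 c0 //.
Qed.

Lemma slow_growth c m : 0 < c -> exists Q, forall d : nat -> nat,
  (forall q, 0 < d q <= q.+1 ^ m) -> exists2 q, q < Q & c * d q.+1 <= c.+1 * d q.
Proof.
move=> c0; have [Q HQ] := exp_beats_poly m c0; exists Q => d Hd.
apply: NNPP => no.
have gr q : q < Q -> c.+1 * d q < c * d q.+1.
  by move=> lt; rewrite ltnNge; apply/negP => le; apply: no; exists q.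
have pw q : q <= Q -> c.+1 ^ q <= c ^ q * d q.
  elim: q => [|q IH] le; first by rewrite !expn0 mul1n; case/andP: (Hd 0%N).
  rewrite !expnS; have := IH (ltnW le); have := gr q le.
  move: (c.+1 ^ q) (c ^ q) (d q) (d q.+1); clear; nia.
have := pw Q (leqnn Q); have := proj2 (andP (Hd Q)).
move=> h1 h2; have : c ^ Q * d Q <= c ^ Q * Q.+1 ^ m by rewrite leq_mul2l h1 orbT.
lia.
Qed.

(* The threshold [Q] of [slow_growth] is chosen before the sequence [d]. It is later applied to
   dimensions that depend on the coefficients of F, while the constants may not. *)
End Counting.

(** * Bases extracted from finite families *)

Section Basis.
Variables (k K : fieldType) (iota : {rmorphism k -> K}).

(** The basis consists of members of the family, so that their pole bounds carry over to it. *)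
Lemma basis_of_family (I : finType) (F : I -> K) : exists d (w : 'I_d -> K),
  [/\ kfree iota w, forall i, kspan iota w (F i), (d <= #|I|)%N & forall a, exists i, w a = F i].
Proof.
pose Q d := exists h : 'I_d -> I, kfree iota (fun a => F (h a)).
pose Qb d := if excluded_middle_informative (Q d) then true else false.
have QbP d : Qb d <-> Q d by rewrite /Qb; case: excluded_middle_informative.
have ex : exists d, Qb d.
  by exists 0%N; apply/QbP; exists (fun a : 'I_0 => match a with Ordinal _ p => match notF p with end end) => c _ [].
have bound d : Qb d -> (d <= #|I|)%N.
  move=> /QbP [h fr]; rewrite -{1}(card_ord d); apply: (@leq_card _ _ h) => a b E.
  apply/eqP/negPn/negP => ab.
  have ba : (b == a) = false by rewrite eq_sym (negPf ab).
  have := fr (fun j => (j == a)%:R - (j == b)%:R) _ a.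
  rewrite eqxx (negPf ab) subr0 => H; have /eqP : (1 : k) = 0; last by rewrite oner_eq0.
  apply: H; rewrite (bigD1 a) //= (bigD1 b) /=; last by rewrite ba.
  rewrite !eqxx (negPf ab) ba subr0 sub0r rmorph1 mul1r rmorphN rmorph1 mulN1r E addrA subrr add0r.
  rewrite big1 // => j /andP[/negPf -> /negPf ->].
  by rewrite subr0 rmorph0 mul0r.
have [d /QbP [h fr] maxd] := ex_maxnP ex bound.
exists d, (fun a => F (h a)); split=> //; last by move=> a; exists (h a).
  move=> i; pose h' (a : 'I_d.+1) := if unlift ord_max a is Some b then h b else i.
  have hl b : h' (lift ord_max b) = h b by rewrite /h' liftK.
  have hm : h' ord_max = i by rewrite /h' unlift_none.
  have nfr : ~ kfree iota (fun a => F (h' a)).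
    by move=> fr'; have : Qb d.+1 by [apply/QbP; exists h']; move/maxd; rewrite ltnn.
  have [c [[a ca] E]] : exists c : 'I_d.+1 -> k, (exists a, c a != 0) /\ \sum_a iota (c a) * F (h' a) = 0.
    apply: NNPP => no; apply: nfr => c E a; apply/eqP/negPn/negP => ca; apply: no.
    by exists c; split=> //; exists a.
  rewrite (bigD1_ord ord_max) //= hm in E.
  case: (eqVneq (c ord_max) 0) => cm.
    case/eqP: ca; case: (unliftP ord_max a) => [b ->|-> //].
    apply: (fr (fun b => c (lift ord_max b))); rewrite -[RHS]E cm rmorph0 mul0r add0r.
    by apply: eq_bigr => b' _; rewrite hl.
  exists (fun b => - c (lift ord_max b) / c ord_max).
  have icm : iota (c ord_max) != 0 by rewrite fmorph_eq0.
  apply: (mulfI icm); move/eqP: E; rewrite addr_eq0 => /eqP ->.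
  rewrite -sumrN mulr_sumr; apply: eq_bigr => b _.
  by rewrite hl fmorph_div rmorphN; field.
by apply: bound; apply/QbP; exists h.
Qed.

End Basis.

(** * Cardinalities of sets of monomials *)

Section MonomialCount.
Variable n : nat.

Lemma card_bmnm (b : nat) : #|{: 'X_{1..n < b.+1}}| = nmono n b.
Proof.
rewrite /nmono addnC -card_partial_ord_partitions.
pose F (m : 'X_{1..n < b.+1}) : n.-tuple 'I_b.+1 := [tuple inord (m i) | i < n].
have mi (m : 'X_{1..n < b.+1}) i : (m i < b.+1)%N.
  apply: leq_ltn_trans (bmdeg m); rewrite mdegE (bigD1 i) //=; exact: leq_addr.
have Fi (m : 'X_{1..n < b.+1}) i : tnth (F m) i = m i :> nat by rewrite tnth_mktuple inordK.
have injF : injective F.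
  move=> m1 m2 E; apply: val_inj; apply/mnmP => i /=.
  by rewrite -[LHS]Fi -[RHS]Fi E.
rewrite -(card_imset _ injF); apply: eq_card => t; rewrite !inE.
have sumE (t' : n.-tuple 'I_b.+1) : (\sum_(i <- t') i = \sum_(i < n) tnth t' i)%N.
  by rewrite big_tuple.
apply/imsetP/idP => [[m _ ->]|le].
  rewrite sumE -ltnS; apply: leq_trans (bmdeg m); rewrite ltnS mdegE.
  by apply: leq_sum => i _; rewrite Fi.
pose m := [multinom (tnth t i : nat) | i < n].
have dm : (mdeg m < b.+1)%N.
  by rewrite ltnS mdegE; apply: leq_trans le; rewrite sumE; apply: leq_sum => i _; rewrite mnmE.
exists (BMultinom dm) => //; apply: eq_from_tnth => i; apply: val_inj.
exact: (esym (etrans (Fi (BMultinom dm) i) (mnmE _ i))).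
Qed.

Lemma card_not_multiple (l : 'X_{1..n}) (b : nat) : (mdeg l <= b)%N ->
  (#|{: {m : 'X_{1..n < b.+1} | ~~ (l <= m)%MM}}| + nmono n (b - mdeg l))%N = nmono n b.
Proof.
move=> le; rewrite card_sig -card_bmnm -(card_bmnm b).
rewrite -(cardC [pred m : 'X_{1..n < b.+1} | ~~ (l <= m)%MM]); congr (_ + _)%N.
have sh (m : 'X_{1..n < (b - mdeg l).+1}) : (mdeg (l + m)%MM < b.+1)%N.
  by have := bmdeg m; rewrite mdegD; lia.
pose F m := BMultinom (sh m).
have injF : injective F.
  by move=> m1 m2 /(congr1 val) /= /addmI E; apply: val_inj.
rewrite -(card_imset _ injF); apply: eq_card => m; rewrite !inE negbK.
apply/imsetP/idP => [[m' _ ->]|lm]; first by rewrite /= lem_addr.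
have dm : (mdeg (m - l)%MM < (b - mdeg l).+1)%N.
  have := bmdeg m; rewrite -{1}(submK lm) mdegD; lia.
by exists (BMultinom dm) => //; apply: val_inj; rewrite /= addmC submK.
Qed.

End MonomialCount.

(** * Independent elements of bounded degree in the ideal (f, h) *)

Section IdealBasis.
Variables (K : fieldType) (n : nat) (f h : {mpoly K[n]}) (d2 N : nat).
Hypothesis pf : rprime f.
Hypothesis fh : ~ rdiv f h.
Let l := mlead f.
Let d1 := mdeg l.
Hypothesis sh : (msize h <= d2.+1)%N.
Hypothesis dN : (d1 + d2 <= N)%N.

(** Multiples of h by monomials divisible by the leading monomial of f are left out: this keeps the
    family independent and makes its size a combination of values of [nmono]. *)
Definition ideal_index : finType :=
  ('X_{1..n < (N - d1).+1} + {m : 'X_{1..n < (N - d2).+1} | ~~ (l <= m)%MM})%type.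

Definition ideal_elt (j : ideal_index) : {mpoly K[n]} :=
  match j with inl m => f * 'X_[m] | inr m => h * 'X_[val m] end.

Lemma card_ideal_index : (#|ideal_index| + nmono n (N - d1 - d2))%N = (nmono n (N - d1) + nmono n (N - d2))%N.
Proof.
rewrite card_sum card_bmnm -addnA; congr (_ + _)%N.
rewrite -(@card_not_multiple n l (N - d2)) //; last by rewrite -/d1; lia.
by rewrite -/d1 -!subnDA addnC [(d2 + d1)%N]addnC addnC.
Qed.

Lemma ideal_elt_msize j : (msize (ideal_elt j) <= N.+1)%N.
Proof.
have [f0 _ _] := pf.
have X0 (m : 'X_{1..n}) : 'X_[K, m] != 0 by rewrite -msize_poly_eq0 msizeX.
case: j => [m|[m lm]] /=.
  rewrite msizeM // msizeX -(mlead_deg f0) -/l -/d1; have := bmdeg m; lia.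
case: (eqVneq h 0) => [->|h0]; first by rewrite mul0r msize0.
by rewrite msizeM // msizeX; move: sh; have := bmdeg m; move: (msize h) (mdeg _); lia.
Qed.

(** From f A + h B = 0 and f prime to h it follows that f divides B. A nonzero B would have a
    leading monomial divisible by that of f, and no such monomial occurs in B. *)
Lemma ideal_elt_free (c : ideal_index -> K) : \sum_j c j *: ideal_elt j = 0 -> forall j, c j = 0.
Proof.
have [f0 _ primef] := pf.
pose A := \sum_(m : 'X_{1..n < (N - d1).+1}) c (inl m) *: 'X_[m].
pose B := \sum_(m : {m : 'X_{1..n < (N - d2).+1} | ~~ (l <= m)%MM}) c (inr m) *: 'X_[val m].
move=> E; have {}E : f * A + h * B = 0.
  rewrite -[RHS]E /A /B big_sumType /= !mulr_sumr; congr (_ + _); apply: eq_bigr => m _;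
  by rewrite -scalerAr.
have cB m : B@_(val m : 'X_{1..n < _}) = c (inr m).
  rewrite /B raddf_sum (bigD1 m) //= mcoeffZ mcoeffX eqxx mulr1 big1 ?addr0 // => m' ne.
  rewrite mcoeffZ mcoeffX; case: eqP => [E'|_]; rewrite ?mulr0 //.
  by case/eqP: ne; apply: val_inj; apply: val_inj.
have cB0 (m : 'X_{1..n}) : (l <= m)%MM -> B@_m = 0.
  move=> lm; rewrite /B raddf_sum big1 // => -[m' lm'] _ /=.
  rewrite mcoeffZ mcoeffX; case: eqP => [E'|_]; rewrite ?mulr0 //.
  by have nl : ~~ (l <= m')%MM := lm'; rewrite E' lm in nl.
have cA m : A@_(m : 'X_{1..n < _}) = c (inl m).
  rewrite /A raddf_sum (bigD1 m) //= mcoeffZ mcoeffX eqxx mulr1 big1 ?addr0 // => m' ne.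
  rewrite mcoeffZ mcoeffX; case: eqP => [E'|_]; rewrite ?mulr0 //.
  by case/eqP: ne; apply: val_inj.
have B0 : B = 0.
  apply/eqP/negPn/negP => Bn0.
  have : rdiv f (h * B).
    by exists (- A); move/eqP: E; rewrite addrC addr_eq0 mulrN => /eqP.
  case/primef => // -[C BE].
  have C0 : C != 0 by apply: contraNneq Bn0 => C0; rewrite BE C0 mulr0.
  have /eqP : B@_(mlead B) = 0 by apply: cB0; rewrite BE mleadM // lem_addr.
  by rewrite mleadc_eq0 (negPf Bn0).
have A0 : A = 0.
  by move/eqP: E; rewrite B0 mulr0 addr0 mulf_eq0 (negPf f0) => /eqP.
by case=> m; [rewrite -cA A0 mcoeff0 | rewrite -cB B0 mcoeff0].
Qed.

End IdealBasis.

(** * Evaluation at powers of units; zeros of f at such points *)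

Section Evaluation.
Variables (k : closedFieldType) (K : fieldType) (iota : {rmorphism k -> K}).
Notation place := (place iota).
Notation derivation := (derivation iota).
Notation kp := (@kp k K iota).
Variables (g : nat).
Hypothesis ff : is_function_field iota.
Hypothesis hg : is_genus iota g.
Hypothesis char0 : [pchar k] =i pred0.
Variable D : K -> K.
Hypothesis dD : derivation D.
Hypothesis D0 : exists h, D h != 0.
Variable ck : int.
Hypothesis bkp : bdd (kp D) ck.
Variables (n : nat) (u : 'I_n -> K) (S : seq place).
Hypothesis u0 : forall j, u j != 0.
Hypothesis uS : uniq S.
Hypothesis Sunit : forall j P, P \notin S -> P (u j) = 0.
Variable l : nat.
Implicit Types (P Q : place).

Definition U (j : 'I_n) : K := u j ^+ l.
Definition Xm (m : 'X_{1..n}) : K := \prod_(j < n) U j ^+ m j.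
Definition uval (P : place) (m : 'X_{1..n}) : int := \sum_(j < n) (m j)%:Z * P (u j).
(** Bounds the poles of all D X / X for monomials X in the units: at most simple ones at S, beyond
    the poles of D. *)
Definition sigS (P : place) : int := kp D P + (P \in S)%:R.
Let cS : int := ck + (size S)%:Z.

Lemma U0 j : U j != 0. Proof. by rewrite expf_neq0. Qed.

Lemma Xm0 m : Xm m != 0.
Proof. by apply/prodf_neq0 => j _; rewrite expf_neq0 // U0. Qed.

Lemma place_Xm P m : P (Xm m) = l%:Z * uval P m.
Proof.
rewrite place_prod; last by move=> j; rewrite expf_neq0 // U0.
rewrite /uval mulr_sumr; apply: eq_bigr => j _.
by rewrite !placeX ?expf_neq0 //; ring.
Qed.

Lemma place_Xm_unit P m : P \notin S -> P (Xm m) = 0.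
Proof. by move=> PS; rewrite place_Xm /uval big1 ?mulr0 // => j _; rewrite Sunit // mulr0. Qed.

Lemma sigS_bdd : bdd sigS cS.
Proof. by apply: bddD => //; apply: bdd_mem. Qed.

Lemma dlog_Xm P m : vge P (- sigS P) (dlog D Xm m).
Proof.
rewrite /dlog /sigS -(@vge_mulr _ _ _ P _ (Xm m)) ?Xm0 // divfK ?Xm0 //.
case PS: (P \in S); last first.
  have E : P (Xm m) = 0 by rewrite place_Xm_unit // PS.
  rewrite E !addr0; apply: (der_kp ff char0 dD D0).
  by rewrite vgeE ?Xm0 // E.
apply: vgeW (der_any ff char0 dD D0 P (Xm0 m)); have := kap_le D P.
by rewrite /=; move: (kap D P) (kp D P) (P (Xm m)) => a b c; lia.
Qed.

Lemma evalE (p : {mpoly K[n]}) : p.@[U] = \sum_(m <- msupp p) p@_m * Xm m.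
Proof. exact: mevalE. Qed.

Lemma evalE_wide (p : {mpoly K[n]}) b : (msize p <= b)%N ->
  p.@[U] = \sum_(m : 'X_{1..n < b}) p@_m * Xm m.
Proof.
move=> le; rewrite {1}(mpolywE le) raddf_sum; apply: eq_bigr => m _.
by rewrite /= mevalZ mevalX.
Qed.

Lemma size_msupp (p : {mpoly K[n]}) b : (msize p <= b.+1)%N -> (size (msupp p) <= nmono n b)%N.
Proof.
move=> le; rewrite -card_bmnm cardE -(size_map (fun m : 'X_{1..n < b.+1} => m : 'X_{1..n})).
apply: uniq_leq_size; first exact: msupp_uniq.
move=> m mp; have lt : (mdeg m < b.+1)%N by apply: leq_trans le; apply: msize_mdeg_lt.
by apply/mapP; exists (BMultinom lt); rewrite ?mem_enum.
Qed.

Definition mult_indep (M : nat) := forall mm : 'I_n -> int, (exists j, mm j != 0) ->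
  \sum_(j < n) `|mm j| <= 2 * M%:Z -> nonconst iota (\prod_(j < n) u j ^ mm j).

(** The difference of two exponent vectors of degree at most M has absolute sum at most 2M, the
    origin of the bound 2m in the theorem. The corresponding nonconstant product of the u_j has a
    pole, whose order is multiplied by l. *)
Lemma separated_Xm M (e : seq 'X_{1..n}) : mult_indep M -> (forall m, m \in e -> (mdeg m <= M)%N) ->
  separated iota Xm l%:Z e.
Proof.
move=> ind deg i j ie je ij.
pose mm a : int := (j a)%:Z - (i a)%:Z.
have PoszS (F : 'I_n -> nat) : (\sum_a F a)%N%:Z = \sum_a (F a)%:Z.
  by rewrite (big_morph Posz PoszD erefl).
have nz : exists a, mm a != 0.
  apply: NNPP => no; case/eqP: ij; apply/mnmP => a; apply/eqP/negPn/negP => ija.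
  by apply: no; exists a; rewrite /mm subr_eq0 eqz_nat eq_sym.
have small : \sum_(a < n) `|mm a| <= 2 * M%:Z.
  apply: le_trans (_ : (mdeg i)%:Z + (mdeg j)%:Z <= _).
    rewrite !mdegE !PoszS -big_split /=; apply: ler_sum => a _; rewrite /mm.
    by move: (i a) (j a); lia.
  by have := deg i ie; have := deg j je; move: (mdeg i) (mdeg j); lia.
have [P HP] := nonconst_pole ff hg (ind mm nz small).
exists P; rewrite !place_Xm -mulrBr -[leLHS]mulr1; apply: ler_wpM2l => //.
suff -> : uval P i - uval P j = - P (\prod_(a < n) u a ^ mm a) by move: HP; plia.
rewrite place_prod; last by move=> a; rewrite expfz_neq0.
rewrite /uval -sumrB -sumrN; apply: eq_bigr => a _.
by rewrite placeXz // /mm mulrBl opprB.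
Qed.

Let tau : int := 2 * cS + ck.

(** The exponent of 4 is the largest possible number of terms, since [unit_indep] loses a factor 4
    with each term. *)
Lemma eval_inj (N : nat) (p : {mpoly K[n]}) (rho : place -> int) (c : int) :
  mult_indep N -> (msize p <= N.+1)%N -> (forall m P, vge P (- rho P) (p@_m)) -> bdd rho c ->
  4%:Z ^+ nmono n N * (c + tau) < l%:Z -> p.@[U] = 0 -> p = 0.
Proof.
move=> ind sp pp br small E; apply/mpolyP => m; rewrite mcoeff0.
case: (boolP (m \in msupp p)) => [mp|]; last exact: memN_msupp_eq0.
have sz := size_msupp sp.
apply: (@unit_indep _ _ _ g ff hg char0 D dD D0 _ Xm Xm0 l%:Z sigS cS ck sigS_bdd bkp
  (size (msupp p)) (msupp p) (fun m => p@_m) rho c) => //.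
- apply: separated_Xm ind _ => m' m'p; rewrite -ltnS; apply: leq_trans sp; exact: msize_mdeg_lt.
- by move=> i P _; exact: dlog_Xm.
- apply: le_lt_trans small; apply: ler_wpM2r; last by rewrite ler_weXn2l.
  by rewrite !addr_ge0 ?mulr_ge0 ?(bdd_ge0 br) ?(bdd_ge0 sigS_bdd) ?(bdd_ge0 bkp).
Qed.

(* The derivation of K[x] compatible with evaluation at U. *)
Definition Dm (p : {mpoly K[n]}) : {mpoly K[n]} :=
  \sum_(m <- msupp p) (D p@_m + p@_m * dlog D Xm m) *: 'X_[m].

Lemma coef_Dm p m : (Dm p)@_m = D p@_m + p@_m * dlog D Xm m.
Proof.
rewrite /Dm raddf_sum /=; case: (boolP (m \in msupp p)) => mp.
  rewrite (bigD1_seq m) ?msupp_uniq //= mcoeffZ mcoeffX eqxx mulr1 big1 ?addr0 // => m' ne.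
  by rewrite mcoeffZ mcoeffX (negPf ne) mulr0.
rewrite (memN_msupp_eq0 mp) (derD0 dD) mul0r addr0 big_seq big1 // => m' m'p.
by rewrite mcoeffZ mcoeffX; case: eqP => [E|_]; rewrite ?mulr0 //; rewrite -E m'p in mp.
Qed.

Lemma eval_Dm p : (Dm p).@[U] = D p.@[U].
Proof.
rewrite [in RHS]evalE /Dm raddf_sum (derD_sum dD) /=; apply: eq_bigr => m _.
by rewrite mevalZ mevalX (D_term dD Xm0).
Qed.

Lemma msize_Dm p : (msize (Dm p) <= msize p)%N.
Proof.
rewrite /Dm; apply: leq_trans (msize_sum _ _ _) _.
apply/bigmax_leqP_seq => m mp _; apply: leq_trans (msizeZ_le _ _) _.
by rewrite msizeX; exact: msize_mdeg_lt.
Qed.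

Lemma pole_Dm (p : {mpoly K[n]}) (rho : place -> int) P : 0 <= rho P -> (forall m, vge P (- rho P) (p@_m)) ->
  forall m, vge P (- (2 * rho P + kp D P + sigS P)) ((Dm p)@_m).
Proof.
move=> r0 H m; rewrite coef_Dm.
have k0 := kp_ge0 D P; have s0 : 0 <= sigS P by case: sigS_bdd.
apply: vgeD.
  by apply: vgeW (der_pole ff char0 dD D0 r0 (H m)); move: (rho P) (kp D P) (sigS P) s0; lia.
apply: (@vgeW _ _ _ P (- rho P + - sigS P)); last by apply: vgeM => //; exact: dlog_Xm.
by move: (rho P) (kp D P) (sigS P) r0 k0 s0; lia.
Qed.

Lemma vge_eval (p : {mpoly K[n]}) P (a : int) : P \notin S -> (forall m, vge P a (p@_m)) -> vge P a (p.@[U]).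
Proof.
move=> PS H; rewrite evalE; apply: vge_sum => m _; rewrite -[a]addr0; apply: vgeM => //.
by rewrite vgeE ?Xm0 // place_Xm_unit.
Qed.

Lemma pole_mulM (p q : {mpoly K[n]}) P (a b : int) : (forall m, vge P a (p@_m)) -> (forall m, vge P b (q@_m)) ->
  forall m, vge P (a + b) ((p * q)@_m).
Proof. by move=> Hp Hq m; rewrite mcoeffM; apply: vge_sum => kk _; apply: vgeM. Qed.

Section GoodZeros.
Variables (f h1 : {mpoly K[n]}) (y g0 : K) (d e Dg : nat).
Variables (rho : place -> int) (c : int).
Hypothesis pf : rprime f.
Hypothesis nmf : ~ ismono f.
Hypothesis fh1 : ~ rdiv f h1.
Hypothesis sf : (msize f <= Dg.+1)%N.
Hypothesis g00 : g0 != 0.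
Hypothesis de : ~~ (d %| e)%N.
Hypothesis yE : f.@[U] ^+ e * (g0 * h1.@[U]) = y ^+ d.
Hypothesis br : bdd rho c.
Hypothesis rf : forall m P, vge P (- rho P) (f@_m).
Hypothesis rh : forall m P, vge P (- rho P) (h1@_m).
Hypothesis bpg : bdd (@pol k K iota g0) c.
Hypothesis bzg : bdd (@zer k K iota g0) c.
Hypothesis ind : mult_indep Dg.
Hypothesis z0 : f.@[U] != 0.
Hypothesis h10 : h1.@[U] != 0.

Definition fval := f.@[U].
Definition twist := h1 * Dm f.

(* At such a place the equation z^e (g0 h1(U)) = y^d with d not dividing e forces z to vanish doubly,
   or h1(U) to vanish; in both cases twist(U) vanishes. *)
Definition goodzero P : bool :=
  [&& P \notin S, kap D P <= 0, rho P == 0, P g0 == 0 & 0 < P fval].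

Lemma goodzero_twist P : goodzero P -> vge P 1 (twist.@[U]).
Proof.
case/and5P => PS kap0 /eqP r0 /eqP vg zpos.
have zint : vge P 0 fval by rewrite vgeE // ltW.
have Hh : vge P 0 (h1.@[U]) by apply: vge_eval => // m; have := rh m P; rewrite r0 oppr0.
have HD : vge P 0 (D fval).
  by apply: vgeW (der_reg ff char0 dD D0 zint); rewrite oppr_ge0.
have E : twist.@[U] = h1.@[U] * D fval by rewrite /twist mevalM eval_Dm.
rewrite E.
case: (lerP 2 (P fval)) => z2.
  rewrite -[1]add0r; apply: vgeM => //.
  apply: vgeW (der_any ff char0 dD D0 P z0); rewrite -/fval.
  by move: z2 kap0; move: (P fval) (kap D P); lia.
have z1 : P fval = 1 by move: zpos z2; plia.
rewrite -[1]addr0; apply: vgeM => //.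
have lhs0 : f.@[U] ^+ e * (g0 * h1.@[U]) != 0 by rewrite !mulf_neq0 ?expf_neq0.
have Ey : e%:Z + P h1.@[U] = d%:Z * P y.
  have y0 : (d == 0)%N || (y != 0).
    by rewrite -implyNb; apply/implyP => dn; apply: contraNneq lhs0 => yy; rewrite yE yy expr0n (negPf dn).
  have : P (f.@[U] ^+ e * (g0 * h1.@[U])) = P (y ^+ d) by rewrite yE.
  rewrite placeM ?mulf_neq0 ?expf_neq0 // placeM // vg (placeX P e z0) -/fval z1 mulr1 add0r => ->.
  by case/orP: y0 => [/eqP ->|y0]; rewrite ?mul0r ?expr0 ?place1 ?placeX.
move: Hh; rewrite !vgeE // => h0.
case: (eqVneq (P h1.@[U]) 0) => [E0|]; last by move: h0; plia.
case/negP: de; move: Ey; rewrite E0 addr0 => Ey.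
by apply/dvdnP; exists (absz (P y)); move: Ey; plia.
Qed.

(** f is not a monomial, so two of its terms would share the eigenvalue. *)
Lemma Dm_not_eigen (lam : K) : 2 * c < l%:Z -> Dm f - lam *: f = 0 -> False.
Proof.
move=> cl /eqP; rewrite subr_eq0 => /eqP E; have [f0 _ _] := pf.
have [m1 [m2 [m12 f1 f2]]] := nonmono_coeffs f0 nmf.
have Em m : D f@_m + f@_m * dlog D Xm m = lam * f@_m by rewrite -coef_Dm E mcoeffZ.
apply: (@no_eigen _ _ _ g ff hg char0 D dD D0 _ Xm Xm0 l%:Z (msupp f) (fun m => f@_m) rho c lam m1 m2) => //.
- apply: (separated_Xm ind) => m /msize_mdeg_lt lt.
  by rewrite -ltnS (leq_trans lt).
- by rewrite mcoeff_msupp.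
- by rewrite mcoeff_msupp.
Qed.

(** f is prime and does not divide h1, so it would divide [Dm f]; as [Dm] does not raise degrees,
    the quotient would be a scalar, that is, an eigenvalue. *)
Lemma twist_not_div : 2 * c < l%:Z -> ~ rdiv f twist.
Proof.
move=> cl dv; have [f0 _ Hp] := pf; case: (Hp _ _ dv) => // -[q E].
have sq : (msize q <= 1)%N.
  case: (eqVneq q 0) => [->|q0]; first by rewrite msize0.
  have := msize_Dm f; rewrite E msizeM //; have := rprime_msize pf.
  by have : (0 < msize q)%N by [rewrite lt0n msize_poly_eq0]; mlia.
apply: (@Dm_not_eigen q@_0 cl).
by rewrite E (msize1_polyC sq) mcoeffC eqxx mulr1 mulrC mul_mpolyC subrr.
Qed.

(** The logarithmic derivative has at most a simple pole beyond those of D. At a zero outside S that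
    is not good, D has a pole, [rho] is positive or g0 has a zero or a pole, and one of these terms
    pays for the extra unit; hence the coefficient 2 of [kp]. *)
Lemma dlog_fval_pole (G : seq place) P : (forall Q, goodzero Q -> Q \in G) ->
  vge P (- (2 * kp D P + (P \in S)%:R + (P \in G)%:R + rho P + pol g0 P + zer g0 P)) (D fval / fval).
Proof.
move=> HG; have r0 : 0 <= rho P by case: br.
have k0 := kp_ge0 D P; have kl := kap_le D P.
have s0 (A : seq place) : 0 <= (P \in A)%:R :> int by case: (P \in A).
have p0 : 0 <= pol g0 P by case: bpg.
have q0 : 0 <= zer g0 P by case: bzg.
have crude : vge P (- (1 + kp D P)) (D fval / fval).
  rewrite -(@vge_mulr _ _ _ P _ fval) // divfK //.
  by apply: vgeW (der_any ff char0 dD D0 P z0); rewrite -/fval; move: kl; plia.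
have SS := s0 S; have SG := s0 G.
case: (boolP (P \in S)) SS SG => PS SS SG.
  by apply: vgeW crude; move: SG k0 r0 p0 q0; rewrite /=; move: ((P \in G)%:R : int) (pol g0 P) (zer g0 P); plia.
case: (eqVneq (P fval) 0) => [zP|zP].
  apply: (@vgeW _ _ _ P (- kp D P)).
    by move: SG k0 r0 p0 q0; rewrite /=; move: ((P \in G)%:R : int) (pol g0 P) (zer g0 P); plia.
  rewrite -(@vge_mulr _ _ _ P _ fval) // divfK // zP addr0.
  by apply: der_kp => //; rewrite vgeE // zP.
case: (ltrP 0 (P fval)) => zP'; last first.
  have : vge P (- rho P) fval by apply: vge_eval => // m; apply: rf.
  rewrite vgeE // => zP2; apply: vgeW crude.
  by move: zP zP' zP2 SG k0 r0 p0 q0; rewrite /=; move: ((P \in G)%:R : int) (pol g0 P) (zer g0 P); plia.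
apply: vgeW crude; move: SG.
case: (boolP (P \in G)) => PG /= SG; first by move: k0 r0 p0 q0; move: (pol g0 P) (zer g0 P); plia.
have : ~~ goodzero P by apply: contra PG; exact: HG.
rewrite /goodzero PS zP' andbT /= !negb_and -ltNge.
move: k0 r0 p0 q0 kl; rewrite /pol /zer; plia.
Qed.

Let R1 : int := 6 * c + 7 * ck + 4 * (size S)%:Z.

(* With few good zeros, lam = D z / z would have few poles, and then Dm f = lam f, which is impossible. *)
Lemma many_good_zeros : exists G : seq place, [/\ uniq G, forall P, P \in G -> goodzero P &
  l%:Z <= 4%:Z ^+ nmono n Dg * ((size G)%:Z + R1)].
Proof.
have [t [ut _ ct]] := cover_list ff hg [::] z0.
pose G := filter goodzero t; have uG : uniq G by rewrite filter_uniq.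
exists G; split=> //; first by move=> P; rewrite mem_filter => /andP[].
rewrite leNgt; apply/negP => small.
have HG Q : goodzero Q -> Q \in G.
  move=> gQ; rewrite mem_filter gQ /=; case/and5P: gQ => _ _ _ _; apply: contraLR => Qt.
  by rewrite -/fval (proj2 ct Q Qt) ltxx.
pose lam := D fval / fval; pose q := Dm f - lam *: f.
pose rl P := 2 * kp D P + (P \in S)%:R + (P \in G)%:R + rho P + pol g0 P + zer g0 P.
have brl : bdd rl (2 * ck + (size S)%:Z + (size G)%:Z + c + c + c).
  by do 3! (apply: bddD => //); do 2! (apply: bddD; last exact: bdd_mem); apply: (bddZ 2).
pose rq P := 2 * rho P + kp D P + sigS P + (rl P + rho P).
have brq : bdd rq (2 * c + ck + cS + (2 * ck + (size S)%:Z + (size G)%:Z + c + c + c + c)).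
  apply: bddD; last exact: bddD.
  by apply: bddD; last exact: sigS_bdd; apply: bddD => //; apply: (bddZ 2).
have q0 : q = 0.
  apply: (eval_inj ind _ _ brq).
  - apply: leq_trans (msizeD_le _ _) _; rewrite msizeN geq_max (leq_trans (msize_Dm _)) //=.
    exact: leq_trans (msizeZ_le _ _) _.
  - move=> m P; have r0 : 0 <= rho P by case: br.
    have rl0 : 0 <= rl P by case: brl.
    have k0 := kp_ge0 D P; have s0 : 0 <= sigS P by case: sigS_bdd.
    rewrite mcoeffB mcoeffZ; apply: vgeB.
      by apply: vgeW (pole_Dm r0 (rf^~ P) m); rewrite /rq; move: rl0 r0 k0 s0; move: (rho P) (kp D P) (sigS P) (rl P); lia.
    apply: (@vgeW _ _ _ P (- rl P + - rho P)); last by apply: vgeM => //; apply: dlog_fval_pole.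
    by rewrite /rq; move: rl0 r0 k0 s0; move: (rho P) (kp D P) (sigS P) (rl P); lia.
  - apply: le_lt_trans small; apply: ler_wpM2l; first by rewrite exprn_ge0.
    by rewrite /tau /cS /R1; move: (size S) (size G); lia.
  - by rewrite mevalB mevalZ eval_Dm /lam -/fval divfK // subrr.
apply: Dm_not_eigen q0; apply: le_lt_trans small.
have E1 : 1 <= 4%:Z ^+ nmono n Dg :> int by rewrite exprn_ege1.
have := bdd_ge0 br; have := bdd_ge0 bkp; rewrite /R1.
by move: (4%:Z ^+ nmono n Dg) E1 (size S) (size G) => E E1 a b; nia.
Qed.

End GoodZeros.
End Evaluation.

Lemma sum_injective_ge (I : finType) (T : nat) (h : 'I_T -> I) (F : I -> int) (b : int) :
  injective h -> (forall i, F i <= b) -> \sum_i F i - (#|I| - T)%N%:Z * b <= \sum_s F (h s).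
Proof.
move=> injh Fb; pose A := [set h s | s in 'I_T].
have cA : #|~: A| = (#|I| - T)%N by rewrite cardsCs setCK card_imset // card_ord.
have E : \sum_(i in A) F i = \sum_s F (h s).
  by rewrite big_imset //= => a b0 _ _; exact: injh.
rewrite (bigID (mem A)) /= E.
rewrite lerBlDr lerD2l -cA -sum1_card (big_morph Posz PoszD erefl) mulr_suml.
rewrite (eq_bigl (fun i => i \in ~: A)); last by move=> i; rewrite inE.
by apply: ler_sum => i _; rewrite mul1r.
Qed.

(** * Upper bound for the number of common zeros *)

Section UpperBound.
Variables (k : closedFieldType) (K : fieldType) (iota : {rmorphism k -> K}).
Notation place := (place iota).
Notation derivation := (derivation iota).
Notation kp := (@kp k K iota).
Variables (g : nat).
Hypothesis ff : is_function_field iota.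
Hypothesis hg : is_genus iota g.
Hypothesis char0 : [pchar k] =i pred0.
Variable D : K -> K.
Hypothesis dD : derivation D.
Hypothesis D0 : exists h, D h != 0.
Variable ck : int.
Hypothesis bkp : bdd (kp D) ck.
Variables (n : nat) (u : 'I_n -> K) (S : seq place).
Hypothesis u0 : forall j, u j != 0.
Hypothesis uS : uniq S.
Hypothesis Sunit : forall j P, P \notin S -> P (u j) = 0.
Variable cM : int.
Hypothesis bM : bdd (fun P : place => \sum_(j < n) `|P (u j)|) cM.
Variable l : nat.
Implicit Types (P Q : place).
Notation X := (Xm u l).
Notation U := (U u l).

Variables (f h : {mpoly K[n]}) (Dg N : nat) (rho : place -> int) (c : int).
Hypothesis pf : rprime f.
Hypothesis fh : ~ rdiv f h.
Hypothesis sf : (msize f <= Dg.+1)%N.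
Hypothesis sh : (msize h <= Dg.+1)%N.
Hypothesis br : bdd rho c.
Hypothesis rf : forall m P, vge P (- rho P) (f@_m).
Hypothesis rh : forall m P, vge P (- rho P) (h@_m).
Hypothesis ind : mult_indep iota u N.
Hypothesis dN : (mdeg (mlead f) + Dg <= N)%N.

Notation index := ('X_{1..n < Dg.+1} + 'X_{1..n < Dg.+1})%type.

Definition coefs (j : index) : K := match j with inl m => f@_m | inr m => h@_m end.

Lemma card_index : #|{: index}| = (2 * nmono n Dg)%N.
Proof. by rewrite card_sum card_bmnm mul2n addnn. Qed.

(** The exponents are bounded one by one, not in total: there are (q+1)^#index such products,
    polynomially many in q as [slow_growth] requires, and multiplying by a coefficient raises q by
    1. *)
Definition coefmon (q : nat) (b : {ffun index -> 'I_q.+1}) : K := \prod_j coefs j ^+ b j.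

Lemma vge_coefs P j : vge P (- rho P) (coefs j). Proof. by case: j => m; [apply: rf | apply: rh]. Qed.

Lemma vge_coefmon P q b : vge P (- ((#|{: index}| * q)%N%:Z * rho P)) (@coefmon q b).
Proof.
have r0 : 0 <= rho P by case: br.
apply: (@vgeW _ _ _ P (\sum_j - (q%:Z * rho P))).
  by rewrite sumr_const -mulr_natl natz PoszM mulrN -mulrA; exact: lexx.
apply: vge_prod => j; apply: vgeW (vgeX (b j) (vge_coefs P j)).
by have := ltn_ord (b j); rewrite ltnS mulrN lerN2; move: (nat_of_ord (b j)) (rho P) r0; nia.
Qed.

Lemma coefmon_mul q b j : exists b', @coefmon q b * coefs j = @coefmon q.+1 b'.
Proof.
exists [ffun i => inord (b i + (i == j))]; rewrite /coefmon (bigD1 j) //= [RHS](bigD1 j) //=.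
have E i : [ffun i => inord (b i + (i == j)) : 'I_q.+2] i = (b i + (i == j))%N :> nat.
  by rewrite ffunE inordK //; have := ltn_ord (b i); case: (i == j) => /=; lia.
rewrite E eqxx exprD expr1 mulrAC; congr (_ * _); apply: eq_bigr => i ij.
by rewrite E (negPf ij) addn0.
Qed.

Lemma eval_shift (p : {mpoly K[n]}) m0 : (msize p <= Dg.+1)%N ->
  (p * 'X_[m0]).@[U] = \sum_(m : 'X_{1..n < Dg.+1}) p@_m * X (m + m0)%MM.
Proof.
move=> sp; rewrite mevalM (evalE_wide _ _ sp) mevalX mulr_suml; apply: eq_bigr => m _.
rewrite -mulrA; congr (_ * _); rewrite /Xm -big_split /=; apply: eq_bigr => j _.
by rewrite mnmDE exprD.
Qed.

Notation elt := (@ideal_elt K n f h Dg N).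

Lemma elt_pole P i m : vge P (- rho P) ((elt i)@_m).
Proof.
have HX (m0 m' : 'X_{1..n}) : vge P 0 ('X_[K, m0]@_m') by rewrite mcoeffX; apply: vge_nat.
by rewrite -[- rho P]addr0; case: i => m0 /=; apply: pole_mulM => //.
Qed.

Section Wronskian.
Variables (q d d' : nat) (w : 'I_d -> K) (w' : 'I_d' -> K).
Hypothesis wfree : kfree iota w.
Hypothesis wE : forall a, exists b, w a = @coefmon q b.
Hypothesis wE' : forall a, exists b, w' a = @coefmon q.+1 b.
Hypothesis wspan : forall b, kspan iota w' (@coefmon q.+1 b).

Notation slot := ('I_d' * 'X_{1..n < N.+1})%type.
Notation fidx := ('I_d * ideal_index f Dg N)%type.
Let Y (s : slot) : K := w' s.1 * X s.2.
Let W (i : fidx) : K := w i.1 * (elt i.2).@[U].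

(** Expanding [elt] into monomials multiplies [w] by coefficients of f or h, which leads from level
    q to level q + 1, spanned by [w']. *)
Lemma slot_span i : kspan iota Y (W i).
Proof.
have [f0 _ _] := pf.
have one (a : 'I_d) j (m : 'X_{1..n}) : (mdeg m < N.+1)%N -> kspan iota Y (w a * (coefs j * X m)).
  move=> dm; have [b ->] := wE a; have [b' E] := coefmon_mul b j; rewrite mulrA E.
  have [cc ->] := wspan b'; rewrite mulr_suml; apply: kspan_sum => e; rewrite -mulrA; apply: kspanZ.
  exact: (@kspan_id _ _ iota _ Y (e, BMultinom dm)).
have zero : kspan iota Y 0 by exists (fun=> 0); rewrite big1 // => s _; rewrite rmorph0 mul0r.
case: i => a [m0|[m0 lm]]; rewrite /W /= eval_shift // mulr_sumr; apply: kspan_sum => m.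
  case: (boolP (bmnm m \in msupp f)) => mf; last by rewrite (memN_msupp_eq0 mf) mul0r mulr0.
  apply: (one a (inl m)); rewrite mdegD; have := msize_mdeg_lt mf; rewrite -(mlead_deg f0).
  have := bmdeg m0; move: dN; move: (mdeg (mlead f)) (mdeg m) (mdeg m0); lia.
apply: (one a (inr m)); rewrite mdegD; have := bmdeg m; have := bmdeg m0.
move: dN; move: (mdeg (mlead f)) (mdeg m) (mdeg m0); lia.
Qed.

Let B := (#|{: index}| * q.+1).+1%N.

Lemma W_pole P i : P \notin S -> vge P (- (B%:Z * rho P)) (W i).
Proof.
move=> PS; have r0 : 0 <= rho P by case: br.
have [b E] := wE i.1.
apply: (@vgeW _ _ _ P (- ((#|{: index}| * q)%N%:Z * rho P) + - rho P)).
  by rewrite /B; move: (#|_|) (rho P) r0; nia.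
apply: vgeM; first by rewrite E; apply: vge_coefmon.
by apply: (vge_eval u0 Sunit) => // m; apply: elt_pole.
Qed.

Hypothesis small : 4%:Z ^+ nmono n N * (B%:Z * c + (2 * (ck + (size S)%:Z) + ck)) < l%:Z.

(** A relation over k is a polynomial of small height vanishing at the point, hence 0 by [eval_inj].
    Independence of the ideal elements over K and of [w] over k then kills its coefficients. *)
Lemma W_free : kfree iota W.
Proof.
move=> cc E.
pose p := \sum_(j : ideal_index f Dg N) (\sum_a iota (cc (a, j)) * w a) *: elt j.
have p0 : p = 0.
  apply: (eval_inj ff hg char0 dD D0 bkp u0 uS Sunit (rho := fun P => B%:Z * rho P) ind _ _ _ small).
  - apply: leq_trans (msize_sum _ _ _) _; apply/bigmax_leqP_seq => j _ _.
    by apply: leq_trans (msizeZ_le _ _) _; apply: ideal_elt_msize.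
  - move=> m P; have r0 : 0 <= rho P by case: br.
    rewrite /p raddf_sum; apply: vge_sum => j _ /=; rewrite mcoeffZ.
    apply: (@vgeW _ _ _ P (- ((#|{: index}| * q)%N%:Z * rho P) + - rho P)).
      by rewrite /B; move: (#|_|) (rho P) r0; nia.
    apply: vgeM; last exact: elt_pole.
    by apply: vge_sum => a _; apply: vgeZ; have [b ->] := wE a; apply: vge_coefmon.
  - exact: bddZ.
  rewrite -[RHS]E /p raddf_sum.
  rewrite (eq_bigr (fun i => iota (cc (i.1, i.2)) * W (i.1, i.2))); last by case.
  rewrite -(pair_bigA _ (fun a j => iota (cc (a, j)) * W (a, j))) exchange_big /=.
  apply: eq_bigr => j _; rewrite mevalZ mulr_suml; apply: eq_bigr => a _.
  by rewrite /W /= mulrA.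
case=> a j; have := ideal_elt_free pf fh p0 j; move/wfree; exact.
Qed.

Let T := #|{: fidx}|.
Let T' := #|{: slot}|.
Let mass P : int := \sum_(j < n) `|P (u j)|.
Let E P : int := \sum_(s : slot) P (X s.2).
Let fW (s : 'I_T) : K := W (enum_val s).

Lemma place_X_le P m : (mdeg m <= N)%N -> P (X m) <= (l * N)%N%:Z * mass P.
Proof.
move=> dm; rewrite (place_Xm u0) PoszM -mulrA; apply: ler_wpM2l => //.
rewrite /uval /mass mulr_sumr; apply: ler_sum => j _.
have : (m j <= N)%N by apply: leq_trans dm; rewrite mdegE (bigD1 j) //=; exact: leq_addr.
by move: (m j) (P (u j)) => a b; nia.
Qed.

(* The rows of the Wronskian expand over the slots Y; by the product formula the monomials of all
   T' slots have total valuation zero, so only the T' - T unused slots contribute. *)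
Lemma sum_slot_ge P (h0 : 'I_T -> slot) : injective h0 ->
  E P - (T' - T)%N%:Z * ((l * N)%N%:Z * mass P) <= \sum_s P (X (h0 s).2).
Proof.
move=> inj; apply: (sum_injective_ge (F := fun s : slot => P (X s.2)) inj) => -[b m] /=.
by apply: place_X_le; rewrite -ltnS bmdeg.
Qed.

Lemma det_vge_S P : P \in S ->
  vge P (E P - (T' - T)%N%:Z * ((l * N)%N%:Z * mass P) - T%:Z * (T%:Z * (B%:Z * rho P + 1 + kp D P)))
    (\det (wronskian D fW)).
Proof.
move=> PS; have r0 : 0 <= rho P by case: br.
have k0 := kp_ge0 D P.
pose A := (#|{: index}| * q.+1)%N.
pose y (s : slot) := P (X s.2) - A%:Z * rho P.
pose b := E P - (T' - T)%N%:Z * ((l * N)%N%:Z * mass P) - T%:Z * (A%:Z * rho P).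
apply: (@vgeW _ _ _ P (b - T%:Z * (T%:Z * (1 + kp D P)))).
  rewrite /b -[leRHS]addrA lerD2l -opprD lerN2 -!mulrDr /B -/A -addn1 PoszD.
  have a0 : 0 <= A%:Z * rho P by rewrite mulr_ge0.
  have -> : (A%:Z + 1%N) * rho P + 1 + kp D P = A%:Z * rho P + rho P + (1 + kp D P) by ring.
  move: (A%:Z * rho P) (T) (rho P) (kp D P) a0 r0 k0 => a t r kk a0 r0 k0.
  case: t => [|t]; first by rewrite !mul0r.
  by apply: ler_wpM2l => //; nia.
apply: (wronskian_vge_span ff char0 dD D0 (Y := Y) (y := y)) => [s|[a m]|h0 inj].
- exact: slot_span.
- rewrite /Y /y /= addrC; apply: vgeM; last exact: vge_self.
  by have [b' ->] := wE' a; apply: vge_coefmon.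
- rewrite /y sumrB sumr_const card_ord /b -mulr_natl natz lerD2r; exact: sum_slot_ge.
Qed.

Variable G : seq place.
Hypothesis uG : uniq G.
Hypothesis GS : forall P, P \in G -> P \notin S.
Hypothesis Gk : forall P, P \in G -> kap D P <= 0.
Hypothesis Gr : forall P, P \in G -> rho P = 0.
Hypothesis Gf : forall P, P \in G -> vge P 1 (f.@[U]).
Hypothesis Gh : forall P, P \in G -> vge P 1 (h.@[U]).

Lemma det_vge_G P : P \in G -> vge P T%:Z (\det (wronskian D fW)).
Proof.
move=> PG; apply: (wronskian_vge_zero ff char0 dD D0 (Gk PG)) => s.
rewrite /fW; case: (enum_val s) => a i; rewrite /W /= -[1]add0r; apply: vgeM.
  by have [b ->] := wE a; have := vge_coefmon P b; rewrite Gr // mulr0 oppr0.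
have HX m : vge P 0 (X m) by rewrite vgeE ?Xm0 // (place_Xm_unit u0 Sunit) ?GS.
case: i => m /=; rewrite mevalM mevalX -[1]addr0; apply: vgeM; [exact: Gf | exact: (HX m) | exact: Gh | exact: (HX (val m))].
Qed.

(** One formula for every place, so that it can be summed: the gain at the common zeros, the terms
    proportional to l at S, and an error independent of l. *)
Let bound P : int := T%:Z * (P \in G)%:R + (P \in S)%:R * (E P - (T' - T)%N%:Z * ((l * N)%N%:Z * mass P))
  - T%:Z * (T%:Z * (B%:Z * rho P + 2 * kp D P + (P \in S)%:R)).

Lemma det_vge P : vge P (bound P) (\det (wronskian D fW)).
Proof.
have r0 : 0 <= rho P by case: br.
have k0 := kp_ge0 D P; rewrite /bound.
have T0 (x : int) : 0 <= x -> 0 <= T%:Z * (T%:Z * x) by move=> x0; rewrite !mulr_ge0.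
case: (boolP (P \in G)) => PG.
  rewrite (negPf (GS PG)) /= mulr1 mul0r !addr0; apply: vgeW (det_vge_G PG).
  by rewrite lerBlDr lerDl T0 // addr_ge0 // !mulr_ge0.
case: (boolP (P \in S)) => PS /=.
  apply: vgeW (det_vge_S PS); rewrite mulr0 add0r mul1r lerD2l lerN2.
  by do 2! (apply: ler_wpM2l => //); move: k0; lia.
rewrite mulr0 mul0r !add0r addr0; apply: (wronskian_vge_pole ff char0 dD D0).
  exact: mulr_ge0.
by move=> s; apply: W_pole.
Qed.

Lemma upper_bound : T%:Z * (size G)%:Z <=
  (T' - T)%N%:Z * ((l * N)%N%:Z * cM) + T%:Z * (T%:Z * (B%:Z * c + 2 * ck + (size S)%:Z)).
Proof.
have W0 : \det (wronskian D fW) != 0 by apply: (wronskian_neq0 ff char0 dD D0); apply: kfree_ord_of W_free.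
have [t [ut st ct]] := cover_list ff hg (S ++ G) W0.
have St : {subset S <= t} by move=> P PS; rewrite st // mem_cat PS.
have Gt : {subset G <= t} by move=> P PG; rewrite st // mem_cat PG orbT.
have sb : \sum_(P <- t) bound P <= 0.
  apply: (@le_trans _ _ (\sum_(P <- t) P (\det (wronskian D fW)))); last by rewrite (product_formula hg W0 ct).
  by apply: ler_sum => P _; have := det_vge P; rewrite vgeE.
have sX (m : 'X_{1..n}) : \sum_(P <- t) P (X m) = 0.
  apply: (product_formula hg (Xm0 u0 l m)); split=> // P Pt.
  by apply: (place_Xm_unit u0 Sunit); apply: contra Pt; exact: St.
have sE : \sum_(P <- t) (P \in S)%:R * E P = 0.
  rewrite -[RHS](_ : \sum_(s : slot) \sum_(P <- t) P (X s.2) = 0); last by apply: big1 => s _; exact: sX.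
  rewrite exchange_big /=; apply: eq_bigr => P _.
  case: (boolP (P \in S)) => PS; first by rewrite mul1r.
  by rewrite mul0r big1 // => s _; apply: (place_Xm_unit u0 Sunit).
have sG : (size G)%:Z <= \sum_(P <- t) (P \in G)%:R.
  apply: le_trans (sum_subset (rho := fun P => (P \in G)%:R) _ uG ut Gt); last by move=> P; case: (P \in G).
  rewrite -sum1_size (big_morph Posz PoszD erefl) big_seq [leRHS]big_seq.
  by apply: ler_sum => P ->.
have sM : \sum_(P <- t) (P \in S)%:R * mass P <= cM.
  apply: le_trans (proj2 bM t ut); apply: ler_sum => P _.
  have m0 : 0 <= mass P by rewrite sumr_ge0.
  by case: (P \in S); rewrite ?mul1r ?mul0r.
have bR : bdd (fun P => B%:Z * rho P + 2 * kp D P + (P \in S)%:R) (B%:Z * c + 2 * ck + (size S)%:Z).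
  by apply: bddD; last exact: bdd_mem; apply: bddD; [exact: bddZ | apply: (bddZ 2)].
have expand : \sum_(P <- t) bound P = T%:Z * \sum_(P <- t) (P \in G)%:R +
    (\sum_(P <- t) (P \in S)%:R * E P - (T' - T)%N%:Z * ((l * N)%N%:Z * \sum_(P <- t) (P \in S)%:R * mass P)) -
    T%:Z * (T%:Z * \sum_(P <- t) (B%:Z * rho P + 2 * kp D P + (P \in S)%:R)).
  by rewrite !mulr_sumr -sumrB -big_split -sumrB /=; apply: eq_bigr => P _; rewrite /bound; ring.
rewrite expand sE sub0r in sb.
rewrite -addrA -opprD subr_le0 in sb.
apply: le_trans (ler_wpM2l (isT : 0 <= T%:Z) sG) (le_trans sb _).
by apply: lerD; do 2! (apply: ler_wpM2l => //); exact: (proj2 bR t ut).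
Qed.

End Wronskian.
End UpperBound.

(** * Choice of the constants and comparison of the two counts *)

Lemma slot_growth (A R r d d' : nat) : (0 < A)%N -> (4 * A * R <= 4 * A * r + R)%N ->
  (4 * A * d' <= (4 * A).+1 * d)%N -> (A * (d' * R - d * r) <= d * r)%N.
Proof.
move=> A0 HR Hd.
(* In ratios, d'R / (d r) is at most (1 + 1/4A) / (1 - 1/4A) = 1 + 2/(4A - 1), and 4A - 1 is at
   least 2A. *)
have H1 : ((4 * A - 1) * R <= 4 * A * r)%N by rewrite mulnBl mul1n leq_subLR addnC.
have H2 : ((4 * A - 1) * (d' * R) <= (4 * A).+1 * (d * r))%N.
  rewrite -(@leq_pmul2l (4 * A)) ?muln_gt0 //.
  have := leq_mul Hd H1; move: (4 * A - 1)%N (4 * A)%N => a b H; nia.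
have H3 : ((4 * A - 1) * (d' * R - d * r) <= 2 * (d * r))%N.
  rewrite mulnBr leq_subLR; apply: leq_trans H2 _; rewrite -mulnDl leq_mul2r; apply/orP; right; lia.
rewrite -(@leq_pmul2l 2) // mulnA; apply: leq_trans H3.
by rewrite leq_mul2r; apply/orP; right; lia.
Qed.

(** The upper bound gives G at most l cM / A1 plus an error independent of l. Inserted into the
    lower bound, with A1 = E cM + 1, this leaves exactly one copy of l on the left. *)
Lemma zero_count (T dT A1 N E : nat) (G l cM R1 R2 : int) : (0 < T)%N -> (0 < N)%N -> 0 <= l -> 0 <= cM ->
  (N * A1 * dT <= T)%N -> A1%:Z = E%:Z * cM + 1 ->
  T%:Z * G <= dT%:Z * (l * N%:Z * cM) + T%:Z * (T%:Z * R2) -> l <= E%:Z * (G + R1) ->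
  l <= E%:Z * A1%:Z * (T%:Z * R2 + R1).
Proof.
move=> T0 N0 l0 c0 HT HA HU HL.
have H1 : T%:Z * (N%:Z * (A1%:Z * G)) <= T%:Z * (N%:Z * (l * cM + A1%:Z * (T%:Z * R2))).
  have H2 : (N * A1 * dT)%N%:Z * (l * N%:Z * cM) <= T%:Z * (l * N%:Z * cM).
    by apply: ler_wpM2r => //; rewrite !mulr_ge0.
  have H3 : (N * A1)%N%:Z * (T%:Z * G) <= (N * A1)%N%:Z * (dT%:Z * (l * N%:Z * cM) + T%:Z * (T%:Z * R2)).
    by apply: ler_wpM2l.
  have -> : T%:Z * (N%:Z * (A1%:Z * G)) = (N * A1)%N%:Z * (T%:Z * G) by rewrite PoszM; ring.
  apply: le_trans H3 _; rewrite mulrDr.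
  have -> : (N * A1)%N%:Z * (dT%:Z * (l * N%:Z * cM)) = (N * A1 * dT)%N%:Z * (l * N%:Z * cM).
    by rewrite !PoszM; ring.
  have -> : T%:Z * (N%:Z * (l * cM + A1%:Z * (T%:Z * R2))) = T%:Z * (l * N%:Z * cM) + (N * A1)%N%:Z * (T%:Z * (T%:Z * R2)).
    by rewrite !PoszM; ring.
  by rewrite lerD2r.
have {}H1 : A1%:Z * G <= l * cM + A1%:Z * (T%:Z * R2).
  by move: H1; rewrite ler_pM2l // ler_pM2l.
have H4 : A1%:Z * l <= A1%:Z * (E%:Z * (G + R1)) by apply: ler_wpM2l.
have H5 := ler_wpM2l (isT : 0 <= E%:Z) H1.
have E1 : A1%:Z * l = E%:Z * cM * l + l by rewrite HA; ring.
rewrite -(lerD2l (E%:Z * cM * l)) -E1; apply: le_trans H4 _.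
have -> : A1%:Z * (E%:Z * (G + R1)) = E%:Z * (A1%:Z * G) + E%:Z * A1%:Z * R1 by ring.
have -> : E%:Z * cM * l + E%:Z * A1%:Z * (T%:Z * R2 + R1) = E%:Z * (l * cM + A1%:Z * (T%:Z * R2)) + E%:Z * A1%:Z * R1 by ring.
by rewrite lerD2r.
Qed.

Lemma mult_indepW (k : closedFieldType) (K : fieldType) (iota : {rmorphism k -> K}) n (u : 'I_n -> K) (M M' : nat) :
  (M <= M')%N -> mult_indep iota u M' -> mult_indep iota u M.
Proof. by move=> le ind mm nz H; apply: ind nz _; apply: le_trans H _; lia. Qed.

Lemma choice_fun (A B : Type) (R : A -> B -> Prop) : (forall a, exists b, R a b) ->
  exists f : A -> B, forall a, R a (f a).
Proof.
move=> H; exists (fun a => proj1_sig (constructive_indefinite_description _ (H a))) => a.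
exact: (proj2_sig (constructive_indefinite_description _ (H a))).
Qed.

(** [N] and [Cst] come before the fields, the curve, S and the polynomials. [c] will be the height
    of F, and the bound on the [msize] sum says that deg f + deg h1 is at most [Dg], which also
    bounds the degree of h1 [Dm f]. *)
Definition bounded_exponent (n Dg H0 N Cst : nat) : Prop :=
  forall (k : closedFieldType) (K : fieldType) (iota : {rmorphism k -> K}),
  [pchar k] =i pred0 -> is_function_field iota -> forall g, is_genus iota g ->
  forall D, derivation iota D -> (exists h, D h != 0) -> forall ck, bdd (@kp k K iota D) ck ->
  forall (u : 'I_n -> K) (S : seq (place iota)),
  (forall j, u j != 0) -> uniq S -> (forall j (P : place iota), P \notin S -> P (u j) = 0) ->
  bdd (fun P : place iota => \sum_(j < n) `|P (u j)|) (2 * n * H0)%N%:Z ->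
  forall (l : nat) (f h1 : {mpoly K[n]}) (y g0 : K) (d e : nat) (rho : place iota -> int) (c : int),
  rprime f -> ~ ismono f -> ~ rdiv f h1 -> h1 != 0 -> (msize h1 + msize f <= Dg.+2)%N ->
  g0 != 0 -> ~~ (d %| e)%N -> f.@[U u l] ^+ e * (g0 * h1.@[U u l]) = y ^+ d ->
  bdd rho c -> (forall m P, vge P (- rho P) (f@_m)) -> (forall m P, vge P (- rho P) (h1@_m)) ->
  bdd (@pol k K iota g0) c -> bdd (@zer k K iota g0) c -> mult_indep iota u N ->
  l%:Z <= Cst%:Z * (c + ck + (size S)%:Z).

Lemma bounded_exponent_exists (n Dg H0 : nat) : exists N Cst, bounded_exponent n Dg H0 N Cst.
Proof.
(* Degree 0 is vacuous, since a prime polynomial has positive degree. *)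
case: Dg => [|Dg'].
  exists 0%N, 0%N => k K iota char0 ff g hg D dD D0 ck bkp u S u0 uS Sunit bM l f h1 y g0 d e rho c pf _ _ h10.
  by have := rprime_msize pf; have : (0 < msize h1)%N by [rewrite lt0n msize_poly_eq0]; mlia.
set Dg := Dg'.+1; pose TD := nmono n Dg; pose E := (4 ^ TD)%N; pose A1 := (E * (2 * n * H0) + 1)%N.
have [N [N2 HN]] := choose_degree n (4 * A1) Dg Dg.
have N0 : (0 < N)%N by move: N2; rewrite /Dg; lia.
pose A := (N * A1)%N; have A0 : (0 < A)%N by rewrite muln_gt0 N0 /A1 addn1.
have A4 : (0 < 4 * A)%N by rewrite muln_gt0.
have [Q HQ] := slow_growth (2 * TD) A4.
pose Bm := (2 * TD * Q).+1%N; pose Tm := (Q ^ (2 * TD) * (2 * nmono n N))%N.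
(* The first summand makes [eval_inj] applicable up to degree N, the second exceeds the outcome of
   [zero_count]. [Bm] and [Tm] bound the pole multiplicity and the size of the Wronskian for every q
   < Q. *)
exists N, (4 ^ nmono n N * (3 * Bm + 3) + E * A1 * (Tm * (3 * Bm + 2) + 7))%N.
move=> k K iota char0 ff g hg D dD D0 ck bkp u S u0 uS Sunit bM l f h1 y g0 d e rho c pf nmf fh1 h10 sfh g00 de yE br rf rh bpg bzg ind.
rewrite leNgt; apply/negP => big.
have c0 := bdd_ge0 br; have k0 := bdd_ge0 bkp; pose s := c + ck + (size S)%:Z.
have s0 : 0 <= s by rewrite !addr_ge0.
have EA : (0 < E * A1)%N by rewrite muln_gt0 /E expn_gt0 /A1 addn1.
have part1 : (4 ^ nmono n N)%N%:Z * ((3 * Bm + 3)%N%:Z * s) < l%:Z.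
  apply: le_lt_trans big; rewrite -/s mulrA -PoszM; apply: ler_wpM2r => //.
  by rewrite lez_nat leq_addr.
have part2 : (E * A1)%N%:Z * ((Tm * (3 * Bm + 2) + 7)%N%:Z * s) < l%:Z.
  apply: le_lt_trans big; rewrite -/s mulrA -PoszM; apply: ler_wpM2r => //.
  by rewrite lez_nat leq_addl.
have Es : E%:Z * (7 * s) < l%:Z.
  apply: le_lt_trans part2; apply: ler_pM => //; first by rewrite mulr_ge0.
    by rewrite lez_nat leq_pmulr // /A1 addn1.
  by apply: ler_wpM2r => //; rewrite lez_nat leq_addl.
have E4 : 4%:Z ^+ TD = E%:Z by rewrite /E; elim: (TD) => // j IH; rewrite exprS IH expnS PoszM.
have N4 : 4%:Z ^+ nmono n N = (4 ^ nmono n N)%N%:Z.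
  by elim: (nmono n N) => // j IH; rewrite exprS IH expnS PoszM.
have E1 : 1 <= E%:Z by rewrite lez_nat expn_gt0.
have DgN : (Dg <= N)%N by apply: leq_trans N2; exact: leq_addr.
have ind' := mult_indepW DgN ind.
have [f0 _ _] := pf.
have sf : (msize f <= Dg.+1)%N.
  by move: sfh; have : (0 < msize h1)%N by [rewrite lt0n msize_poly_eq0]; mlia.
have sh1 : (msize h1 <= Dg.+1)%N by move: sfh; have := rprime_msize pf; mlia.
have smE : 4%:Z ^+ nmono n Dg * (c + (2 * (ck + (size S)%:Z) + ck)) < l%:Z.
  apply: le_lt_trans Es; rewrite E4; apply: ler_wpM2l => //; rewrite /s; move: (size S); lia.
have z0 : f.@[U u l] != 0.
  apply: contraNneq f0 => z0; apply/eqP.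
  exact: (eval_inj ff hg char0 dD D0 bkp u0 uS Sunit ind' sf (fun m P => rf m P) br smE z0).
have w0 : h1.@[U u l] != 0.
  apply: contraNneq h10 => z1; apply/eqP.
  exact: (eval_inj ff hg char0 dD D0 bkp u0 uS Sunit ind' sh1 (fun m P => rh m P) br smE z1).
have cl : 2 * c < l%:Z.
  apply: le_lt_trans Es; apply: (@le_trans _ _ (1 * (7 * s))); last by apply: ler_wpM2r => //; rewrite mulr_ge0.
  by rewrite /s; move: c0 k0 (size S); clear; lia.
pose h := twist D u l f h1.
have fh : ~ rdiv f h.
  exact: (twist_not_div ff hg char0 dD D0 ck u0 uS Sunit pf nmf fh1 sf g00 de br rf ind' z0 w0 cl).
have [G [uG GG HG]] := many_good_zeros ff hg char0 dD D0 bkp u0 uS Sunit pf nmf sf g00 de br rf bpg bzg ind' z0 w0.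
have sh : (msize h <= Dg.+1)%N.
  rewrite /h /twist; case: (eqVneq (Dm D u l f) 0) => [->|Dm0]; first by rewrite mulr0 msize0.
  rewrite msizeM //; move: sfh; have := msize_Dm D u l f; mlia.
pose rZ P := rho P + (2 * rho P + kp D P + sigS D S P).
pose cZ := c + (2 * c + ck + (ck + (size S)%:Z)).
have bZ : bdd rZ cZ.
  apply: bddD => //; apply: bddD; last by apply: sigS_bdd.
  by apply: bddD => //; apply: (bddZ 2).
have r0 P : 0 <= rho P by case: br.
have kk0 P : 0 <= kp D P by apply: kp_ge0.
have sg0 P : 0 <= sigS D S P by rewrite addr_ge0 //; case: (P \in S).
have rfZ m P : vge P (- rZ P) (f@_m).
  by apply: vgeW (rf m P); rewrite lerN2 lerDl !addr_ge0 ?mulr_ge0.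
have rhZ m P : vge P (- rZ P) (h@_m).
  rewrite /rZ opprD /h /twist; apply: pole_mulM => // m'.
  exact: (pole_Dm ff char0 dD D0 bkp u0 uS Sunit).
(* [dim q] is the dimension of the span of the coefficient monomials of level q. *)
have [dim dimP] := choice_fun (fun q => basis_of_family iota (@coefmon _ n f h Dg q)).
have dimb q : (0 < dim q <= q.+1 ^ (2 * TD))%N.
  have [w [wf ws wd wE]] := dimP q; apply/andP; split; last first.
    by apply: leq_trans wd _; rewrite card_ffun card_ord card_index leqnn.
  rewrite lt0n; apply/eqP => d0.
  have [cc E0] := ws [ffun=> ord0].
  have /eqP : 1 = 0 :> K; last by rewrite oner_eq0.
  transitivity (@coefmon _ n f h Dg q [ffun=> ord0]).
    by rewrite /coefmon big1 // => j _; rewrite ffunE expr0.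
  by rewrite E0 big1 // => a _; have := ltn_ord a; rewrite [X in (_ < X)%N]d0.
have [q qQ dq] := HQ dim dimb.
have [w [wf ws wd wE]] := dimP q.
have [w' [wf' ws' wd' wE']] := dimP q.+1.
have dN : (mdeg (mlead f) + Dg <= N)%N.
  apply: leq_trans N2; rewrite leq_add2r -ltnS (mlead_deg f0); exact: sf.
have qB : ((#|{: 'X_{1..n < Dg.+1} + 'X_{1..n < Dg.+1}}| * q.+1).+1 <= Bm)%N.
  by rewrite card_index ltnS leq_mul2l qQ orbT.
have cZs : cZ <= 3 * s by rewrite /cZ /s; move: c0 k0 (size S); clear; lia.
have cZ0 := bdd_ge0 bZ.
have smallN : 4%:Z ^+ nmono n N * ((#|{: 'X_{1..n < Dg.+1} + 'X_{1..n < Dg.+1}}| * q.+1).+1%:Z * cZ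
    + (2 * (ck + (size S)%:Z) + ck)) < l%:Z.
  apply: le_lt_trans part1; rewrite N4; apply: ler_wpM2l => //; 
  have -> : (3 * Bm + 3)%N%:Z * s = Bm%:Z * (3 * s) + 3 * s by rewrite PoszD PoszM; ring.
  apply: lerD; first exact: ler_pM.
  by rewrite /s; move: c0 k0 (size S); clear; lia.
have GE P : P \in G -> [/\ P \notin S, kap D P <= 0, rho P = 0 & vge P 1 f.@[U u l]].
  by case/GG/and5P => PS Pk /eqP Pr _ zP; split=> //; rewrite vgeE.
have GkE P : P \in G -> kp D P = 0.
  by case/GE => _ Pk _ _; apply/eqP; rewrite eq_le kk0 andbT /kp ge_max lexx.
have UB := upper_bound ff hg char0 dD D0 bkp u0 uS Sunit bM pf fh sf sh bZ rfZ rhZ ind dN wf wE wE' ws' smallN uG.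
have {}UB := UB (fun P PG => let: And4 a _ _ _ := GE P PG in a).
have {}UB := UB (fun P PG => let: And4 _ a _ _ := GE P PG in a).
have GrZ P : P \in G -> rZ P = 0.
  by move=> PG; have [PS _ Pr _] := GE P PG; rewrite /rZ /sigS (GkE P PG) Pr (negPf PS).
have {}UB := UB GrZ (fun P PG => let: And4 _ _ _ a := GE P PG in a).
have {}UB := UB (fun P PG => goodzero_twist ff char0 dD D0 ck u0 uS Sunit sf g00 de yE rh z0 w0 (GG P PG)).
rewrite !card_prod !card_ord card_bmnm in UB.
have dl : (mdeg (mlead f) <= Dg)%N by rewrite -ltnS (mlead_deg f0); exact: sf.
have HI := card_ideal_index sh dN; have := HN _ _ dl (leqnn Dg); rewrite -HI.
move: UB; set r := #|_|; set R := nmono n N => UB Hr.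
have mon x : (nmono n (N - x) <= R)%N by apply: nmono_mono; exact: leq_subr.
have r0' : (0 < r)%N.
  have := nmono_mono n (_ : N - mdeg (mlead f) - Dg <= N - mdeg (mlead f))%N.
  move/(_ (leq_subr _ _)); have := nmono_gt0 n (N - Dg); move: HI; rewrite -/r; clear; lia.
have r2 : (r <= 2 * R)%N.
  by have := mon (mdeg (mlead f)); have := mon Dg; move: HI; rewrite -/r; clear; lia.
have HR : (4 * A * R <= 4 * A * r + R)%N.
  have E4A : (4 * A1 * N = 4 * A)%N by rewrite /A -mulnA [(A1 * N)%N]mulnC.
  by move: Hr; rewrite E4A !mulnDr addnAC leq_add2r.
have gr := slot_growth A0 HR dq.
have [d0 dle] := andP (dimb q).
have T0 : (0 < dim q * r)%N by rewrite muln_gt0 d0.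
have Tle : (dim q * r <= Tm)%N.
  apply: leq_mul => //; apply: leq_trans dle _; exact: leq_exp2r'.
rewrite E4 in HG.
have HA1 : A1%:Z = E%:Z * (2 * n * H0)%N%:Z + 1 by rewrite /A1 PoszD PoszM.
rewrite PoszM in UB.
move: UB; set R2 := _ + (size S)%:Z => UB.
have := zero_count (l := l%:Z) T0 N0 isT (isT : 0 <= (2 * n * H0)%N%:Z) gr HA1 UB HG.
apply/negP; rewrite -ltNge; apply: le_lt_trans part2; rewrite -PoszM; apply: ler_wpM2l => //.
have R2s : R2 <= (3 * Bm + 2)%N%:Z * s.
  have -> : (3 * Bm + 2)%N%:Z * s = Bm%:Z * (3 * s) + 2 * s by rewrite PoszD PoszM; ring.
  rewrite /R2 -addrA; apply: lerD; first exact: ler_pM.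
  by rewrite /s; move: c0 k0 (size S); clear; lia.
have R20 : 0 <= R2 by rewrite /R2 !addr_ge0 // !mulr_ge0.
have -> : (Tm * (3 * Bm + 2) + 7)%N%:Z * s = Tm%:Z * ((3 * Bm + 2)%N%:Z * s) + 7 * s by rewrite PoszD PoszM; ring.
apply: lerD; first exact: ler_pM.
by rewrite /s; move: c0 k0 (size S); clear; lia.
Qed.

(** Makes the pole mass of the derivation linear in [ch] once the height is bounded by [h0]. *)
Lemma kappa_bound (h0 g : nat) (x ch : int) : 0 <= x -> x <= h0%:Z -> 1 <= ch -> g%:Z <= ch ->
  4 * x * (g.+1%:Z * x + 1) <= (4 * h0 * (2 * h0 + 1))%N%:Z * ch.
Proof.
move=> x0 xh ch1 gch.
have gx : g.+1%:Z * x <= 2 * ch * h0%:Z by apply: ler_pM => //; lia.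
have -> : (4 * h0 * (2 * h0 + 1))%N%:Z * ch = 4 * h0%:Z * (2 * ch * h0%:Z + ch).
  by rewrite !PoszM PoszD PoszM; ring.
have gx0 : 0 <= g.+1%:Z * x by rewrite mulr_ge0.
apply: ler_pM; [by rewrite mulr_ge0 | by rewrite addr_ge0 | exact: ler_wpM2l | exact: lerD].
Qed.

(** * Heights of the factors of F and of the units *)

Section Heights.
Variables (k : closedFieldType) (K : fieldType) (iota : {rmorphism k -> K}).
Notation place := (place iota).
Variables (g : nat).
Hypothesis ff : is_function_field iota.
Hypothesis hg : is_genus iota g.
Variable n : nat.
Implicit Types (A f h F : {mpoly K[n]}) (P : place).

Lemma vpolyC P (c : K) : c != 0 -> vpoly P (c%:MP : {mpoly K[n]}) = P c.
Proof. by move=> c0; rewrite /vpoly msuppC (negPf c0) /= mcoeffC eqxx mulr1. Qed.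

Lemma vpolyZ P c A : c != 0 -> A != 0 -> vpoly P (c *: A) = P c + vpoly P A.
Proof.
move=> c0 A0; rewrite -mul_mpolyC vpolyM ?vpolyC //.
by rewrite mpolyC_eq0.
Qed.

Lemma vpolyX P A e : A != 0 -> vpoly P (A ^+ e) = e%:Z * vpoly P A.
Proof.
move=> A0; elim: e => [|e IH].
  by rewrite expr0 mul0r -mpolyC1 vpolyC ?oner_eq0 // place1.
by rewrite exprS vpolyM ?expf_neq0 // IH intS mulrDl mul1r.
Qed.

Lemma vpoly_le0 P A m : A@_m = 1 -> vpoly P A <= 0.
Proof.
move=> A1; have := vge_vpoly P A m; rewrite A1 vgeE ?oner_eq0 //.
by rewrite place1.
Qed.

Lemma vpoly_cover A : A != 0 -> exists s : seq place, forall P, P \notin s -> vpoly P A = 0.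
Proof.
move=> A0.
have [s Hs] : exists s : seq place, forall P, P \notin s -> forall m, m \in msupp A -> P A@_m = 0.
  have : forall m, m \in msupp A -> A@_m != 0 by move=> m; rewrite mcoeff_msupp.
  elim: (msupp A) => [|m r IH] H; first by exists [::].
  have [|s Hs] := IH; first by move=> m' m'r; apply: H; rewrite inE m'r orbT.
  have [t [_ st ct]] := cover_list ff hg s (H m (mem_head _ _)).
  exists t => P Pt m'; rewrite inE => /orP[/eqP ->|]; first exact: (proj2 ct).
  by apply: Hs; apply: contra Pt => /st.
exists s => P Ps; have [_ [m mA <-]] := vpolyP P A0; exact: Hs.
Qed.

(** A coefficient equal to 1 makes the Gauss valuations of f and h nonpositive at every place, so
    they cannot cancel each other in that of F. The scalar a contributes degree 0 by the product
    formula. *)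
Lemma htilde_bounds (a : K) f h e : (0 < e)%N -> a != 0 -> (exists m, f@_m = 1) -> (exists m, h@_m = 1) ->
  let F := a *: (f ^+ e * h) in
  bdd (fun P => - vpoly P f - vpoly P h) (htilde iota F) /\ bdd (@pol k K iota a) (htilde iota F).
Proof.
move=> e0 a0 [mf f1] [mh h1] F.
have nz A m : A@_m = 1 -> A != 0.
  by move=> A1; apply/eqP => A0; move/eqP: A1; rewrite A0 mcoeff0 eq_sym oner_eq0.
have f0 := nz _ _ f1; have h0 := nz _ _ h1.
have vF P : vpoly P F = P a + (e%:Z * vpoly P f + vpoly P h).
  by rewrite /F vpolyZ ?mulf_neq0 ?expf_neq0 // vpolyM ?expf_neq0 // vpolyX.
have F0 : F != 0 by rewrite scaler_eq0 negb_or a0 mulf_neq0 ?expf_neq0.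
have fle P := vpoly_le0 P f1; have hle P := vpoly_le0 P h1.
have [sF HsF] := vpoly_cover F0.
have cov s : uniq s -> exists t, [/\ uniq t, {subset s <= t}, covers t (fun P => P a) &
    htilde iota F = \sum_(P <- t) - Num.min 0 (vpoly P F)].
  move=> us; have [t [ut st ct]] := cover_list ff hg (s ++ sF) a0; exists t; split=> //.
    by move=> P Ps; apply: st; rewrite mem_cat Ps.
  rewrite /htilde (@fsumE _ _ _ t) ?sumrN //; split=> // P Pt; rewrite HsF ?minxx //.
  by apply: contra Pt => PF; apply: st; rewrite mem_cat PF orbT.
split; split=> [P|s us].
- by have := fle P; have := hle P; lia.
- have [t [ut st ct ->]] := cov s us.
  apply: le_trans (sum_subset _ us ut st) _; first by move=> P; have := fle P; have := hle P; lia.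
  have -> : \sum_(P <- t) (- vpoly P f - vpoly P h) = \sum_(P <- t) (- vpoly P f - vpoly P h - P a).
    by rewrite [RHS]sumrB (product_formula hg a0 ct) subr0.
  apply: ler_sum => P _.
  rewrite vF; have := fle P; have := hle P; move: (vpoly P f) (vpoly P h) (P a) => x z w; nia.
- by rewrite /pol le_max lexx.
have [t [ut st ct ->]] := cov s us.
apply: le_trans (sum_subset _ us ut st) _; first by move=> P; rewrite /pol le_max lexx.
apply: ler_sum => P _; rewrite vF /pol; have := fle P; have := hle P.
by move: (vpoly P f) (vpoly P h) (P a) => x z w; nia.
Qed.

Lemma valuation_mass (u : 'I_n -> K) (H : int) : (forall j, u j != 0) -> (forall j, height iota (u j) <= H) ->
  bdd (fun P => \sum_(j < n) `|P (u j)|) (2 * n%:Z * H).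
Proof.
move=> u0 uH; have H1 j : bdd (fun P : place => `|P (u j)|) (2 * H).
  have bp := height_bdd ff hg (u0 j); have bz := pol_bdd ff hg bp (u0 j).
  apply: (bddW (sigma := fun P => @pol _ _ iota (u j) P + @zer _ _ iota (u j) P) (c := height iota (u j) + height iota (u j))).
  - by [].
  - by move=> P; rewrite /pol /zer; plia.
  - by have := uH j; lia.
  - exact: bddD.
have -> : 2 * n%:Z * H = \sum_(j < n) 2 * H; last exact: bdd_sum.
by rewrite sumr_const card_ord -mulr_natl natz; ring.
Qed.

End Heights.

Theorem theorem1p3 :
  forall (d n : nat), (2 <= d)%N ->
  exists (M : nat -> int -> nat) (C1 C2 : nat -> int -> rat),
    (forall D H, (0 < M D H)%N) /\
    forall (k : closedFieldType) (K : fieldType) (iota : {rmorphism k -> K}),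
      [pchar k] =i pred0 ->
      is_function_field iota ->
      forall (g : nat), is_genus iota g ->
      forall (S : seq (place iota)), List.NoDup S ->
      forall (F : {mpoly K[n]}),
        (forall (a : K) (i : 'X_{1..n}) (G : {mpoly K[n]}),
            a != 0 -> F != a *: 'X_[i] * G ^+ d) ->
      forall (u : 'I_n -> K), (forall j, S_unit S (u j)) ->
      let D := mtdeg F in
      let H := \big[Num.max/0]_(j < n) height iota (u j) in
      forall l : int,
        (C1 D H * (htilde iota F)%:~R
           + C2 D H * (Num.max 1 (2 * g%:Z - 2 + (size S)%:Z))%:~R <= l%:~R) ->
        (exists y : K, F.@[fun j => u j ^ l] = y ^+ d) ->
        exists mm : 'I_n -> int,
          (exists j, mm j != 0) /\
          (\sum_(j < n) `|mm j| <= 2 * (M D H)%:Z) /\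
          (exists c : k, \prod_(j < n) u j ^ mm j = iota c).
Proof.
move=> d n d2.
have [Nf [Cf coreP]] : exists Nf Cf : nat -> nat -> nat,
    forall D H0, bounded_exponent n D H0 (Nf D H0) (Cf D H0).
  have [Nf HN] := choice_fun (fun p : nat * nat => bounded_exponent_exists n p.1 p.2).
  have [Cf HC] := choice_fun HN.
  by exists (fun D H0 => Nf (D, H0)), (fun D H0 => Cf (D, H0)) => D H0; exact: (HC (D, H0)).
(* With eta = [htilde F] and chi the maximum in the statement, [kappa_bound] and |S| at most 3 chi
   bound c + ck + |S| by the inner factor times eta + chi; the final 1 makes the inequality
   strict. *)
pose C0 D (H : int) : nat := let h := absz H in (Cf D h * (4 * h * (2 * h + 1) + 3) + 1)%N.
exists (fun D H => (Nf D (absz H)).+1), (fun D H => (C0 D H)%:R), (fun D H => (C0 D H)%:R); split=> // k K iota char0 ff g hg S uS F HF u uunit D H l big [y yE].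
apply: NNPP => none.
have u0 j : u j != 0 by case: (uunit j).
have Sunit j P : P \notin S -> P (u j) = 0.
  by move=> PS; apply: (proj2 (uunit j)) => /List_InP; apply/negP.
have {}uS : uniq S by apply/List_NoDupP.
have hle j : height iota (u j) <= H by rewrite /H (bigD1 j) //= le_max lexx.
have H0 : 0 <= H by rewrite /H; elim/big_ind: _ => // [x z x0 _|j _]; [rewrite le_max x0 | exact: bdd_ge0 (height_bdd ff hg (u0 j))].
have [h0 HE] : exists h0 : nat, H = h0%:Z by exists (absz H); rewrite gez0_abs.
have bM := valuation_mass ff hg u0 hle.
rewrite HE /= in big none bM *; clearbody H.
have ind : mult_indep iota u (Nf D h0).
  move=> mm nz le c; apply/eqP => E; apply: none; exists mm; split=> //; split; last by exists c.
  by apply: le_trans le _; lia.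
have [F0 [f [e [h [pf nmf FE fh de]]]]] := prime_split d2 HF.
have [f0 _ _] := pf.
have h1 : h != 0 by apply: contraNneq F0 => h1; rewrite FE h1 mulr0.
have [m1 [m2 [m12 fm1 _]]] := nonmono_coeffs f0 nmf.
(* Without variables there is only one monomial. A nonconstant u_j is needed to build the
   derivation. *)
have [j0 _] : exists j0 : 'I_n, True.
  by apply: NNPP => no; case/eqP: m12; apply/mnmP => j; case: no; exists j.
have nu : nonconst iota (u j0).
  move=> c; apply/eqP => E; apply: none; exists (fun j => (j == j0)%:Z); split; first by exists j0; rewrite eqxx.
  split; last first.
    exists c; rewrite (bigD1 j0) //= eqxx expr1z big1 ?mulr1 // => j /negPf ->.
    by rewrite expr0z.
  rewrite (bigD1 j0) //= eqxx big1 ?addr0 //= => j /negPf -> //.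
have [delta [dD dn bk]] := vector_field ff hg char0 nu.
set ck := (X in bdd _ X) in bk.
(* Scaling both factors to leading coefficient 1 puts them in the form required by [htilde_bounds];
   [g0] collects the scalars. *)
pose a := f@_(mlead f); pose b := h@_(mlead h).
have a0 : a != 0 by rewrite mleadc_eq0.
have b0 : b != 0 by rewrite mleadc_eq0.
pose f' := a^-1 *: f; pose h' := b^-1 *: h; pose g0 := a ^+ e * b.
have g00 : g0 != 0 by rewrite mulf_neq0 ?expf_neq0.
have fE : f = a *: f' by rewrite scalerA divff // scale1r.
have hE : h = b *: h' by rewrite scalerA divff // scale1r.
have FE' : F = g0 *: (f' ^+ e * h') by rewrite FE {1}fE {1}hE exprZn -scalerAl -scalerAr scalerA.
have e0 : (0 < e)%N by rewrite lt0n; apply: contraNneq de => ->; rewrite dvdn0.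
have [] := htilde_bounds ff hg (a := g0) (f := f') (h := h') e0 g00.
- by exists (mlead f); rewrite mcoeffZ mulVf.
- by exists (mlead h); rewrite mcoeffZ mulVf.
rewrite -FE' => br bg.
set eta := htilde iota F in big br bg.
set chi : int := Num.max 1 _ in big.
have eta0 := bdd_ge0 br.
have chi1 : 1 <= chi by rewrite /chi le_max lexx.
have {}big : (C0 D h0)%:Z * (eta + chi) <= l.
  by move: big; rewrite -mulrDr -intrD -[(C0 D h0)%:R]/((C0 D h0)%:Z%:~R) -intrM ler_int.
have l0 : 0 <= l by apply: le_trans big; rewrite mulr_ge0 // addr_ge0 // (le_trans _ chi1).
case: l l0 big yE => // l _ big yE.
have pf' : rprime f' by apply: rprime_scale => //; rewrite invr_eq0.
have nmf' : ~ ismono f' by move=> [c [m E]]; apply: nmf; exists (a * c), m; rewrite fE E scalerA.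
have fh' : ~ rdiv f' h'.
  by move=> [q E]; apply: fh; exists ((b / a) *: q); rewrite {1}hE E {1}/f' -scalerAl scalerA -scalerAr.
have h'0 : h' != 0 by rewrite scaler_eq0 invr_eq0 negb_or b0.
have sfh : (msize h' + msize f' <= D.+2)%N.
  rewrite /f' /h' !msizeZ ?invr_eq0 // /D /mtdeg FE msizeM ?expf_neq0 // -(prednK e0) exprS msizeM ?expf_neq0 //.
  have : (0 < msize h)%N by rewrite lt0n msize_poly_eq0.
  have : (0 < msize f)%N by rewrite lt0n msize_poly_eq0.
  have : (0 < msize (f ^+ e.-1))%N by rewrite lt0n msize_poly_eq0 expf_neq0.
  by move: (msize h) (msize f) (msize _) => x z w; clear; lia.
have yE' : f'.@[U u l] ^+ e * (g0 * h'.@[U u l]) = y ^+ d.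
  by rewrite -yE FE' [RHS]mevalZ [X in _ = _ * X]mevalM [X in _ = _ * (X * _)]rmorphXn mulrCA.
have fle (P : place iota) : vpoly P f' <= 0 by apply: (@vpoly_le0 _ _ _ _ _ _ (mlead f)); rewrite mcoeffZ mulVf.
have hl (P : place iota) : vpoly P h' <= 0 by apply: (@vpoly_le0 _ _ _ _ _ _ (mlead h)); rewrite mcoeffZ mulVf.
have rf m (P : place iota) : vge P (- (- vpoly P f' - vpoly P h')) (f'@_m).
  by apply: vgeW (vge_vpoly P f' m); rewrite opprB opprK gerDr.
have rh m (P : place iota) : vge P (- (- vpoly P f' - vpoly P h')) (h'@_m).
  by apply: vgeW (vge_vpoly P h' m); rewrite opprB opprK gerDl.
have := coreP D h0 k K iota char0 ff g hg delta dD dn ck bk u S u0 uS Sunit bM l f' h' y g0 d e _ eta pf' nmf' fh' h'0 sfh g00 de yE' br rf rh bg (pol_bdd ff hg bg g00) ind.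
apply/negP; rewrite -ltNge; apply: lt_le_trans big.
(* If g is at least 2 then g is at most 2g - 2, and otherwise at most 1. Likewise |S| is at most chi
   + 2 - 2g, hence at most 3 chi. *)
have gchi : g%:Z <= chi by rewrite /chi; move: (size S); clear; lia.
have Schi : (size S)%:Z <= 3 * chi by rewrite /chi; move: (size S); clear; lia.
have hu0 := bdd_ge0 (height_bdd ff hg (u0 j0)).
have ckle : ck <= (4 * h0 * (2 * h0 + 1))%N%:Z * chi.
  by have := hle j0; rewrite HE => /(kappa_bound hu0); apply.
rewrite /C0 /= PoszD PoszM mulrDl mul1r; move: (Cf D h0) => cc.
apply: (@le_lt_trans _ _ (cc%:Z * ((4 * h0 * (2 * h0 + 1) + 3)%N%:Z * (eta + chi)))); last first.
  by rewrite mulrA ltrDl ltr_wpDl // (lt_le_trans ltr01).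
apply: ler_wpM2l => //; rewrite PoszD mulrDl; move: (4 * h0 * (2 * h0 + 1))%N ckle => w ckle.
have := mulr_ge0 (isT : 0 <= w%:Z) eta0.
move: eta0 chi1 ckle Schi; move: (eta) (chi) (ck) (size S); clear; lia.
Qed.
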